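(* Assume hypothesis (H), $\mathbb{E}(f^2(X))<+\infty$, and $k/N^k\to 0$ as $k\to\infty$. Then, whether the allocations are computed with rule (a) at every step or with rule (b) at every step, the adaptive stratified estimator satisfies $$\sqrt{N^k}\,\big(\hat c^k-c\big)\xrightarrow[k\to\infty]{\text{in law}}\mathcal N(0,\sigma_*^2).$$
   Context: Setting. $X$ is an $\mathbb{R}^d$-valued random variable, $f:\mathbb{R}^d\to\mathbb{R}$ is measurable, and $(A_i)_{1\le i\le I}$ is a measurable partition of $\mathbb{R}^d$ with $p_i=\mathbb{P}(X\in A_i)>0$ known for all $i$. $X_i$ denotes a random variable with the conditional law of $X$ given $X\in A_i$, and $c=\mathbb{E}f(X)=\sum_{i=1}^I p_i\mathbb{E}f(X_i)$. When $\mathbb{E}f^2(X)<\infty$: $\sigma_i^2=\mathrm{Var}(f(X_i))$, $\sigma_*=\sum_{i=1}^I p_i\sigma_i$, and (when $\sigma_*>0$) $q_i^*=p_i\sigma_i/\sigma_*$. Hypothesis (H): $\sigma_i>0$ for at least one index $i$. $(X_i^j)_{1\le i\le I,\,j\ge 1}$ are independent random variables, $X_i^j$ having the law of $X_i$. Adaptive algorithm. Fix deterministic integers $0=N^0<N^1<N^2<\cdots$ with $N^k-N^{k-1}\ge I$ for all $k\ge1$, and set $N_i^0=0$ for all $i$. For each step $k\ge1$: (1) If $k=1$ set $\hat\sigma_i^0=1$ for all $i$; if $k>1$ set $\hat\sigma_i^{k-1}\ge 0$ by $(\hat\sigma_i^{k-1})^2=\frac{1}{N_i^{k-1}}\sum_{j=1}^{N_i^{k-1}}f(X_i^j)^2-\big(\frac{1}{N_i^{k-1}}\sum_{j=1}^{N_i^{k-1}}f(X_i^j)\big)^2$.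 (2) Let $L_k=N^k-N^{k-1}-I$. If $\hat\sigma_i^{k-1}=0$ for all $i$, set $m_i^k=p_iL_k$. Otherwise compute $m_i^k\ge0$ by the chosen rule: Rule (a): $m_i^k=\frac{p_i\hat\sigma_i^{k-1}}{\sum_{j=1}^I p_j\hat\sigma_j^{k-1}}L_k$. Rule (b): set $m_i^k=0$ for every $i$ with $\hat\sigma_i^{k-1}=0$. Let $J$ be the set of the remaining indices, and for $i\in J$ put $n_i=N_i^{k-1}+1$, $\alpha_i=p_i\hat\sigma_i^{k-1}$. Enumerate $J$ as $(1),\dots,(|J|)$ so that $n_{(i)}/\alpha_{(i)}$ is nonincreasing in $i$. Let $i^*$ be the largest $i\in\{1,\dots,|J|-1\}$ such that $\frac{n_{(i)}}{\alpha_{(i)}}\ge\frac{L_k+\sum_{j=i+1}^{|J|}n_{(j)}}{\sum_{j=i+1}^{|J|}\alpha_{(j)}}$, and $i^*=0$ if there is no such $i$. Set $m_{(i)}^k=0$ for $i\le i^*$ and $m_{(i)}^k=\alpha_{(i)}\frac{L_k+\sum_{j=i^*+1}^{|J|}n_{(j)}}{\sum_{j=i^*+1}^{|J|}\alpha_{(j)}}-n_{(i)}$ for $i>i^*$. (3) (Systematic sampling) $\tilde m_i^k=\lfloor m_1^k+\dots+m_i^k\rfloor-\lfloor m_1^k+\dots+m_{i-1}^k\rfloor$ (second term $0$ for $i=1$), and $N_i^k=N_i^{k-1}+1+\tilde m_i^k$; thus $\sum_i N_i^k=N^k$ and at least one new drawing is made in each stratum. (4) The estimator after step $k$ is $\hat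 c^k=\sum_{i=1}^I\frac{p_i}{N_i^k}\sum_{j=1}^{N_i^k}f(X_i^j)$. *)

(* Defs.v *)
From HB Require Import structures.
From mathcomp Require Import all_boot all_order all_algebra.
From mathcomp Require Import all_classical all_reals all_analysis.
From mathcomp Require Import normal_distribution.

Set Implicit Arguments.
Unset Strict Implicit.
Unset Printing Implicit Defensive.

Import Order.TTheory GRing.Theory Num.Theory.
Import numFieldNormedType.Exports.

Local Open Scope classical_set_scope.
Local Open Scope ring_scope.

Definition mutually_independent (R : realType) (d : measure_display)
  (Omega : measurableType d) (P : probability Omega R)
  (d' : measure_display) (E : measurableType d') (T : eqType)
  (Y : T -> Omega -> E) : Prop :=
  forall (J : seq T) (B : T -> set E), uniq J ->
    (forall t, t \in J -> measurable (B t)) ->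
    P (\bigcap_(t in [set t | t \in J]) (Y t @^-1` B t)) =
    (\prod_(t <- J) P (Y t @^-1` B t))%E.

Definition has_cond_law (R : realType) (d : measure_display)
  (Omega : measurableType d) (P : probability Omega R)
  (d' : measure_display) (E : measurableType d')
  (X : Omega -> E) (A : set E) (Y : Omega -> E) : Prop :=
  forall B : set E, measurable B ->
    P (Y @^-1` B) = (fine (P (X @^-1` (B `&` A))) / fine (P (X @^-1` A)))%:E.

Definition cond_expect (R : realType) (d : measure_display)
  (Omega : measurableType d) (P : probability Omega R)
  (d' : measure_display) (E : measurableType d')
  (X : Omega -> E) (A : set E) (g : E -> R) : R :=
  fine (\int[P]_(w in X @^-1` A) (g (X w))%:E) / fine (P (X @^-1` A)).

Definition cond_var (R : realType) (d : measure_display)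
  (Omega : measurableType d) (P : probability Omega R)
  (d' : measure_display) (E : measurableType d')
  (X : Omega -> E) (A : set E) (f : E -> R) : R :=
  cond_expect P X A (fun x => (f x - cond_expect P X A f) ^+ 2).

Definition cvg_in_law (R : realType) (d : measure_display)
  (Omega : measurableType d) (P : probability Omega R)
  (Z : nat -> Omega -> R) (mu : probability (measurableTypeR R) R) : Prop :=
  forall g : R -> R, continuous g -> (exists M : R, forall x, `|g x| <= M) ->
    (fun k => \int[P]_w (g (Z k w))%:E)%E @ \oo --> (\int[mu]_x (g x)%:E)%E.

Inductive alloc_rule := RuleA | RuleB.

Section Algorithm.
Variables (R : realType) (I : nat).
(* p i = P(X \in A_i); N k = N^k; Y i j = f(X_i^{j+1}) (samples indexed from 0) *)
Variables (p : 'I_I -> R) (N : nat -> nat) (Y : 'I_I -> nat -> R).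

Definition emp_sd (n : nat) (i : 'I_I) : R :=
  Num.sqrt ((\sum_(j < n) Y i j ^+ 2) / n%:R - ((\sum_(j < n) Y i j) / n%:R) ^+ 2).

Definition ruleA (sh : 'I_I -> R) (L : R) (i : 'I_I) : R :=
  p i * sh i / (\sum_(j < I) p j * sh j) * L.

(* rule (b); n0 i = N_i^{k-1}, sh i = hat sigma_i^{k-1} *)
Definition ruleB (n0 : 'I_I -> nat) (sh : 'I_I -> R) (L : R) (i : 'I_I) : R :=
  let nn j := (n0 j).+1%:R in
  let al j := p j * sh j in
  let J := [seq j <- enum 'I_I | sh j != 0] in
  let s := sort (fun x y => nn y / al y <= nn x / al x) J in
  let ns := map nn s in
  let als := map al s in
  (* cond t : the inequality for index t (1-based) *)
  let cond t := (L + \sum_(x <- drop t ns) x) / (\sum_(x <- drop t als) x)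
                  <= ns`_(t.-1) / als`_(t.-1) in
  let istar := (\max_(t < size s | (0 < (t : nat))%N && cond (t : nat)) (t : nat))%N in
  if (sh i == 0) || (i \in take istar s) then 0
  else al i * (L + \sum_(x <- drop istar ns) x) / (\sum_(x <- drop istar als) x) - nn i.

Fixpoint alloc (r : alloc_rule) (k : nat) : 'I_I -> nat :=
  match k with
  | 0 => fun _ => 0%N
  | k'.+1 =>
      let prev := alloc r k' in
      let sh i := if k' == 0%N then 1 else emp_sd (prev i) i in
      let L : R := (N k'.+1 - N k' - I)%N%:R in
      let m i := if [forall j, sh j == 0] then p i * L
                 else match r with
                      | RuleA => ruleA sh L i
                      | RuleB => ruleB prev sh L i
                      end in
      let S i := \sum_(j < I | (j <= i)%N) m j in
      let S' i := \sum_(j < I | (j < i)%N) m j in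
      fun i => (prev i + 1 + `|Num.floor (S i) - Num.floor (S' i)|)%N
  end.

Definition estimator (r : alloc_rule) (k : nat) : R :=
  \sum_(i < I) p i / (alloc r k i)%:R * \sum_(j < alloc r k i) Y i j.

End Algorithm.

(* Main.v *)
Require Import Defs.
From HB Require Import structures.
From mathcomp Require Import all_boot all_order all_algebra.
From mathcomp Require Import all_classical all_reals all_analysis.
From mathcomp Require Import normal_distribution measurable_realfun zify ring lra.
Import Order.TTheory GRing.Theory Num.Theory.
Import numFieldNormedType.Exports.
Local Open Scope classical_set_scope.
Local Open Scope ring_scope.

Set Implicit Arguments.
Unset Strict Implicit.
Unset Printing Implicit Defensive.

(* At least one draw per step sends all sample sizes to infinity, so by the strong law
   of large numbers the empirical standard deviations converge almost surely to
   sigma_i. Under both rules a step raises the size of stratum i to at most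
   max(N_i + 2 + q (N^k - N^(k-1)), q N^k + 2), where q is the current estimate of q_i^*
   (rule (b) is a water-filling); with k = o(N^k) this gives limsup N_i^k / N^k <= q_i^*,
   and equality follows because both sides sum to 1. Hence the random sizes N_i^k may be
   replaced, up to a quantity tending to 0 in probability, by deterministic ones close to
   q_i^* N^k: the difference of the two sums is controlled by Kolmogorov's maximal
   inequality on a window of length eta N^k (Anscombe's argument), uniformly in the
   dependence between sizes and samples. The deterministic sums, rescaled in each stratum
   to the common variance sigma_*^2, obey Lindeberg's central limit theorem, proved by
   replacing the summands by Gaussian ones one at a time. *)

(** * Real-valued expectations *)

(** The obstacle is that the sizes [N_i^k] are functions of the very samples that they count, so the
    sums cannot be treated conditionally on their lengths. In the strata with sigma_i > 0 the
    comparison with deterministic sizes uses only that [N_i^k / N^k] converges in probability. The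
    hypothesis k = o(N^k) pays for the forced draw and the rounding: each step may give a stratum up
    to 2 draws beyond its computed allocation, hence up to 2k after k steps. Only an upper bound on
    the sizes is proved step by step, because a lower bound of the same kind fails for rule (b),
    where a stratum that is already too large receives its forced draw alone. Strata with sigma_i =
    0 cannot be rescaled to the common variance. They carry no Gaussian part, and their centred sums
    are shown separately to vanish with probability one. Rule (b) is defined by sorting, which hides
    both its size and its measurability; both are recovered from the water level. *)

Section measurable_sets.
Context d (T : measurableType d) (R : realType).

Lemma measurable_set_bool (b : T -> bool) :
  measurable_fun setT b -> measurable [set x | b x].
Proof.
by move=> mb; have := mb measurableT [set true] I; rewrite setTI.
Qed.

Lemma measurable_set_le (f g : T -> R) : measurable_fun setT f ->
  measurable_fun setT g -> measurable [set x | f x <= g x].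
Proof. by move=> mf mg; apply: measurable_set_bool; exact: measurable_fun_ler. Qed.

Lemma measurable_set_lt (f g : T -> R) : measurable_fun setT f ->
  measurable_fun setT g -> measurable [set x | f x < g x].
Proof. by move=> mf mg; apply: measurable_set_bool; exact: measurable_fun_ltr. Qed.

End measurable_sets.

Section expectation.
Context d (T : measurableType d) (R : realType) (mu : probability T R).
Implicit Types f g : T -> R.

Definition integrableR f := mu.-integrable setT (EFin \o f).
Definition sq_integrable f :=
  measurable_fun setT f /\ integrableR (fun x => f x ^+ 2).

Lemma integrableR_measurable f : integrableR f -> measurable_fun setT f.
Proof. by move=> /integrableP[/measurable_EFinP]. Qed.

Lemma integrableR_le f g : measurable_fun setT f ->
  (forall x, `|f x| <= g x) -> integrableR g -> integrableR f.
Proof.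
move=> mf fg; apply: le_integrable => //; first exact/measurable_EFinP.
by move=> x _ /=; rewrite lee_fin (le_trans (fg x))// ler_norm.
Qed.

Lemma integrableR_cst c : integrableR (fun=> c).
Proof. exact: finite_measure_integrable_cst. Qed.

Lemma integrableR_bounded f M : measurable_fun setT f ->
  (forall x, `|f x| <= M) -> integrableR f.
Proof. by move=> mf fM; apply: integrableR_le fM _ => //; exact: integrableR_cst. Qed.

Lemma integrableRD f g : integrableR f -> integrableR g ->
  integrableR (fun x => f x + g x).
Proof. by move=> hf hg; have := integrableD measurableT hf hg. Qed.

Lemma integrableRB f g : integrableR f -> integrableR g ->
  integrableR (fun x => f x - g x).
Proof. by move=> hf hg; have := integrableB measurableT hf hg. Qed.

Lemma integrableRZ c f : integrableR f -> integrableR (fun x => c * f x).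
Proof. by move=> hf; have := integrableZl measurableT c hf. Qed.

Lemma integrableR_abs f : integrableR f -> integrableR (fun x => `|f x|).
Proof. exact: integrable_norm. Qed.

Lemma integrableR_sum I (s : seq I) (F : I -> T -> R) :
  (forall i, integrableR (F i)) -> integrableR (fun x => \sum_(i <- s) F i x).
Proof.
move=> hF; elim: s => [|i s ih].
  apply: eq_integrable (integrableR_cst 0) => // x _ /=.
  by rewrite big_nil.
apply: eq_integrable (integrableRD (hF i) ih) => // x _ /=.
by rewrite big_cons.
Qed.

Lemma RintegralT_D f g : integrableR f -> integrableR g ->
  \int[mu]_x (f x + g x) = \int[mu]_x f x + \int[mu]_x g x.
Proof. by move=> hf hg; rewrite RintegralD. Qed.

Lemma RintegralT_B f g : integrableR f -> integrableR g ->
  \int[mu]_x (f x - g x) = \int[mu]_x f x - \int[mu]_x g x.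
Proof. by move=> hf hg; rewrite RintegralB. Qed.

Lemma RintegralT_Z c f : integrableR f ->
  \int[mu]_x (c * f x) = c * \int[mu]_x f x.
Proof. by move=> hf; rewrite RintegralZl. Qed.

Lemma RintegralT_cst (c : R) : \int[mu]_x c = c.
Proof. by rewrite Rintegral_cst//= probability_setT mulr1. Qed.

Lemma RintegralT_sum I (s : seq I) (F : I -> T -> R) :
  (forall i, integrableR (F i)) ->
  \int[mu]_x (\sum_(i <- s) F i x) = \sum_(i <- s) \int[mu]_x F i x.
Proof.
move=> hF; elim: s => [|i s ih].
  rewrite big_nil -[RHS](RintegralT_cst 0).
  by apply: eq_Rintegral => x _; rewrite big_nil.
rewrite big_cons -ih -RintegralT_D//; last exact: integrableR_sum.
by apply: eq_Rintegral => x _; rewrite big_cons.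
Qed.

Lemma RintegralT_le f g : integrableR f -> integrableR g ->
  (forall x, f x <= g x) -> \int[mu]_x f x <= \int[mu]_x g x.
Proof. by move=> hf hg fg; apply: le_Rintegral. Qed.

Lemma RintegralT_norm_le f : integrableR f ->
  `|\int[mu]_x f x| <= \int[mu]_x `|f x|.
Proof. by move=> hf; apply: le_normr_Rintegral. Qed.

Lemma RintegralT_norm_bound f g : measurable_fun setT f ->
  (forall x, `|f x| <= g x) -> integrableR g ->
  `|\int[mu]_x f x| <= \int[mu]_x g x.
Proof.
move=> mf fg ig; have hf := integrableR_le mf fg ig.
apply: le_trans (RintegralT_norm_le hf) _.
by apply: RintegralT_le => //; exact: integrableR_abs.
Qed.

Lemma RintegralT_indic (A : set T) : measurable A ->
  \int[mu]_x (\1_A x : R) = fine (mu A).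
Proof. by move=> mA; rewrite /Rintegral integral_indic// setIT. Qed.

Lemma integrableR_indic (A : set T) : measurable A -> integrableR (\1_A : T -> R).
Proof. by move=> mA; exact: integrable_indic. Qed.

Lemma RintegralE f : integrableR f -> (\int[mu]_x (f x)%:E)%E = (\int[mu]_x f x)%:E.
Proof.
by move=> hf; rewrite /Rintegral fineK//; exact: integrable_fin_num.
Qed.

Lemma Rintegral_eq_measure (nu : probability T R) f :
  (forall A, measurable A -> mu A = nu A) -> \int[mu]_x f x = \int[nu]_x f x.
Proof.
by move=> mn; rewrite /Rintegral; congr fine; apply: eq_measure_integral => A mA _; exact: mn.
Qed.

Lemma markovR f (A : set T) a : measurable A -> 0 < a -> integrableR f ->
  (forall x, 0 <= f x) -> (forall x, A x -> a <= f x) ->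
  fine (mu A) <= (\int[mu]_x f x) / a.
Proof.
move=> mA a0 hf f0 fa; rewrite ler_pdivlMr// mulrC -RintegralT_indic// -RintegralT_Z.
  apply: RintegralT_le => //; first exact/integrableRZ/integrableR_indic.
  move=> x; rewrite indicE; case: (boolP (x \in A)) => [|_]; last by rewrite mulr0.
  by rewrite inE mulr1 => /fa.
exact: integrableR_indic.
Qed.

(** Since [(|f| - |g|)^2 >= 0], the product is dominated by [f^2 + g^2]. *)
Lemma sq_integrableM f g : sq_integrable f -> sq_integrable g ->
  integrableR (fun x => f x * g x).
Proof.
move=> [mf hf] [mg hg]; apply: integrableR_le (integrableRD hf hg).
  exact: measurable_funM.
move=> x; rewrite normrM -[f x ^+ 2]real_normK ?num_real//.
rewrite -[g x ^+ 2]real_normK ?num_real//.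
have := sqr_ge0 (`|f x| - `|g x|); have := sqr_ge0 (`|f x| + `|g x|).
have := normr_ge0 (f x); have := normr_ge0 (g x).
nra.
Qed.

Lemma sq_integrable_cst c : sq_integrable (fun=> c).
Proof. by split=> //; exact: integrableR_cst. Qed.

Lemma sq_integrable_integrable f : sq_integrable f -> integrableR f.
Proof.
move=> hf; have := sq_integrableM hf (sq_integrable_cst 1).
by apply: eq_integrable => // x _ /=; rewrite mulr1.
Qed.

Lemma sq_integrable_le f g : measurable_fun setT f ->
  (forall x, `|f x| <= `|g x|) -> sq_integrable g -> sq_integrable f.
Proof.
move=> mf fg [mg hg]; split=> //; apply: integrableR_le hg.
  exact: measurable_funX.
by move=> x; rewrite normrX -[leRHS]real_normK ?num_real// lerXn2r ?nnegrE.
Qed.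

Lemma sq_integrable_bounded f M : measurable_fun setT f ->
  (forall x, `|f x| <= M) -> sq_integrable f.
Proof.
move=> mf fM; apply: sq_integrable_le (sq_integrable_cst M) => // x.
by rewrite (le_trans (fM x))// ler_norm.
Qed.

Lemma sq_integrableD f g : sq_integrable f -> sq_integrable g ->
  sq_integrable (fun x => f x + g x).
Proof.
move=> hf hg; split; first by apply: measurable_funD; [case: hf|case: hg].
have := integrableRD (integrableRD hf.2 (integrableRZ 2 (sq_integrableM hf hg))) hg.2.
by apply: eq_integrable => // x _ /=; congr EFin; ring.
Qed.

Lemma sq_integrableZ c f : sq_integrable f -> sq_integrable (fun x => c * f x).
Proof.
move=> hf; split; first by apply: measurable_funM => //; case: hf.
have := integrableRZ (c ^+ 2) hf.2.
by apply: eq_integrable => // x _ /=; congr EFin; ring.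
Qed.

Lemma sq_integrable_sum I (s : seq I) (F : I -> T -> R) :
  (forall i, sq_integrable (F i)) -> sq_integrable (fun x => \sum_(i <- s) F i x).
Proof.
move=> hF; elim: s => [|i s ih].
  have -> : (fun x => \sum_(i <- [::]) F i x) = (fun=> 0).
    by apply/funext => x; rewrite big_nil.
  exact: sq_integrable_cst.
have -> : (fun x => \sum_(j <- i :: s) F j x) =
          (fun x => F i x + \sum_(j <- s) F j x).
  by apply/funext => x; rewrite big_cons.
exact: sq_integrableD.
Qed.

End expectation.

(** * Independence *)

Section independence.
Context d (Omega : measurableType d) (R : realType) (P : probability Omega R).

Lemma mutually_independent_comp d1 d2 (E1 : measurableType d1)
    (E2 : measurableType d2) (T : eqType) (Y : T -> Omega -> E1)
    (h : T -> E1 -> E2) :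
  (forall t, measurable_fun setT (h t)) -> mutually_independent P Y ->
  mutually_independent P (fun t => h t \o Y t).
Proof.
move=> mh iY J B uJ mB.
have mB' t : t \in J -> measurable (h t @^-1` B t).
  by move=> tJ; rewrite -[X in measurable X]setTI; apply: mh => //; exact: mB.
by have := iY J (fun t => h t @^-1` B t) uJ mB'.
Qed.

Lemma mutually_independent_reindex d1 (E : measurableType d1) (T T' : choiceType)
    (Y : T -> Omega -> E) (phi : T' -> T) :
  injective phi -> mutually_independent P Y ->
  mutually_independent P (fun t => Y (phi t)).
Proof.
move=> phi_inj iY J B uJ mB.
(* The events must be indexed by all of [T], and [phi] has no inverse at hand: this intersection is
   [B s] at [phi s] for [s \in J], by injectivity. *)
pose B' t := [set x | forall s, s \in J -> phi s = t -> B s x].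
have B'E s : s \in J -> B' (phi s) = B s.
  move=> sJ; apply/seteqP; split=> x /=; first by move=> /(_ s sJ erefl).
  by move=> Bx s' _ /phi_inj ->.
have := iY (map phi J) B'; rewrite map_inj_uniq// => /(_ uJ).
rewrite big_map => h.
transitivity (P (\bigcap_(t in [set t | t \in map phi J]) (Y t @^-1` B' t))).
  congr (P _); apply/seteqP; split=> w /=.
    move=> h1 t /= /mapP[s sJ ->]; rewrite /preimage /=.
    by rewrite B'E//; exact: h1.
  by move=> h1 s /= sJ; have := h1 (phi s) (map_f _ sJ); rewrite /preimage /= B'E.
rewrite h; last by move=> t /mapP[s sJ ->]; rewrite B'E//; exact: mB.
rewrite big_seq [RHS]big_seq; apply: eq_bigr => s sJ.
by rewrite B'E.
Qed.

Variables (T : choiceType) (xi : T -> Omega -> R).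

(** Cylinder events: a pi-system generating the sigma-algebra of the variables [xi t], [t \in J].
    Measurability from [g_sigma_algebraType (block J)] thus expresses being a function of these
    variables only. *)
Definition block (J : seq T) : set (set Omega) :=
  [set A | exists B : T -> set R, (forall t, measurable (B t)) /\
     A = \bigcap_(t in [set t | t \in J]) (xi t @^-1` B t)].

Hypothesis mxi : forall t, measurable_fun setT (xi t).

Lemma block_measurable J : block J `<=` measurable.
Proof.
move=> _ [B [mB ->]]; apply: fin_bigcap_measurable => [|t _].
  exact: finite_seq.
by rewrite -[X in measurable X]setTI; exact: mxi.
Qed.

Lemma block_setI J : setI_closed (block J).
Proof.
move=> _ _ [B [mB ->]] [C [mC ->]]; exists (fun t => B t `&` C t); split.
  by move=> t; exact: measurableI.
apply/seteqP; split=> w /=.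
  by move=> [h1 h2] t tJ; split; [exact: h1|exact: h2].
by move=> h; split=> t tJ; have [] := h t tJ.
Qed.

Lemma blockT J : block J setT.
Proof.
exists (fun=> setT); split=> //.
by apply/seteqP; split=> w.
Qed.

Lemma xi_block_measurable J t : t \in J ->
  measurable_fun (setT : set (g_sigma_algebraType (block J))) (xi t).
Proof.
move=> tJ _ B mB; rewrite setTI; apply: sub_sigma_algebra.
exists (fun s => if s == t then B else setT); split.
  by move=> s; case: ifP.
apply/seteqP; split=> w /=.
  by move=> Bw s sJ; rewrite /preimage /=; case: eqP => // ->.
by move=> /(_ t tJ); rewrite /preimage /= eqxx.
Qed.

Lemma block_measurable_fun J d' (E : measurableType d') (f : Omega -> E) :
  measurable_fun (setT : set (g_sigma_algebraType (block J))) f ->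
  measurable_fun setT f.
Proof.
move=> mf _ B mB; have := mf measurableT B mB.
rewrite !setTI; apply: (@smallest_sub _ (sigma_algebra setT) (block J)).
  exact: sigma_algebra_measurable.
exact: block_measurable.
Qed.

Hypothesis ixi : mutually_independent P xi.

(** Finite measures that agree on a pi-system agree on the sigma-algebra it generates; here the
    measures are [A |-> P (A & B)] and [P] scaled by [P B]. *)
Lemma indep_sigma_closure (G : set (set Omega)) B :
  G `<=` measurable -> setI_closed G -> G setT -> measurable B ->
  (forall A, G A -> P (A `&` B) = (P A * P B)%E) ->
  forall A, <<s G >> A -> P (A `&` B) = (P A * P B)%E.
Proof.
move=> Gm GI GT mB GB A sA.
have pB0 : 0 <= fine (P B) by exact/fine_ge0/measure_ge0.
have scaleE C : measurable C -> mscale (NngNum pB0) P C = (P C * P B)%E.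
  by move=> mC; rewrite /mscale /= fineK ?fin_num_measure// muleC.
rewrite -scaleE; last exact: (smallest_sub (@sigma_algebra_measurable _ _) Gm).
apply: (g_sigma_algebra_measure_unique G Gm (fun=> setT) (fun=> GT) _
  (mrestr P mB) (mscale (NngNum pB0) P)) => //; first by rewrite bigcup_const.
- by move=> C GC /=; rewrite /mrestr GB// scaleE//; exact: Gm.
- move=> _; apply: (@le_lt_trans _ _ 1%E); last exact: ltry.
  by apply: probability_le1; exact: measurableI.
Qed.

(** On two cylinders the formula is mutual independence for the concatenated list. It is then
    extended to the generated sigma-algebras one factor at a time. *)
Lemma block_indep J1 J2 A B : uniq (J1 ++ J2) ->
  <<s block J1 >> A -> <<s block J2 >> B -> P (A `&` B) = (P A * P B)%E.
Proof.
move=> uJ.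
have base A' B' : block J1 A' -> block J2 B' -> P (A' `&` B') = (P A' * P B')%E.
  move=> [C [mC ->]] [D [mD ->]].
  have := uJ; rewrite cat_uniq => /and3P[u1 /hasPn dis u2].
  pose F t := if t \in J1 then C t else D t.
  have F2 t : t \in J2 -> F t = D t by move=> /dis; rewrite /F => /negPf ->.
  have F1 t : t \in J1 -> F t = C t by rewrite /F => ->.
  have h J : {subset J <= J1 ++ J2} -> uniq J -> P (\bigcap_(t in [set t | t \in J])
      (xi t @^-1` F t)) = (\prod_(t <- J) P (xi t @^-1` F t))%E.
    by move=> _ uJ'; apply: ixi => // t _; rewrite /F; case: ifP.
  transitivity (P (\bigcap_(t in [set t | t \in J1 ++ J2]) (xi t @^-1` F t))).
    congr (P _); apply/seteqP; split=> w /=.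
      move=> [h1 h2] t /=; rewrite mem_cat => /orP[tJ|tJ]; rewrite /preimage/=.
        by rewrite F1//; exact: h1.
      by rewrite F2//; exact: h2.
    move=> h1; split=> t /= tJ; have := h1 t; rewrite /preimage /= mem_cat tJ ?orbT.
      by rewrite F1//; exact.
    by rewrite F2//; exact.
  rewrite h// big_cat/= -h// -?h//.
  - congr (P _ * P _)%E; apply: eq_bigcapr => t /= tJ; first by rewrite F1.
    by rewrite F2.
  - by move=> t tJ; rewrite mem_cat tJ orbT.
  - by move=> t tJ; rewrite mem_cat tJ.
have sm J C : <<s block J >> C -> measurable C.
  by apply: smallest_sub; [exact: sigma_algebra_measurable|exact: block_measurable].
move=> sA sB; move: A sA; apply: indep_sigma_closure; last first.
  move=> A bA; rewrite setIC muleC; move: B sB; apply: indep_sigma_closure.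
  - exact: block_measurable.
  - exact: block_setI.
  - exact: blockT.
  - exact: block_measurable bA.
  - by move=> B bB; rewrite setIC muleC; exact: base.
- exact: sm sB.
- exact: blockT.
- exact: block_setI.
- exact: block_measurable.
Qed.

Definition indep2 d1 d2 (E1 : measurableType d1) (E2 : measurableType d2)
    (U : Omega -> E1) (V : Omega -> E2) :=
  forall A B, measurable A -> measurable B ->
    P (U @^-1` A `&` V @^-1` B) = (P (U @^-1` A) * P (V @^-1` B))%E.

Lemma block_indep2 J1 J2 d1 d2 (E1 : measurableType d1) (E2 : measurableType d2)
    (U : Omega -> E1) (V : Omega -> E2) : uniq (J1 ++ J2) ->
  measurable_fun (setT : set (g_sigma_algebraType (block J1))) U ->
  measurable_fun (setT : set (g_sigma_algebraType (block J2))) V ->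
  indep2 U V.
Proof.
move=> uJ mU mV A B mA mB; apply: (block_indep uJ).
  by have := mU measurableT A mA; rewrite setTI.
by have := mV measurableT B mB; rewrite setTI.
Qed.

Lemma indep2_comp d1 d2 d3 d4 (E1 : measurableType d1) (E2 : measurableType d2)
    (E3 : measurableType d3) (E4 : measurableType d4)
    (U : Omega -> E1) (V : Omega -> E2) (u : E1 -> E3) (v : E2 -> E4) :
  measurable_fun setT u -> measurable_fun setT v -> indep2 U V ->
  indep2 (fun w => u (U w)) (fun w => v (V w)).
Proof.
move=> mu mv UV A B mA mB.
have := UV (u @^-1` A) (v @^-1` B); rewrite -[X in measurable X]setTI.
rewrite -[X in _ -> measurable X -> _]setTI; apply; [exact: mu|exact: mv].
Qed.

End independence.

(** * Image laws *)

Section law.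
Context d d' (Omega : measurableType d) (E : measurableType d') (R : realType).
Variables (P : probability Omega R) (X : Omega -> E).
Hypothesis mX : measurable_fun setT X.

Definition law : probability E R :=
  distribution P (HB.pack_for {mfun Omega >-> E} X (isMeasurableFun.Build _ _ _ _ _ mX)).

Lemma lawE A : law A = P (X @^-1` A).
Proof. by []. Qed.

Lemma ge0_integral_law (f : E -> \bar R) : measurable_fun setT f ->
  (forall x, 0 <= f x)%E ->
  (\int[law]_x f x = \int[P]_w f (X w))%E.
Proof. by move=> mf f0; rewrite ge0_integral_pushforward. Qed.

Lemma integrable_law (f : E -> R) : measurable_fun setT f ->
  integrableR P (fun w => f (X w)) -> integrableR law f.
Proof.
move=> mf hf; apply: integrable_pushforward => //; exact/measurable_EFinP.
Qed.

Lemma Rintegral_law (f : E -> R) : measurable_fun setT f ->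
  integrableR P (fun w => f (X w)) ->
  \int[law]_x f x = \int[P]_w f (X w).
Proof.
move=> mf hf; rewrite /Rintegral integral_pushforward//.
exact/measurable_EFinP.
Qed.

End law.

Section indep_expectation.
Context d (Omega : measurableType d) (R : realType) (P : probability Omega R).

(** By independence the law of the pair [(U, V)] is the product of the two laws. Tonelli on absolute
    values gives the integrability of the product, and Fubini then factors the integral. *)
Lemma indep2_integralM (U V : Omega -> R) :
  indep2 P U V -> integrableR P U -> integrableR P V ->
  integrableR P (fun w => U w * V w) /\
  \int[P]_w (U w * V w) = (\int[P]_w U w) * (\int[P]_w V w).
Proof.
move=> UV iU iV.
have mU := integrableR_measurable iU; have mV := integrableR_measurable iV.
have mUV : measurable_fun setT (fun w => (U w, V w)) by exact/measurable_fun_pair.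
pose m1 := law P mU; pose m2 := law P mV; pose m := law P mUV.
have prodE A : measurable A -> (m1 \x m2)%E A = m A.
  by move=> mA; apply: product_measure_unique => // B C mB mC; exact: UV.
have i1 : integrableR m1 id by exact: (@integrable_law _ _ _ _ _ _ _ mU id).
have i2 : integrableR m2 id by exact: (@integrable_law _ _ _ _ _ _ _ mV id).
pose g (z : R * R) := z.1 * z.2.
have mg : measurable_fun setT g by apply: measurable_funM.
have intg : (\int[m1 \x m2]_z `|(g z)%:E| < +oo)%E.
  rewrite fubini_tonelli1//; last by do 2 apply: measurableT_comp => //.
  rewrite /fubini_F/=.
  have -> : (\int[m1]_x \int[m2]_y `|(g (x, y))%:E|)%E =
      (\int[m1]_x ((\int[m2]_y `|y|)%:E * `|x|%:E))%E.
    apply: eq_integral => x _; rewrite muleC -RintegralE ?integrableR_abs//.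
    rewrite -integralZl//; last exact: (integrableR_abs i2).
    by apply: eq_integral => y _; rewrite /g/= normrM.
  rewrite integralZl//; last exact: (integrableR_abs i1).
  by rewrite (RintegralE (integrableR_abs i1)) -EFinM ltry.
have ig : (m1 \x m2)%E.-integrable setT (EFin \o g).
  by apply/integrableP; split => //; exact/measurable_EFinP.
have igm : m.-integrable setT (EFin \o g).
  apply/integrableP; split; first exact/measurable_EFinP.
  by rewrite (eq_measure_integral (m1 \x m2)%E) => // A mA _; exact/esym/prodE.
have igP : integrableR P (fun w => U w * V w).
  apply/integrableP; split; first by apply/measurable_EFinP/measurable_funM.
  move/integrableP : igm => [_]; rewrite /m ge0_integral_law//.
  by do 2 apply: measurableT_comp => //.
split => //.
rewrite -(@Rintegral_law _ _ _ _ _ _ _ mUV g)// -/m.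
rewrite /Rintegral (eq_measure_integral (m1 \x m2)%E); last by move=> A mA _; exact/esym/prodE.
rewrite -integral12_prod_meas1//= /fubini_F.
have -> : (\int[m1]_x \int[m2]_y (g (x, y))%:E)%E =
      (\int[m1]_x ((\int[m2]_y y)%:E * x%:E))%E.
  apply: eq_integral => x _; rewrite muleC -RintegralE//.
  by rewrite -integralZl.
rewrite integralZl// (RintegralE i1)/= mulrC; congr (_ * _).
  exact: (@Rintegral_law _ _ _ _ _ _ _ mU id).
exact: (@Rintegral_law _ _ _ _ _ _ _ mV id).
Qed.

End indep_expectation.

(** * Kolmogorov's maximal inequality *)

Section kolmogorov.
Context d (Omega : measurableType d) (R : realType) (P : probability Omega R).
Variables (xi : nat -> Omega -> R) (a : R).
Hypothesis a0 : 0 < a.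

(* The partial sums, frozen as soon as they leave ]-a, a[: the increments remain
   orthogonal and a passage outside ]-a, a[ is still visible at time n. *)
Fixpoint stopped_sum n (w : Omega) : R :=
  if n is m.+1 then
    stopped_sum m w + (if `|stopped_sum m w| < a then xi m w else 0)
  else 0.

(** Invariant: as long as no partial sum has left ]-a, a[ the stopped sum is the plain one;
    afterwards it is frozen at a value outside. *)
Lemma stopped_sum_hit n w :
  (exists2 m, (m <= n)%N & a <= `|\sum_(j < m) xi j w|) ->
  a <= `|stopped_sum n w|.
Proof.
suff h : ((forall m, (m <= n)%N -> `|\sum_(j < m) xi j w| < a) /\
          stopped_sum n w = \sum_(j < n) xi j w) \/ a <= `|stopped_sum n w|.
  case: h => // -[h _] [m mn]; by rewrite leNgt h.
elim: n => [|n [[ih1 ih2]|ih]].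
- left; rewrite big_ord0; split=> // m; rewrite leqn0 => /eqP ->.
  by rewrite big_ord0 normr0.
- have s1 : stopped_sum n.+1 w = \sum_(j < n.+1) xi j w.
    by rewrite /= ih2 ih1// big_ord_recr.
  have [sa|sa] := ltP `|stopped_sum n.+1 w| a; [left|by right].
  split=> // m; rewrite leq_eqVlt => /predU1P[->|]; last exact: ih1.
  by rewrite -s1.
- by right; rewrite /= ltNge ih /= addr0.
Qed.

Hypothesis xi2 : forall j, sq_integrable P (xi j).
Hypothesis xi0 : forall j, \int[P]_w xi j w = 0.
Hypothesis ixi : mutually_independent P xi.

Let mxi j : measurable_fun setT (xi j). Proof. by case: (xi2 j). Qed.

Lemma stopped_sum_measurable J n : (forall j, (j < n)%N -> j \in J) ->
  measurable_fun (setT : set (g_sigma_algebraType (block xi J))) (stopped_sum n).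
Proof.
elim: n => [|n ih] hJ /=; first exact: measurable_cst.
have mS := ih (fun j jn => hJ j (ltnW jn)).
apply: measurable_funD => //; apply: measurable_fun_ifT => //.
  by apply: measurable_fun_ltr => //; exact: measurableT_comp.
by apply: xi_block_measurable; exact: hJ.
Qed.

Lemma stopped_sum_sq n : sq_integrable P (stopped_sum n) /\
  \int[P]_w (stopped_sum n w ^+ 2) <= \sum_(j < n) \int[P]_w (xi j w ^+ 2).
Proof.
elim: n => [|n [ih1 ih2]].
  split; first exact: sq_integrable_cst.
  by rewrite big_ord0/= expr0n/= RintegralT_cst.
have msJ := @stopped_sum_measurable (iota 0 n) n.
(* In the square of the next stopped sum the cross term is [2 * (U * xi n)]. Here [U] is bounded by
   [a] and depends on the first [n] variables only, so it is independent of [xi n] and the cross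
   term has mean 0. *)
pose U w := if `|stopped_sum n w| < a then stopped_sum n w else 0.
pose V w := if `|stopped_sum n w| < a then xi n w else 0.
have mU : measurable_fun (setT : set (g_sigma_algebraType (block xi (iota 0 n)))) U.
  have mS : measurable_fun (setT : set (g_sigma_algebraType (block xi (iota 0 n))))
    (stopped_sum n) by apply: msJ => j jn; rewrite mem_iota add0n.
  by apply: measurable_fun_ifT => //; apply: measurable_fun_ltr => //; exact: measurableT_comp.
have mU' := block_measurable_fun mxi mU.
have iU : integrableR P U.
  apply: (@integrableR_bounded _ _ _ _ _ a) => // w; rewrite /U.
  by case: ifP => [/ltW //|_]; rewrite normr0 ltW.
have V2 : sq_integrable P V.
  apply: (@sq_integrable_le _ _ _ _ _ (xi n)) => //.
    have [mS _] := ih1.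
    apply: measurable_fun_ifT => //; apply: measurable_fun_ltr => //.
    exact: measurableT_comp.
  by move=> w; rewrite /V; case: ifP => // _; rewrite normr0.
have UV : indep2 P U (xi n).
  apply: (block_indep2 mxi ixi (J1 := iota 0 n) (J2 := [:: n])) => //.
    by rewrite -[[:: n]]/(iota (0 + n) 1) -iotaD iota_uniq.
  by apply: xi_block_measurable; rewrite inE.
have [iUV eUV] := indep2_integralM UV iU (sq_integrable_integrable (xi2 n)).
have sq w : stopped_sum n.+1 w ^+ 2 =
    stopped_sum n w ^+ 2 + (2 * (U w * xi n w) + V w ^+ 2).
  by rewrite /= /U /V; case: ifP => _; ring.
split; first exact: (sq_integrableD ih1 V2).
rewrite (eq_Rintegral _ (g := fun w => stopped_sum n w ^+ 2 + (2 * (U w * xi n w) + V w ^+ 2)));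
  last by move=> w _; exact: sq.
rewrite RintegralT_D//; [|by case: ih1|].
  rewrite RintegralT_D//; [|exact: integrableRZ|by case: V2].
  rewrite RintegralT_Z// eUV xi0 mulr0 mulr0 add0r big_ord_recr/= lerD//.
  apply: RintegralT_le; [by case: V2|by case: (xi2 n)|].
  by move=> w; rewrite /V; case: ifP => // _; rewrite expr0n/= sqr_ge0.
by apply: integrableRD; [exact: integrableRZ|case: V2].
Qed.

Lemma kolmogorov_inequality n (A : set Omega) : measurable A ->
  (forall w, A w -> exists2 m, (m <= n)%N & a <= `|\sum_(j < m) xi j w|) ->
  fine (P A) <= (\sum_(j < n) \int[P]_w (xi j w ^+ 2)) / a ^+ 2.
Proof.
move=> mA hA; have [[mS iS] le] := stopped_sum_sq n.
apply: (@le_trans _ _ ((\int[P]_w (stopped_sum n w ^+ 2)) / a ^+ 2)); last first.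
  by rewrite ler_pM2r// invr_gt0 exprn_gt0.
apply: markovR => //; first by rewrite exprn_gt0.
  by move=> w; exact: sqr_ge0.
move=> w /hA /stopped_sum_hit h.
by rewrite -[leRHS]real_normK ?num_real// lerXn2r// nnegrE// ltW.
Qed.

End kolmogorov.

(** * Strong law of large numbers *)

Lemma Rintegral_dominated_cvg d (T : measurableType d) (R : realType)
    (mu : probability T R) (F : nat -> T -> R) (f g : T -> R) :
  (forall n, measurable_fun setT (F n)) ->
  (forall x, F ^~ x @ \oo --> f x) -> integrableR mu g ->
  (forall n x, `|F n x| <= g x) ->
  integrableR mu f /\ (fun n => \int[mu]_x F n x) @ \oo --> \int[mu]_x f x.
Proof.
move=> mF Ff ig Fg.
have mf : measurable_fun setT f.
  by apply: (measurable_fun_cvg (h := F)) => // x _; exact: Ff.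
have [] := @dominated_convergence _ _ _ mu setT measurableT (fun n x => (F n x)%:E)
  (EFin \o f) (EFin \o g).
- by move=> n; exact/measurable_EFinP.
- exact/measurable_EFinP.
- by apply/aeW => x _; apply: cvg_EFin; [exact: nearW|exact: Ff].
- exact: ig.
- by apply/aeW => x n _ /=; rewrite lee_fin.
move=> i1 _ h; split=> //.
have iF n : integrableR mu (F n) by exact: integrableR_le (mF n) (Fg n) ig.
move: h; rewrite RintegralE// => /fine_cvg.
by apply: cvg_trans; apply: near_eq_cvg; near=> n.
Unshelve. all: by end_near.
Qed.

Section same_law.
Context d d' (Omega : measurableType d) (E : measurableType d') (R : realType).
Variables (P : probability Omega R) (X Y : Omega -> E).
Hypotheses (mX : measurable_fun setT X) (mY : measurable_fun setT Y).
Hypothesis XY : forall B, measurable B -> P (X @^-1` B) = P (Y @^-1` B).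

Lemma same_law_integral (h : E -> R) : measurable_fun setT h ->
  integrableR P (fun w => h (X w)) ->
  integrableR P (fun w => h (Y w)) /\
  \int[P]_w h (Y w) = \int[P]_w h (X w).
Proof.
move=> mh iX.
have eqi (f : E -> \bar R) : (\int[law P mY]_x f x = \int[law P mX]_x f x)%E.
  by apply: eq_measure_integral => A mA _; exact/esym/XY.
have iY : integrableR P (fun w => h (Y w)).
  have mhY : measurable_fun setT (fun w => h (Y w)) by exact: measurableT_comp.
  apply/integrableP; split; first exact/measurable_EFinP.
  have /integrableP[_] := integrable_law mX mh iX.
  rewrite -eqi ge0_integral_law//.
  by apply: measurableT_comp => //; exact/measurable_EFinP.
by split=> //; rewrite -(Rintegral_law mX mh iX) -(Rintegral_law mY mh iY) /Rintegral eqi.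
Qed.

End same_law.

Section dyadic.
Variable R : realType.
Implicit Types z : R.

(** This bound and the next one, taken at [z = |xi 0|] and integrated, turn a finite first moment
    into the summability over dyadic scales needed for Borel-Cantelli. *)
Lemma dyadic_tail_sum z M : 0 <= z ->
  \sum_(m < M) (2 ^+ m * (2 ^+ m < z)%R%:R) <= 2 * z.
Proof.
move=> z0; elim: M => [|M ih]; first by rewrite big_ord0; lra.
rewrite big_ord_recr/=; have [Mz|_] := ltP (2 ^+ M) z; last by rewrite mulr0 addr0.
(* If the last term is present then [2 ^+ M < z], and the whole sum is at most the geometric bound
   [2 ^+ M.+1], below [2 * z]. *)
rewrite mulr1; apply: (@le_trans _ _ (2 ^+ M.+1 : R)); last by rewrite exprS; lra.
clear ih Mz; elim: M => [|M ih]; first by rewrite big_ord0 add0r expr0 expr1; lra.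
rewrite [leRHS]exprS mulr2n mulrDl mul1r lerD2r// (le_trans _ ih)// big_ord_recr/=.
rewrite lerD2l ler_piMr ?exprn_ge0//.
by case: (_ < _).
Qed.

Lemma dyadic_square_sum z M : 0 <= z ->
  \sum_(m < M) (2 ^- m * (z ^+ 2 * (z <= 2 ^+ m)%R%:R)) <= 2 * z.
Proof.
(* A telescoping majorant: for [z <= 2 ^+ m] the minimum is its second argument and [a m - a m.+1]
   is exactly the term; for larger [z] the term is 0 and [a] does not increase. *)
move=> z0; pose a m : R := 2 * Num.min z (z ^+ 2 * 2 ^- m).
have a0 m : 0 <= a m.
  by rewrite /a mulr_ge0// le_min z0 mulr_ge0 ?sqr_ge0// invr_ge0 exprn_ge0.
suff h : \sum_(m < M) (2 ^- m * (z ^+ 2 * (z <= 2 ^+ m)%R%:R)) <= a 0%N - a M.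
  apply: (le_trans h); rewrite lerBlDr (@le_trans _ _ (2 * z))//.
    by rewrite /a ler_pM2l// ge_min lexx.
  by rewrite lerDl.
elim: M => [|M ih]; first by rewrite big_ord0 subrr.
rewrite big_ord_recr/=; suff : 2 ^- M * (z ^+ 2 * (z <= 2 ^+ M)%R%:R) <= a M - a M.+1.
  by move: ih; lra.
have p0 : (0 : R) < 2 ^+ M by rewrite exprn_gt0.
have -> : a M.+1 = 2 * Num.min z (z ^+ 2 * 2 ^- M / 2).
  by rewrite /a (exprS 2 M) invfM [_^-1 * _]mulrC mulrA.
set q := z ^+ 2 * 2 ^- M.
have q0 : 0 <= q by rewrite mulr_ge0 ?sqr_ge0// invr_ge0 ltW.
rewrite /a -/q; case: (leP z (2 ^+ M)) => zM /=.
  rewrite mulr1 mulrC -/q.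
  have qz : q <= z by rewrite ler_pdivrMr// expr2 ler_wpM2l.
  by rewrite !min_r//; lra.
rewrite mulr0 mulr0 subr_ge0 ler_pM2l//.
by rewrite le_min ge_min lexx/= ge_min; apply/orP; right; lra.
Qed.

End dyadic.

Section slln.
Context d (Omega : measurableType d) (R : realType) (P : probability Omega R).

Lemma probU_le (A B : set Omega) : measurable A -> measurable B ->
  fine (P (A `|` B)) <= fine (P A) + fine (P B).
Proof.
move=> mA mB; rewrite -lee_fin EFinD !fineK ?fin_num_measure//; last exact: measurableU.
exact: measureU2.
Qed.

Variable xi : nat -> Omega -> R.
Hypothesis mxi : forall j, measurable_fun setT (xi j).
Hypothesis ixi : mutually_independent P xi.
Hypothesis lxi : forall j B, measurable B -> P (xi j @^-1` B) = P (xi 0%N @^-1` B).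
Hypothesis xi1 : integrableR P (xi 0%N).

Let trunc (L x : R) := if `|x| <= L then x else 0.

Let mtrunc L : measurable_fun setT (trunc L).
Proof. by apply: measurable_fun_ifT => //; apply: measurable_fun_ler. Qed.

Let trunc_le L x : 0 <= L -> `|trunc L x| <= L.
Proof. by move=> L0; rewrite /trunc; case: ifP => //; rewrite normr0. Qed.

Let trunc_le_norm L x : `|trunc L x| <= `|x|.
Proof. by rewrite /trunc; case: ifP; rewrite ?normr0. Qed.

Let L m : R := 2 ^+ m.
Let L0 m : 0 <= L m. Proof. by rewrite exprn_ge0. Qed.
Let L0' m : 0 < L m. Proof. by rewrite exprn_gt0. Qed.

Let mu m := \int[P]_w trunc (L m) (xi 0%N w).

Let eta m j w := trunc (L m) (xi j w) - mu m.

Let mtxi m j : measurable_fun setT (fun w => trunc (L m) (xi j w)).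
Proof. exact: measurableT_comp. Qed.

Let itxi m j : sq_integrable P (fun w => trunc (L m) (xi j w)).
Proof. by apply: (@sq_integrable_bounded _ _ _ _ _ (L m)) => // w; exact: trunc_le. Qed.

Let eta_sq m j : sq_integrable P (eta m j).
Proof.
have := sq_integrableD (itxi m j) (sq_integrable_cst P (- mu m)).
exact.
Qed.

Let eta_0 m j : \int[P]_w eta m j w = 0.
Proof.
rewrite RintegralT_B ?RintegralT_cst; last exact: integrableR_cst.
  have := same_law_integral (mxi 0) (mxi j) (fun B mB => esym (lxi j mB)) (mtrunc (L m)).
  move=> /(_ (sq_integrable_integrable (itxi m 0))) [_ ->].
  by rewrite subrr.
exact: sq_integrable_integrable.
Qed.

Let eta_2 m j : \int[P]_w (eta m j w ^+ 2) <= \int[P]_w (trunc (L m) (xi 0%N w) ^+ 2).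
Proof.
have i1 := sq_integrable_integrable (itxi m j).
have E1 : \int[P]_w trunc (L m) (xi j w) = mu m.
  have := eta_0 m j; rewrite RintegralT_B ?RintegralT_cst; [lra|exact: i1|exact: integrableR_cst].
have -> : \int[P]_w (eta m j w ^+ 2) = \int[P]_w (trunc (L m) (xi j w) ^+ 2) - mu m ^+ 2.
  transitivity (\int[P]_w (trunc (L m) (xi j w) ^+ 2 - (2 * mu m * trunc (L m) (xi j w) - mu m ^+ 2))).
    by apply: eq_Rintegral => w _; rewrite /eta; ring.
  rewrite RintegralT_B; [|by case: (itxi m j)|].
    rewrite RintegralT_B; [|exact: integrableRZ|exact: integrableR_cst].
    by rewrite RintegralT_Z// RintegralT_cst E1; ring.
  by apply: integrableRB; [exact: integrableRZ|exact: integrableR_cst].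
have := same_law_integral (mxi 0) (mxi j) (fun B mB => esym (lxi j mB))
  (h := fun x => trunc (L m) x ^+ 2) (measurable_funX 2 (mtrunc (L m))).
move=> /(_ (proj2 (itxi m 0))) [_ ->].
by have := sqr_ge0 (mu m); lra.
Qed.

Let eta_ind m : mutually_independent P (eta m).
Proof.
apply: (mutually_independent_comp (h := fun _ x => trunc (L m) x - mu m) _ ixi) => _.
exact: measurable_funB.
Qed.

(* For n <= 2 ^ m.+1 the variables are truncated at 2 ^ m. Outside [bad eps m] the
   truncation is not felt and the centred sums are smaller than eps * 2 ^ m; the
   probabilities of [bad eps m] are summable in m. *)
Let big m := \bigcup_(j in [set j | (j < 2 ^ m.+1)%N]) [set w | L m < `|xi j w|].
Let dev eps m := \bigcup_(n in [set n | (n <= 2 ^ m.+1)%N])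
  [set w | eps * L m <= `|\sum_(j < n) eta m j w|].
Let bad eps m := dev eps m `|` big m.

Let mbig1 m j : measurable [set w | L m < `|xi j w|].
Proof. by apply: measurable_set_lt => //; exact: measurableT_comp. Qed.

Let mbig m : measurable (big m).
Proof. by apply: bigcup_measurable => j _; exact: mbig1. Qed.

Let mdev eps m : measurable (dev eps m).
Proof.
apply: bigcup_measurable => n _; apply: measurable_set_le => //.
apply: measurableT_comp => //; apply: measurable_sum => j.
by case: (eta_sq m j).
Qed.

(** The first part is the maximal inequality for [2 ^ m.+1] centred variables at threshold
    [eps * 2 ^+ m]: the quotient [2 ^+ m.+1 / (eps * 2 ^+ m) ^+ 2] equals [2 / eps ^+ 2 * 2 ^- m].
    The second is the union bound over the same number of variables. Both are kept under one
    integral so that the sum over [m] can be taken inside. *)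
Let bad_le eps m : 0 < eps -> fine (P (bad eps m)) <=
  (\int[P]_w (2 / eps ^+ 2 * (2 ^- m * (`|xi 0%N w| ^+ 2 * (`|xi 0%N w| <= 2 ^+ m)%R%:R)) +
    2 * (2 ^+ m * (2 ^+ m < `|xi 0%N w|)%R%:R))).
Proof.
move=> e0; apply: (le_trans (probU_le (mdev eps m) (mbig m))).
have t2 : \int[P]_w (2 / eps ^+ 2 * (2 ^- m * (`|xi 0%N w| ^+ 2 * (`|xi 0%N w| <= 2 ^+ m)%R%:R))) =
    2 / eps ^+ 2 * (2 ^- m * \int[P]_w (trunc (L m) (xi 0%N w) ^+ 2)).
  rewrite -RintegralT_Z; last by case: (itxi m 0).
  rewrite -RintegralT_Z; last by apply: integrableRZ; case: (itxi m 0).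
  apply: eq_Rintegral => w _; rewrite /trunc /L; case: ifP => _.
    by rewrite mulr1 real_normK ?num_real.
  by rewrite mulr0 expr0n.
have ib j : integrableR P (fun w => (2 ^+ m < `|xi j w|)%R%:R).
  have := integrableR_indic P (mbig1 m j).
  by apply: eq_integrable => // w _ /=; rewrite indicE mem_setE.
have it : integrableR P (fun w => 2 / eps ^+ 2 * (2 ^- m * (`|xi 0%N w| ^+ 2 * (`|xi 0%N w| <= 2 ^+ m)%R%:R))).
  have := integrableRZ (2 / eps ^+ 2) (integrableRZ (2 ^- m) (proj2 (itxi m 0))).
  apply: eq_integrable => // w _ /=; rewrite /trunc /L; case: ifP => _.
    by rewrite mulr1 real_normK ?num_real.
  by rewrite mulr0 expr0n.
rewrite RintegralT_D//; last by do 2 apply: integrableRZ.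
rewrite t2 lerD//.
  have := kolmogorov_inequality (mulr_gt0 e0 (L0' m)) (eta_sq m) (eta_0 m) (@eta_ind m)
    (n := (2 ^ m.+1)%N) (mdev eps m).
  move=> /(_ (fun w h => let: ex_intro2 n h1 h2 := h in ex_intro2 _ _ n h1 h2))/le_trans; apply.
  apply: (@le_trans _ _ ((\sum_(j < (2 ^ m.+1)) \int[P]_w (trunc (L m) (xi 0%N w) ^+ 2)) / (eps * L m) ^+ 2)).
    by rewrite ler_pM2r ?invr_gt0 ?exprn_gt0 ?mulr_gt0//; apply: ler_sum => j _; exact: eta_2.
  rewrite sumr_const card_ord -[X in X / _ <= _]mulr_natl natrX /L exprMn exprS.
  rewrite le_eqVlt; apply/orP; left; apply/eqP; field.
  by rewrite !gt_eqF// exprn_gt0.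
rewrite RintegralT_Z; last exact: integrableRZ.
rewrite RintegralT_Z// mulrA -exprS.
have := @markovR _ _ _ P (fun w => \sum_(j < (2 ^ m.+1)) (2 ^+ m < `|xi j w|)%R%:R) (big m) 1.
have isum := integrableR_sum (index_enum 'I_(2 ^ m.+1)) (fun j => ib (nat_of_ord j)).
rewrite divr1 => /(_ (mbig m) ltr01 isum _ _)/le_trans; apply.
- by move=> w; apply: sumr_ge0 => j _; case: (_ < _).
- move=> w [j /= jm hj]; rewrite (bigD1 (Ordinal jm))//= hj lerDl.
  by apply: sumr_ge0 => i _; case: (_ < _).
rewrite RintegralT_sum; last by move=> j; exact: ib.
rewrite (eq_bigr (fun=> \int[P]_w (2 ^+ m < `|xi 0%N w|)%R%:R)); last first.
  move=> j _.
  have := same_law_integral (mxi 0) (mxi j) (fun B mB => esym (lxi j mB))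
    (h := fun x => (2 ^+ m < `|x|)%R%:R) _ (ib 0).
  case=> //.
  rewrite (_ : (fun x : R => _) = \1_[set x : R | 2 ^+ m < `|x|]); last first.
    by apply/funext => x; rewrite indicE mem_setE.
  apply: measurable_indic; apply: measurable_set_lt => //.
by rewrite sumr_const card_ord -[leLHS]mulr_natl natrX.
Qed.

(** Borel-Cantelli. The constant [C] below collects the two dyadic sums, each at most [2 * |xi 0|]
    before integration. *)
Let bad_as eps : 0 < eps -> P (lim_sup_set (bad eps)) = 0%E.
Proof.
move=> e0.
have mbad m : measurable (bad eps m) by apply: measurableU.
apply: lim_sup_set_cvg0 => //.
pose C := 2 / eps ^+ 2 * (2 * \int[P]_w `|xi 0%N w|) + 2 * (2 * \int[P]_w `|xi 0%N w|).
apply: (@le_lt_trans _ _ C%:E); last exact: ltry.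
apply: lime_le; first exact: is_cvg_nneseries.
apply: nearW => M.
rewrite (eq_bigr (fun m => (fine (P (bad eps m)))%:E)); last first.
  by move=> m _; rewrite fineK// fin_num_measure.
rewrite sumEFin lee_fin big_mkord.
apply: le_trans; first by apply: ler_sum => m _; exact: bad_le.
have ia := integrableR_abs xi1.
have icmp c m : integrableR P (fun w => c * (2 ^- m * (`|xi 0%N w| ^+ 2 * (`|xi 0%N w| <= 2 ^+ m)%R%:R))).
  have := integrableRZ c (integrableRZ (2 ^- m) (proj2 (itxi m 0))).
  apply: eq_integrable => // w _ /=; rewrite /trunc /L; case: ifP => _.
    by rewrite mulr1 real_normK ?num_real.
  by rewrite mulr0 expr0n.
have icmp2 c m : integrableR P (fun w => c * (2 ^+ m * (2 ^+ m < `|xi 0%N w|)%R%:R)).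
  apply/integrableRZ/integrableRZ.
  have := integrableR_indic P (mbig1 m 0).
  by apply: eq_integrable => // w _ /=; rewrite indicE mem_setE.
rewrite -RintegralT_sum; last by move=> m; exact: integrableRD.
rewrite /C -!RintegralT_Z//; [|exact: integrableRZ|exact: integrableRZ].
rewrite -RintegralT_D//; [|exact/integrableRZ/integrableRZ|exact/integrableRZ/integrableRZ].
apply: RintegralT_le.
- by apply: integrableR_sum => m; exact: integrableRD.
- by apply: integrableRD; exact/integrableRZ/integrableRZ.
move=> w; rewrite big_split/= -!mulr_sumr lerD//.
  by rewrite ler_pM2l ?dyadic_square_sum// divr_gt0// exprn_gt0.
by rewrite ler_pM2l ?dyadic_tail_sum.
Qed.

Let mu_cvg : mu @ \oo --> \int[P]_w xi 0%N w.
Proof.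
have := @Rintegral_dominated_cvg _ _ _ P (fun m w => trunc (L m) (xi 0%N w)) (xi 0%N) (fun w => `|xi 0%N w|).
case=> //; last exact: integrableR_abs.
move=> w; apply: cvg_near_cst; near=> m.
rewrite /trunc ifT// /L; near: m.
exists (Num.trunc `|xi 0%N w|).+1 => // m /= hm.
apply: (@le_trans _ _ m%:R).
  by apply: (le_trans (ltW (truncnS_gt _))); rewrite ler_nat.
by rewrite -natrX ler_nat ltnW// ltn_expl.
Unshelve. all: by end_near.
Qed.

(** Only a first moment is assumed. Truncation by dyadic blocks keeps the variances summable, and
    the maximal inequality controls all [n] of a block at once, so no interpolation between blocks
    is needed. *)
Theorem strong_law_of_large_numbers :
  {ae P, forall w, (fun n => (\sum_(j < n) xi j w) / n%:R) @ \oo --> \int[P]_w xi 0%N w}.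
Proof.
pose N := \bigcup_k lim_sup_set (bad k.+1%:R^-1).
have N0 : P.-negligible N.
  apply: negligible_bigcup => k; apply/negligibleP.
    apply: bigcapT_measurable => n; apply: bigcup_measurable => j _.
    by apply: measurableU.
  by apply: bad_as; rewrite invr_gt0.
apply: negligibleS N0 => w /= hw; apply: contrapT => Nw; apply: hw.
apply/cvgrPdist_lt => e e0.
have [k ke] : exists k, k.+1%:R^-1 < e / 2.
  exists (Num.trunc (e / 2)^-1); rewrite invf_plt ?posrE ?divr_gt0//.
  exact: truncnS_gt.
have [M hM] : exists M, forall m, (M <= m)%N -> ~ bad k.+1%:R^-1 m w.
  apply: contrapT => /forallNP h; apply: Nw; exists k => // M _.
  have /existsNP[m /not_implyP[Mm /contrapT bm]] := h M.
  by exists m.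
have /cvgrPdist_lt /(_ (e / 2)) := mu_cvg; rewrite divr_gt0// => /(_ isT) [M' _ hM'].
exists (2 ^ (maxn M M'))%N => // n /= hn.
have n0 : (0 < n)%N by apply: leq_trans hn; rewrite expn_gt0.
(* The block of [n]: all indices below [n] are below [2 ^ m.+1], so none of them is truncated
   outside [bad], and [2 ^ m <= n] turns the deviation bound into one for the average. *)
pose m := trunc_log 2 n.
have mM : (maxn M M' <= m)%N by apply: trunc_log_max.
have /andP[mn nm] : (2 ^ m <= n < 2 ^ m.+1)%N by apply: trunc_log_bounds.
have /not_orP[ndev nbig] := hM m (leq_trans (leq_maxl _ _) mM).
have hmu : `|\int[P]_w xi 0%N w - mu m| < e / 2.
  by apply: hM' => /=; exact: (leq_trans (leq_maxr _ _) mM).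
have nR : (0 : R) < n%:R by rewrite ltr0n.
have sumE : (\sum_(j < n) xi j w) / n%:R - mu m = (\sum_(j < n) eta m j w) / n%:R.
  have e1 : mu m *+ n / n%:R = mu m by rewrite -[X in X / _]mulr_natr mulfK// gt_eqF.
  rewrite sumrB sumr_const card_ord mulrBl e1.
  congr (_ / _ - _); apply: eq_bigr => j _; rewrite /trunc ifT// leNgt.
  apply/negP => hj; apply: nbig; exists (nat_of_ord j) => //=.
  by apply: ltn_trans nm.
have dm : `|(\sum_(j < n) xi j w) / n%:R - mu m| < e / 2.
  rewrite sumE normrM normfV (ger0_norm (ltW nR)) ltr_pdivrMr//.
  apply: (@lt_le_trans _ _ (k.+1%:R^-1 * L m)).
    rewrite ltNge; apply/negP => h; apply: ndev; exists n => //=.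
    exact: ltnW.
  apply: ler_pM => //; first exact: ltW.
  by rewrite /L -natrX ler_nat.
by rewrite (le_lt_trans (ler_distD (mu m) _ _))// [ltRHS]splitr ltrD// distrC.
Qed.

End slln.

(** * Gaussian averages *)

Section density.
Context d (T : measurableType d) (R : realType).
Variables (mu nu : {measure set T -> \bar R}) (h : T -> R).
Hypotheses (mh : measurable_fun setT h) (h0 : forall x, 0 <= h x).
Hypothesis nuE : forall A, measurable A -> nu A = (\int[mu]_(x in A) (h x)%:E)%E.
Import HBNNSimple.
Local Open Scope ereal_scope.

(** True for indicators by [nuE], for simple functions by linearity, and in general by monotone
    convergence along [nnsfun_approx]. *)
Lemma ge0_integral_density (f : T -> \bar R) : measurable_fun setT f ->
  (forall x, 0 <= f x) -> \int[nu]_x f x = \int[mu]_x (f x * (h x)%:E).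
Proof.
move=> mf f0; pose f_ := nnsfun_approx measurableT mf.
have mEh : measurable_fun setT (EFin \o h) by exact/measurable_EFinP.
transitivity (limn (fun n => \int[nu]_x (f_ n x)%:E)).
  rewrite -monotone_convergence//.
  - by apply: eq_integral => y _; apply/esym/cvg_lim => //; exact: cvg_nnsfun_approx.
  - by move=> n; exact/measurable_EFinP/measurable_funP.
  - by move=> n y _; rewrite lee_fin.
  - by move=> y _ m n mn; rewrite lee_fin; exact/lefP/nd_nnsfun_approx.
rewrite (_ : (fun n => \int[nu]_x (f_ n x)%:E) = (fun n => \int[mu]_x ((f_ n x)%:E * (h x)%:E))).
  rewrite -monotone_convergence//; last 3 first.
    - by move=> n; apply: emeasurable_funM => //; exact/measurable_EFinP/measurable_funP.
    - by move=> n x _; rewrite mule_ge0 ?lee_fin.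
    - move=> x _ m n mn; rewrite lee_pmul ?lee_fin//.
      exact/lefP/nd_nnsfun_approx.
  apply: eq_integral => x _; apply/cvg_lim => //; apply: cvgeZr => //.
  exact: cvg_nnsfun_approx.
apply/funext => n.
rewrite integralT_nnsfun sintegralE.
under [RHS]eq_integral do rewrite fimfunE -EFinM mulrC mulr_fsumr -fsumEFin//.
rewrite ge0_integral_fsum//; last 2 first.
- move=> r; apply/measurable_EFinP/measurable_funM => //.
  exact: measurable_funM.
- move=> r x _; rewrite lee_fin mulr_ge0//.
  by have := nnfun_muleindic_ge0 (f_ n) r x; rewrite lee_fin.
apply: eq_fsbigr => r /set_mem[x _ rE].
have mD : measurable (f_ n @^-1` [set r]).
  by rewrite -[X in measurable X]setTI; exact: measurable_funP.
rewrite nuE// integral_mkcond -ge0_integralZl//.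
- apply: eq_integral => y _; rewrite patchE indicE; case: ifPn => // _.
    by rewrite -EFinM mulr1 mulrC.
  by rewrite mule0 !mulr0.
- by apply/(measurable_restrictT _ _).1 => //; exact: measurable_funTS.
- by move=> y _; rewrite patchE; case: ifPn => // _; rewrite lee_fin.
- by rewrite lee_fin -rE.
Qed.

End density.

Section affine.
Variable R : realType.
Local Notation leb := (@lebesgue_measure R).
Local Open Scope ereal_scope.

(** The image of Lebesgue measure under [x |-> a * x + b], scaled by [a], gives every interval its
    length, hence is Lebesgue measure by uniqueness. *)
Lemma ge0_integral_affine (f : R -> \bar R) (a b : R) : (0 < a)%R ->
  measurable_fun setT f -> (forall x, 0 <= f x) ->
  \int[leb]_x f x = a%:E * \int[leb]_x f (a * x + b)%R.
Proof.
move=> a0 mf f0.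
pose phi (x : measurableTypeR R) : measurableTypeR R := (a * x + b)%R.
have mphi : measurable_fun [set: measurableTypeR R] phi.
  by apply: measurable_funD => //; exact: measurable_funM.
pose a' := NngNum (ltW a0).
pose m : {measure set (measurableTypeR R) -> \bar R} :=
  measure_function_pushforward__canonical__measure_function_Measure leb mphi.
have E A : measurable A -> leb A = mscale a' m A.
  apply: lebesgue_measure_unique => _ [[c e] _ <-].
  transitivity (a%:E * leb (phi @^-1` `]c, e])); last by [].
  rewrite (_ : phi @^-1` _ = `](c - b) / a, (e - b) / a]%classic)%R; last first.
    apply/seteqP; split=> x /=; rewrite !in_itv/= /phi.
      by rewrite ltr_pdivrMr// ler_pdivlMr// ltrBlDr lerBrDr mulrC.
    by rewrite ltr_pdivrMr// ler_pdivlMr// ltrBlDr lerBrDr mulrC.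
  rewrite !lebesgue_measure_itv/= !lte_fin ltr_pM2r ?invr_gt0// ltrD2r.
  case: ifPn => _; last by rewrite mule0.
  rewrite -!EFinD -EFinM; congr (_%:E).
  by field; rewrite gt_eqF.
transitivity (\int[mscale a' m]_x f x).
  by apply: eq_measure_integral => A mA _; exact: E.
by rewrite ge0_integral_mscale//= ge0_integral_pushforward.
Qed.

End affine.

Section normal.
Variable R : realType.
Local Notation leb := (@lebesgue_measure R).
Local Notation pdf := (normal_pdf (0 : R) 1).
Local Notation nu := (normal_prob (0 : R) 1).

Lemma ge0_integral_normal (s : R) (f : R -> \bar R) : measurable_fun setT f ->
  (forall x, 0 <= f x)%E ->
  (\int[normal_prob 0 s]_x f x = \int[leb]_x (f x * (normal_pdf 0 s x)%:E))%E.
Proof.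
move=> mf f0; apply: ge0_integral_density => //.
  exact: measurable_normal_pdf.
by move=> x; exact: normal_pdf_ge0.
Qed.

Lemma normal_pdf1E (x : R) : pdf x = normal_peak 1 * expR (- (x ^+ 2 / 2)).
Proof.
rewrite normal_pdfE ?oner_neq0//= /normal_fun subr0 expr1n; congr (_ * expR _).
by rewrite mulNr; congr (- (_ / _)).
Qed.

Let mpdf s : measurable_fun setT (EFin \o normal_pdf (0 : R) s).
Proof. by apply/measurable_EFinP; exact: measurable_normal_pdf. Qed.

Let mind (A : set R) : measurable A -> measurable_fun setT (fun x : R => (\1_A x)%:E : \bar R).
Proof. by move=> mA; apply/measurable_EFinP; exact: measurable_indic. Qed.

Lemma normal_probE s (B : set R) : measurable B ->
  (normal_prob 0 s B = \int[leb]_x ((\1_B x)%:E * (normal_pdf 0 s x)%:E))%E.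
Proof.
move=> mB; rewrite -ge0_integral_normal; last 2 first.
- exact: mind.
- by move=> x; rewrite lee_fin.
by rewrite integral_indic// setIT.
Qed.

Lemma normal_scaling (s : R) (A : set R) : 0 < s -> measurable A ->
  normal_prob 0 s A = nu ((fun x => s * x) @^-1` A).
Proof.
move=> s0 mA.
have mA' : measurable ((fun x => s * x) @^-1` A).
  by rewrite -[X in measurable X]setTI; apply: measurable_funM.
rewrite normal_probE; last exact: mA.
rewrite normal_probE; last exact: mA'.
rewrite (@ge0_integral_affine _ _ s 0 s0).
- rewrite -ge0_integralZl//.
  + apply: eq_integral => x _; rewrite addr0 -!EFinM; congr (_%:E); rewrite mulrCA; congr (_ * _).
    rewrite !normal_pdfE ?oner_neq0 ?gt_eqF//= /normal_fun /normal_peak !subr0 expr1n.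
    rewrite mulrA; congr (_ * expR _).
      rewrite -mulrnAr sqrtrM ?sqr_ge0// sqrtr_sqr gtr0_norm// invfM mulrA divff ?gt_eqF//.
      by rewrite !mul1r.
    by field; rewrite gt_eqF.
  + apply: emeasurable_funM.
      apply: (measurableT_comp (mind mA)).
      by apply: measurable_funD => //; exact: measurable_funM.
    apply: (measurableT_comp (mpdf s)).
    by apply: measurable_funD => //; exact: measurable_funM.
  + by move=> x _; rewrite -EFinM lee_fin mulr_ge0// normal_pdf_ge0.
  + by rewrite lee_fin ltW.
- by apply: emeasurable_funM; [exact: mind|exact: mpdf].
- by move=> x; rewrite -EFinM lee_fin mulr_ge0// normal_pdf_ge0.
Qed.

Lemma normal_symmetric (A : set R) : measurable A -> nu (-%R @^-1` A) = nu A.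
Proof.
move=> mA.
have mN : measurable (-%R @^-1` A).
  by rewrite -[X in measurable X]setTI; exact: (measurable_funN (@measurable_id _ _ setT)).
rewrite normal_probE; last exact: mN.
rewrite normal_probE; last exact: mA.
transitivity (\int[pushforward leb (-%R : R -> measurableTypeR R)]_x ((\1_A x)%:E * (pdf x)%:E))%E.
  rewrite ge0_integral_pushforward.
  - apply: eq_integral => x _ /=; congr (_ * _%:E)%E.
    by rewrite !normal_pdf1E sqrrN.
  - exact: (measurable_funN (@measurable_id _ _ setT)).
  - exact: measurableT.
  - by apply: emeasurable_funM; [exact: mind|exact: mpdf].
  - by move=> x _; rewrite -EFinM lee_fin mulr_ge0// normal_pdf_ge0.
apply: eq_measure_integral => B mB _; exact: lebesgue_measureN.
Qed.

(** With the density written out, substitute so that the argument of [f] becomes [c * y], exchange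
    the integrals by Tonelli, and recognize in the integral over [x] a Gaussian density of total
    mass 1. *)
Lemma normal_convolution (a b c : R) (f : R -> \bar R) : 0 < b -> 0 < c ->
  c ^+ 2 = a ^+ 2 + b ^+ 2 -> measurable_fun setT f -> (forall x, 0 <= f x)%E ->
  (\int[nu]_x \int[nu]_y f (a * x + b * y)%R = \int[nu]_x f (c * x)%R)%E.
Proof.
move=> b0 c0 abc mf f0.
have mf2 (g : R -> R) : measurable_fun setT g -> measurable_fun setT (fun x => f (g x)).
  exact: measurableT_comp.
have mpdf1 := mpdf 1.
have pdf0 x : (0 <= (pdf x)%:E)%E by rewrite lee_fin normal_pdf_ge0.
have cb0 : 0 < c / b by rewrite divr_gt0.
pose F (z : R * R) := ((c / b)%:E * (f (c * z.2)%R * ((pdf z.1)%:E * (pdf ((c * z.2 - a * z.1) / b)%R)%:E)))%E.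
have mF : measurable_fun setT F.
  apply: emeasurable_funM => //; apply: emeasurable_funM.
    by apply: (measurableT_comp mf); exact: measurable_funM.
  apply: emeasurable_funM.
    by apply: (measurableT_comp mpdf1).
  apply: (measurableT_comp mpdf1) => //.
  apply: measurable_funM => //; apply: measurable_funB; exact: measurable_funM.
have F0 z : (0 <= F z)%E.
  by apply: mule_ge0; [rewrite lee_fin ltW|apply: mule_ge0; [exact: f0|exact: mule_ge0]].
have mlin (u v : R) : measurable_fun setT (fun x : R => u * x + v).
  by apply: measurable_funD => //; exact: measurable_funM.
have inner (x : R) : (\int[nu]_y f (a * x + b * y)%R =
    \int[leb]_y ((c / b)%:E * (f (c * y)%R * (pdf ((c * y - a * x) / b)%R)%:E)))%E.
  have mfx : measurable_fun setT (fun y : R => f (a * x + b * y)%R).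
    by apply: mf2; under eq_fun do rewrite addrC; exact: mlin.
  rewrite (@ge0_integral_normal _ _ mfx); last by move=> y; exact: f0.
  have mG : measurable_fun setT (fun y : R => (f (a * x + b * y)%R * (pdf y)%:E)%E).
    by apply: emeasurable_funM; [exact: mfx|exact: mpdf1].
  rewrite (@ge0_integral_affine _ _ (c / b) (- (a * x / b)) cb0 mG); last first.
    by move=> y; exact: mule_ge0.
  rewrite -ge0_integralZl; last 4 first.
  - exact: measurableT.
  - exact: (measurableT_comp mG (mlin _ _)).
  - by move=> y _; exact: mule_ge0.
  - by rewrite lee_fin ltW.
  apply: eq_integral => y _.
  have e1 : a * x + b * (c / b * y - a * x / b) = c * y by field; rewrite gt_eqF.
  have e2 : c / b * y - a * x / b = (c * y - a * x) / b by field; rewrite gt_eqF.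
  by rewrite e1 e2.
have mfc : measurable_fun setT (fun y : R => f (c * y)%R).
  by apply: mf2; exact: measurable_funM.
have mpx (x : R) : measurable_fun setT (fun y : R => (pdf ((c * y - a * x) / b)%R)%:E).
  by apply: (measurableT_comp mpdf1); apply: measurable_funM.
have minner : measurable_fun setT (fun x : R => \int[nu]_y f (a * x + b * y)%R)%E.
  have mg2 : measurable_fun setT (fun z : R * measurableTypeR R => f (a * z.1 + b * z.2)%R).
    apply: (measurableT_comp mf); apply: measurable_funD; exact: measurable_funM.
  have := @measurable_fun_fubini_tonelli_F _ _ _ (measurableTypeR R) R nu _ mg2 (fun z => f0 (a * z.1 + b * z.2)).
  exact.
transitivity (\int[leb]_x \int[leb]_y F (x, y))%E.
  rewrite (@ge0_integral_normal _ _ minner); last by move=> x; apply: integral_ge0.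
  apply: eq_integral => x _; rewrite inner muleC -ge0_integralZl; last 4 first.
  - exact: measurableT.
  - apply: emeasurable_funM => //; apply: emeasurable_funM.
      exact: mfc.
    exact: mpx.
  - by move=> y _; apply: mule_ge0; [rewrite lee_fin ltW|exact: mule_ge0].
  - exact: pdf0.
  apply: eq_integral => y _; rewrite /F/= muleCA; congr (_ * _)%E.
  by rewrite muleCA.
rewrite (@fubini_tonelli _ _ (measurableTypeR R) (measurableTypeR R) R leb leb F mF F0).
rewrite (@ge0_integral_normal _ _ mfc); last by move=> y; exact: f0.
apply: eq_integral => y _.
(* As [c^2 = a^2 + b^2], one has [x^2 + ((c y - a x) / b)^2 = y^2 + ((c x - a y) / b)^2]: the
   density at [y] comes out and the rest is an affine image of the density in [x]. *)
transitivity (\int[leb]_x ((f (c * y)%R * (pdf y)%:E) * ((c / b)%:E * (pdf (c / b * x + - (a * y / b)))%:E)))%E.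
  apply: eq_integral => x _; rewrite /F/= muleCA -muleA; congr (_ * _)%E.
  rewrite -!EFinM; congr (_%:E); rewrite [RHS]mulrCA; congr (_ * _).
  rewrite !normal_pdf1E mulrACA [RHS]mulrACA; congr (_ * _).
  rewrite -!expRD; congr expR; rewrite -!opprD; congr (- _).
  have b1 : b != 0 by rewrite gt_eqF.
  have -> : x ^+ 2 / 2 + ((c * y - a * x) / b) ^+ 2 / 2 =
    (b ^+ 2 * x ^+ 2 + (c * y - a * x) ^+ 2) / (2 * b ^+ 2) by field.
  have -> : y ^+ 2 / 2 + (c / b * x - a * y / b) ^+ 2 / 2 =
    (b ^+ 2 * y ^+ 2 + (c * x - a * y) ^+ 2) / (2 * b ^+ 2) by field.
  by congr (_ / _); rewrite [LHS](_ : _ = (a ^+ 2 + b ^+ 2) * x ^+ 2 + c ^+ 2 * y ^+ 2 - 2 * a * c * x * y);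
    [rewrite -abc (_ : b ^+ 2 = c ^+ 2 - a ^+ 2); [ring|rewrite abc; ring]|ring].
have mpc : measurable_fun setT (fun x : R => (pdf (c / b * x + - (a * y / b)))%:E).
  exact: (measurableT_comp mpdf1 (mlin _ _)).
rewrite ge0_integralZl; last 4 first.
- exact: measurableT.
- by apply: emeasurable_funM.
- by move=> x _; rewrite -EFinM lee_fin; apply: mulr_ge0; [exact: ltW|exact: normal_pdf_ge0].
- exact: mule_ge0.
rewrite ge0_integralZl; last 4 first.
- exact: measurableT.
- exact: mpc.
- by move=> x _; exact: pdf0.
- by rewrite lee_fin ltW.
rewrite -(@ge0_integral_affine _ (EFin \o pdf) (c / b) (- (a * y / b)) cb0 mpdf1 pdf0).
by rewrite integral_normal_pdf mule1.
Qed.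

Lemma measurable_id_measurableTypeR :
  measurable_fun [set: measurableTypeR R] (fun x : measurableTypeR R => x : R).
Proof. by move=> _ A mA; rewrite setTI. Qed.

(* [normal_prob] transported from [measurableTypeR R] to the canonical
   measurable structure of [R], in which random variables take their values. *)
Definition gauss (s : R) : probability R R :=
  law (normal_prob (0 : R) s) measurable_id_measurableTypeR.

Lemma ge0_integral_gauss (s : R) (f : R -> \bar R) : measurable_fun [set: R] f ->
  (forall x, 0 <= f x)%E -> (\int[gauss s]_x f x = \int[normal_prob 0 s]_x f x)%E.
Proof. by move=> mf f0; rewrite ge0_integral_law. Qed.

Lemma integral_gauss (s : R) (f : R -> \bar R) : measurable_fun [set: R] f ->
  (\int[normal_prob 0 s]_x f x = \int[gauss s]_x f x)%E.
Proof.
move=> mf; rewrite integralE [RHS]integralE.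
rewrite (ge0_integral_gauss s (measurable_funepos mf)); last by move=> x; exact: funepos_ge0.
by rewrite (ge0_integral_gauss s (measurable_funeneg mf)) // => x; exact: funeneg_ge0.
Qed.

Lemma Rintegral_gauss_scaling (s : R) (f : R -> R) : 0 < s ->
  measurable_fun setT f -> integrableR (gauss 1) (fun x => f (s * x)) ->
  \int[gauss s]_x f x = \int[gauss 1]_x f (s * x).
Proof.
move=> s0 mf fi.
have mZ : measurable_fun [set: R] (fun x : R => s * x) by exact: measurable_funM.
transitivity (\int[law (gauss 1) mZ]_x f x); last exact: Rintegral_law.
by apply: Rintegral_eq_measure => A mA; rewrite !lawE; exact: normal_scaling.
Qed.

Let mexpq (s : R) : measurable_fun setT (fun x : R => expR (- ((s ^+ 2 - 1) * x ^+ 2 / 2))).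
Proof.
apply: measurableT_comp => //; apply: measurable_funN.
by apply: measurable_funM => //; apply: measurable_funM => //; exact: measurable_funX.
Qed.

(** The Laplace transform of the square of a standard Gaussian. It serves twice: for [s < 1] it
    dominates the moments, and for varying [s] it determines the second one. *)
Lemma normal_expR_quad (s : R) : 0 < s ->
  (\int[gauss 1]_x (expR (- ((s ^+ 2 - 1) * x ^+ 2 / 2)))%:E = s^-1%:E)%E.
Proof.
move=> s0; rewrite ge0_integral_gauss; last 2 first.
- by apply/measurable_EFinP; exact: mexpq.
- by move=> x; rewrite lee_fin expR_ge0.
rewrite ge0_integral_normal; last 2 first.
- by apply/measurable_EFinP; exact: mexpq.
- by move=> x; rewrite lee_fin expR_ge0.
have mps : measurable_fun setT (fun x : R => (pdf (s * x + 0))%:E).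
  apply: (measurableT_comp (mpdf 1)); apply: measurable_funD => //; exact: measurable_funM.
transitivity (s^-1%:E * (s%:E * \int[leb]_x (pdf (s * x + 0))%:E))%E.
  rewrite muleA -EFinM mulVf ?gt_eqF// mul1e; apply: eq_integral => x _.
  rewrite -EFinM; congr (_%:E); rewrite !normal_pdf1E addr0 mulrCA; congr (_ * _).
  by rewrite -expRD; congr expR; field.
have pdf0 x : (0 <= (pdf x)%:E)%E by rewrite lee_fin normal_pdf_ge0.
rewrite -(@ge0_integral_affine _ (EFin \o pdf) s 0 s0 (mpdf 1) pdf0).
by rewrite integral_normal_pdf mule1.
Qed.

Let iexpq (s : R) : 0 < s -> integrableR (gauss 1) (fun x : R => expR (- ((s ^+ 2 - 1) * x ^+ 2 / 2))).
Proof.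
move=> s0; apply/integrableP; split; first by apply/measurable_EFinP; exact: mexpq.
under eq_integral do rewrite /= ger0_norm ?expR_ge0//.
by rewrite normal_expR_quad// ltry.
Qed.

Let Eexpq (s : R) : 0 < s -> \int[gauss 1]_x expR (- ((s ^+ 2 - 1) * x ^+ 2 / 2)) = s^-1.
Proof. by move=> s0; rewrite /Rintegral normal_expR_quad. Qed.

Let s2 : R := Num.sqrt (2^-1).
Let s20 : 0 < s2. Proof. by rewrite sqrtr_gt0 invr_gt0. Qed.
Let s2E : s2 ^+ 2 = 2^-1. Proof. by rewrite sqr_sqrtr// invr_ge0. Qed.

Lemma normal_fourth_integrable : integrableR (gauss 1) (fun x : R => x ^+ 4).
Proof.
(* For [s2 ^+ 2 = 1/2] the exponent is [x^2 / 4], the double of [x^2 / 8]; as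
   [expR (x^2 / 8) >= x^2 / 8], squaring gives [x^4 / 64]. *)
apply: (@integrableR_le _ _ _ _ _ (fun x : R => 64 * expR (- ((s2 ^+ 2 - 1) * x ^+ 2 / 2)))).
- exact: measurable_funX.
- move=> x; rewrite s2E -[x ^+ 4]/(x ^+ (2 * 2)) exprM ger0_norm ?sqr_ge0//.
  have -> : - ((2^-1 - 1) * x ^+ 2 / 2) = x ^+ 2 / 8 + x ^+ 2 / 8 by field.
  rewrite expRD; have := expR_ge1Dx (x ^+ 2 / 8); have := sqr_ge0 x.
  by set y := x ^+ 2; set e := expR _; nra.
- exact/integrableRZ/iexpq.
Qed.

Lemma normal_square_integrable : integrableR (gauss 1) (fun x : R => x ^+ 2).
Proof.
apply: (@integrableR_le _ _ _ _ _ (fun x : R => 1 + x ^+ 4)).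
- exact: measurable_funX.
- move=> x; rewrite ger0_norm ?sqr_ge0// -[x ^+ 4]/(x ^+ (2 * 2)) exprM.
  by have := sqr_ge0 x; set y := x ^+ 2; nra.
- by apply: integrableRD; [exact: integrableR_cst|exact: normal_fourth_integrable].
Qed.

Lemma normal_cube_integrable : integrableR (gauss 1) (fun x : R => `|x| ^+ 3).
Proof.
apply: (@integrableR_le _ _ _ _ _ (fun x : R => 1 + x ^+ 4)).
- exact: (measurable_funX 3 (@normr_measurable R setT)).
- move=> x; rewrite ger0_norm ?exprn_ge0// -[x ^+ 4]/(x ^+ (2 * 2)) exprM.
  rewrite -(@real_normK _ x) ?num_real//; have := normr_ge0 x; set y := `|x| => y0.
  rewrite -exprM; have := sqr_ge0 (y ^+ 2 - y); have := sqr_ge0 (y - 1).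
  by rewrite !exprS expr0 !mulr1; nra.
- by apply: integrableRD; [exact: integrableR_cst|exact: normal_fourth_integrable].
Qed.

Lemma normal_integrable : integrableR (gauss 1) (fun x : R => x).
Proof.
by apply: sq_integrable_integrable; split=> //; exact: normal_square_integrable.
Qed.

Lemma normal_mean0 : \int[gauss 1]_x x = 0.
Proof.
have mN : measurable_fun [set: R] (fun x : R => - x) by exact: measurable_funN.
have iN : integrableR (gauss 1) (fun x : R => - x).
  have := integrableRZ (-1) normal_integrable.
  by apply: eq_integrable => // x _ /=; rewrite mulN1r.
have E : \int[gauss 1]_x x = \int[gauss 1]_x (- x).
  transitivity (\int[law (gauss 1) mN]_x x).
    by apply: Rintegral_eq_measure => A mA; rewrite !lawE; exact/esym/normal_symmetric.
  exact: (@Rintegral_law _ _ _ _ _ (gauss 1) _ mN id (@measurable_id _ _ setT) iN).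
have : \int[gauss 1]_x (- x) = - \int[gauss 1]_x x.
  rewrite -mulN1r -RintegralT_Z; last exact: normal_integrable.
  by apply: eq_Rintegral => x _; rewrite mulN1r.
by rewrite -E => /eqP; rewrite eq_sym eqNr => /eqP.
Qed.

(** No differentiation under the integral: [1 - expR (- y) <= y] at [y = (s^2 - 1) x^2 / 2]
    integrates to [1 - 1/s <= (s^2 - 1) m / 2] for all [s > 0]. The choice [s = 2] shows [m > 0],
    and [s = 1 / sqrt m] then reads [(1 - sqrt m)^2 <= 0]. *)
Lemma normal_second_moment : \int[gauss 1]_x x ^+ 2 = 1.
Proof.
set m := LHS.
have imul (c : R) : integrableR (gauss 1) (fun x : R => c * x ^+ 2 / 2).
  have := integrableRZ (c / 2) normal_square_integrable.
  by apply: eq_integrable => // x _ /=; rewrite mulrAC.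
have bnd (s : R) : 0 < s -> 1 - s^-1 <= (s ^+ 2 - 1) * m / 2.
  move=> s0; have := RintegralT_le (integrableRB (integrableR_cst (gauss 1) 1) (iexpq s0)) (imul (s ^+ 2 - 1)).
  rewrite RintegralT_B ?RintegralT_cst ?Eexpq//; [|exact: integrableR_cst|exact: iexpq].
  have -> : \int[gauss 1]_x ((s ^+ 2 - 1) * x ^+ 2 / 2) = (s ^+ 2 - 1) * m / 2.
    rewrite mulrAC -RintegralT_Z; last exact: normal_square_integrable.
    by apply: eq_Rintegral => x _; rewrite mulrAC.
  apply => x; set y := _ / 2; have := expR_ge1Dx (- y); lra.
have m0 : 0 < m.
  have := bnd 2 ltac:(lra); lra.
set q := Num.sqrt m; have q0 : 0 < q by rewrite sqrtr_gt0.
have qm : m = q ^+ 2 by rewrite sqr_sqrtr// ltW.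
have := bnd q^-1; rewrite invr_gt0 q0 => /(_ isT); rewrite invrK qm.
have -> : (q^-1 ^+ 2 - 1) * q ^+ 2 / 2 = (1 - q ^+ 2) / 2 by field; rewrite gt_eqF.
have -> : 1 - q = (1 - q ^+ 2) / 2 + (1 - q) ^+ 2 / 2 by field.
rewrite gerDl => h.
have := sqr_ge0 (1 - q) => h2.
have /eqP : (1 - q) ^+ 2 = 0 by lra.
by rewrite expf_eq0/= subr_eq0 => /eqP <-; rewrite expr1n.
Qed.

Lemma gauss_convolution (a b c B : R) (f : R -> R) : 0 < b -> 0 < c ->
  c ^+ 2 = a ^+ 2 + b ^+ 2 -> measurable_fun setT f -> (forall x, `|f x| <= B) ->
  \int[gauss 1]_x \int[gauss 1]_y f (a * x + b * y) = \int[gauss 1]_x f (c * x).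
Proof.
move=> b0 c0 abc mf fB.
(* Adding the bound [B] makes the function nonnegative, as the convolution formula for
   extended-valued integrals demands; [B] is subtracted at the end. *)
pose h x := f x + B.
have mh : measurable_fun setT (EFin \o h).
  by apply/measurable_EFinP; exact: measurable_funD.
have h0 x : (0 <= (EFin \o h) x)%E.
  by rewrite lee_fin /h; have := fB x; rewrite ler_norml; lra.
have mlin (u v : R) : measurable_fun setT (fun x : R => u * x + v).
  by apply: measurable_funD => //; exact: measurable_funM.
have ifl u v : integrableR (gauss 1) (fun x => f (u * x + v)).
  apply: (@integrableR_bounded _ _ _ _ _ B) => //.
  exact: (measurableT_comp mf (mlin u v)).
have ifl' u v : integrableR (gauss 1) (fun x => f (v + u * x)).
  by have := ifl u v; apply: eq_integrable => // x _ /=; rewrite addrC.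
have ifc : integrableR (gauss 1) (fun x => f (c * x)).
  by have := ifl c 0; apply: eq_integrable => // x _ /=; rewrite addr0.
have := normal_convolution b0 c0 abc mh h0.
have e1 : (\int[nu]_x (EFin \o h) (c * x)%R = (\int[gauss 1]_x f (c * x) + B)%:E)%E.
  rewrite -ge0_integral_gauss//; last by apply: (measurableT_comp mh); exact: measurable_funM.
  rewrite RintegralE; last by apply: integrableRD => //; exact: integrableR_cst.
  by rewrite RintegralT_D ?RintegralT_cst//; exact: integrableR_cst.
have e2 (x : R) : (\int[nu]_y (EFin \o h) (a * x + b * y)%R =
    (\int[gauss 1]_y f (a * x + b * y) + B)%:E)%E.
  rewrite -ge0_integral_gauss//; last first.
    apply: (measurableT_comp mh); apply: measurable_funD => //; exact: measurable_funM.
  rewrite RintegralE; last by apply: integrableRD => //; exact: integrableR_cst.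
  by rewrite RintegralT_D ?RintegralT_cst//; exact: integrableR_cst.
rewrite e1; under eq_integral do rewrite e2.
have Bf (x : R) : `|\int[gauss 1]_y f (a * x + b * y)| <= B.
  rewrite (le_trans (RintegralT_norm_bound (g := fun=> B) _ _ _)) ?RintegralT_cst//.
  - by apply: integrableR_measurable (ifl' b (a * x)).
  - exact: integrableR_cst.
have mB : measurable_fun [set: R] (fun x : R => \int[gauss 1]_y f (a * x + b * y)).
  have mg2 : measurable_fun setT (fun z : R * R => (EFin \o h) (a * z.1 + b * z.2)).
    apply: (measurableT_comp mh); apply: measurable_funD; exact: measurable_funM.
  have := @measurable_fun_fubini_tonelli_F _ _ R R R (gauss 1) _ mg2 (fun z => h0 (a * z.1 + b * z.2)).
  rewrite /fubini_F.
  have -> : (fun x : R => \int[gauss 1]_y (EFin \o h) (a * (x, y).1 + b * (x, y).2)%R)%E =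
      (fun x : R => (\int[gauss 1]_y f (a * x + b * y) + B)%:E).
    apply/funext => x; rewrite -e2 ge0_integral_gauss//=.
      by apply: (measurableT_comp mh); apply: measurable_funD => //; exact: measurable_funM.
    by move=> y; exact: h0.
  move=> /measurable_EFinP mg.
  have -> : (fun x : R => \int[gauss 1]_y f (a * x + b * y)) =
      (fun x => (\int[gauss 1]_y f (a * x + b * y) + B) - B).
    by apply/funext => x; rewrite addrK.
  exact: measurable_funB.
have iB : integrableR (gauss 1) (fun x : R => \int[gauss 1]_y f (a * x + b * y)).
  exact: integrableR_bounded Bf.
rewrite -ge0_integral_gauss; last 2 first.
- by apply/measurable_EFinP; exact: measurable_funD.
- by move=> x; rewrite lee_fin; have := Bf x; rewrite ler_norml; lra.
rewrite RintegralE; last by apply: integrableRD => //; exact: integrableR_cst.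
rewrite RintegralT_D ?RintegralT_cst//; last exact: integrableR_cst.
by move=> [] /addIr.
Qed.

End normal.

(** * Smooth test functions *)

Section taylor2.
Variable R : realType.
Implicit Types g : R -> R.

(* [g1] and [g2] stand for the first two derivatives of [g0]. Only the Taylor
   remainder is recorded, a form that is obviously stable under Gaussian smoothing. *)
Record taylor2 (C : R) g0 g1 g2 : Prop := Taylor2 {
  taylor2_meas0 : measurable_fun setT g0;
  taylor2_meas1 : measurable_fun setT g1;
  taylor2_meas2 : measurable_fun setT g2;
  taylor2_bnd0 : forall x, `|g0 x| <= C;
  taylor2_bnd1 : forall x, `|g1 x| <= C;
  taylor2_bnd2 : forall x, `|g2 x| <= C;
  taylor2_rem2 : forall x h,
    `|g0 (x + h) - g0 x - g1 x * h - g2 x * h ^+ 2 / 2| <= C * h ^+ 2;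
  taylor2_rem3 : forall x h,
    `|g0 (x + h) - g0 x - g1 x * h - g2 x * h ^+ 2 / 2| <= C * `|h| ^+ 3
}.

Lemma is_derive_continuous g (dg : R -> R) :
  (forall x : R, is_derive x 1 g (dg x)) -> continuous g.
Proof.
by move=> dg' x; apply: differentiable_continuous; apply/derivable1_diffP; case: (dg' x).
Qed.

Lemma mean_value g (dg : R -> R) (x h : R) : (forall x : R, is_derive x 1 g (dg x)) ->
  exists c, `|c - x| <= `|h| /\ g (x + h) - g x = dg c * h.
Proof.
move=> dg'; have cg := is_derive_continuous dg'.
have [h0|h0] := leP 0 h.
  have xh : x <= x + h by rewrite lerDl.
  have [c] := MVT_segment xh (fun y _ => dg' y) (continuous_subspaceT cg).
  rewrite in_itv/= => /andP[c1 c2] ->; exists c; split; last by rewrite addrAC subrr add0r.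
  rewrite !ger0_norm// ?subr_ge0//; lra.
have hx : x + h <= x by lra.
have [c] := MVT_segment hx (fun y _ => dg' y) (continuous_subspaceT cg).
rewrite in_itv/= => /andP[c1 c2] e; exists c; split.
  rewrite (ltr0_norm h0) ler0_norm ?subr_le0//; lra.
rewrite -opprB e; ring.
Qed.

Lemma is_derive_shift g (dg : R -> R) (a t : R) : (forall x : R, is_derive x 1 g (dg x)) ->
  is_derive t 1 (fun u => g (a + u)) (dg (a + t)).
Proof.
move=> dg'; have di : is_derive t (1 : R) (fun u : R => a + u) (0 + 1).
  by apply: is_deriveD.
rewrite add0r in di.
by have := @is_derive1_comp R g (fun u => a + u) t _ _ (dg' _) di; rewrite mulr1.
Qed.

(** Two uses of the mean value theorem write the remainder as [(g2 (x + t') - g2 x) * t * h] with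
    [|t'| <= |t| <= |h|]. Boundedness of [g2] gives the quadratic bound, its Lipschitz property the
    cubic one. *)
Lemma taylor2_of_derivatives g0 g1 g2 (A B L : R) :
  (forall x : R, is_derive x 1 g0 (g1 x)) -> (forall x : R, is_derive x 1 g1 (g2 x)) ->
  continuous g2 -> (forall x, `|g0 x| <= A) -> (forall x, `|g1 x| <= B) ->
  (forall x, `|g2 x| <= L) -> (forall x h, `|g2 (x + h) - g2 x| <= L * `|h|) ->
  exists2 C, taylor2 C g0 g1 g2 & 0 <= C.
Proof.
move=> d0 d1 c2 b0 b1 b2 l2.
have A0 : 0 <= A by exact: le_trans (b0 0).
have B0 : 0 <= B by exact: le_trans (b1 0).
have L0 : 0 <= L by exact: le_trans (b2 0).
pose r x t := g0 (x + t) - g0 x - g1 x * t - g2 x * t ^+ 2 / 2.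
have rE x h : exists t, exists t', [/\ `|t| <= `|h|, `|t'| <= `|t| &
    r x h = (g2 (x + t') - g2 x) * t * h].
  pose q (t : R) := g0 (x + t) - g1 x * t - g2 x * t ^+ 2 / 2.
  have dq t : is_derive t (1 : R) q (g1 (x + t) - g1 x - g2 x * t).
    have dx := is_derive_shift x t d0.
    by rewrite /q; apply: is_derive_eq; rewrite /GRing.scale/=; field.
  have [t [ht et]] := mean_value 0 h dq.
  have [c [hc ec]] := mean_value x t d1.
  exists t, (c - x); split; rewrite ?subr0// in ht *.
  rewrite [x + (c - x)]addrC subrK; move: et ec; rewrite add0r /q /r !addr0 => et ec.
  have -> : g0 (x + h) - g0 x - g1 x * h - g2 x * h ^+ 2 / 2 =
     (g1 (x + t) - g1 x - g2 x * t) * h by rewrite -et; ring.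
  by rewrite ec; ring.
have mc g : continuous g -> measurable_fun setT g by exact: continuous_measurable_fun.
exists (A + B + 2 * L); last by lra.
split.
- exact: (mc _ (is_derive_continuous d0)).
- exact: (mc _ (is_derive_continuous d1)).
- exact: mc.
- by move=> x; apply: le_trans (b0 x) _; lra.
- by move=> x; apply: le_trans (b1 x) _; lra.
- by move=> x; apply: le_trans (b2 x) _; lra.
- move=> x h; rewrite -/(r x h); have [t [t' [h1 h2 ->]]] := rE x h.
  have h3 : `|g2 (x + t') - g2 x| <= 2 * L.
    by rewrite (le_trans (ler_normB _ _))// mulrDl mul1r lerD.
  rewrite !normrM -[h ^+ 2]real_normK ?num_real// expr2 -mulrA.
  apply: ler_pM => //.
    by apply: le_trans h3 _; lra.
  by rewrite ler_wpM2r.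
- move=> x h; rewrite -/(r x h); have [t [t' [h1 h2 ->]]] := rE x h.
  have h3 : `|g2 (x + t') - g2 x| <= L * `|h|.
    by apply: le_trans (l2 x t') _; rewrite ler_wpM2l// (le_trans h2).
  have -> : (A + B + 2 * L) * `|h| ^+ 3 = ((A + B + 2 * L) * `|h|) * (`|h| * `|h|) by ring.
  rewrite !normrM -mulrA.
  apply: ler_pM => //.
    by apply: le_trans h3 _; rewrite ler_wpM2r//; lra.
  by rewrite ler_wpM2r.
Qed.

End taylor2.

(** * Smoothing by moving averages *)

Section smoothing.
Variable R : realType.
Local Notation leb := (@lebesgue_measure R).

Definition compact_support (f : R -> R) :=
  continuous f /\ exists K, forall x, K < `|x| -> f x = 0.

Lemma compact_support_primitive (f : R -> R) : compact_support f ->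
  exists F : R -> R, forall x : R, is_derive x 1 F (f x).
Proof.
move=> [cf [K fK]].
have mf : measurable_fun setT f by exact: continuous_measurable_fun.
have intf : leb.-integrable setT (EFin \o f).
  have -> : EFin \o f = (EFin \o f) \_ `[- K, K].
    apply/funext => x; rewrite patchE; case: ifPn => // /negP; rewrite inE/= in_itv/= => h.
    by rewrite fK// ltNge ler_norml; apply/negP.
  have mD : measurable (`[- K, K] : set (measurableTypeR R)) by exact: measurable_itv.
  apply/(integrable_mkcond _ mD).
  apply: continuous_compact_integrable; first exact: segment_compact.
  exact: continuous_subspaceT.
exists (fun x => \int[leb]_(t in `]-oo, x]) f t) => x.
have intx : leb.-integrable `]-oo, x + 1] (EFin \o f).
  by apply: integrableS intf.
have xu : x < x + 1 by rewrite ltrDl.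
have [|h1 h2] := continuous_FTC1 xu intx _ (cf x); first by rewrite ltNyr.
by apply: DeriveDef; [exact: h1|rewrite -derive1E; exact: h2].
Qed.

(** Each averaging gains one derivative, which is a difference quotient of [f], and keeps compact
    support; by the mean value theorem its values are values of [f] at distance at most [h], so
    bounds persist too. *)
Lemma moving_average (f : R -> R) (h : R) : compact_support f -> 0 < h ->
  exists G : R -> R, [/\ compact_support G,
    forall x : R, is_derive x 1 G ((f (x + h) - f x) / h) &
    forall x, exists c, `|c - x| <= h /\ G x = f c].
Proof.
move=> sf h0; have [F dF] := compact_support_primitive sf.
case: sf => cf [K fK].
pose G x := (F (x + h) - F x) / h.
have dG (x : R) : is_derive x (1 : R) G ((f (x + h) - f x) / h).
  have dx : is_derive x (1 : R) (fun t => F (t + h)) (f (x + h)).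
    by rewrite addrC; under eq_fun do rewrite addrC; exact: is_derive_shift.
  rewrite /G; apply: is_derive_eq; rewrite /GRing.scale/=; ring.
have GE x : exists c, `|c - x| <= h /\ G x = f c.
  have [c [hc ec]] := mean_value x h dF; exists c; split.
    by rewrite (ger0_norm (ltW h0)) in hc.
  by rewrite /G ec mulfK// gt_eqF.
exists G; split=> //; split; first exact: is_derive_continuous dG.
exists (K + h) => x Kx; have [c [hc ->]] := GE x; apply: fK.
have := ler_normB (x - c) (- c); rewrite opprK subrK distrC normrN => h1.
by move: hc h1 Kx; rewrite distrC; lra.
Qed.

Lemma compact_support_unif_continuous (f : R -> R) : compact_support f ->
  forall e, 0 < e -> exists2 h, 0 < h & forall x y, `|x - y| <= h -> `|f x - f y| <= e.
Proof.
move=> [cf [K fK]] e e0.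
(* With a margin of 1 and [d <= 1], a point outside [-K1, K1] and any point within [d] of it both
   lie where [f] vanishes. *)
pose K1 := `|K| + 1.
have cpt : compact `[- K1, K1] by exact: segment_compact.
pose Q (d x : R) := forall y, `|x - y| <= d -> `|f x - f y| <= e.
have : \forall d \near 0^'+, `[- K1, K1] `<=` Q d.
  move/compact_near_coveringP : cpt; apply=> x _.
  have /cvgrPdist_lt /(_ (e / 2)) := cf x; rewrite divr_gt0// => /(_ isT).
  move=> /nbhs_ballP[r /= r0 hr].
  exists (ball x (r / 2), [set d : R | 0 < d < r / 2]).
    split; first by apply: nbhsx_ballx; rewrite divr_gt0.
    near=> d => /=; apply/andP; split => //.
    near: d; apply: nbhs_right_lt; by rewrite divr_gt0.
  move=> [x' d] /= [xx' /andP[d0 dr]] y x'y.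
  have h1 : `|f x - f x'| < e / 2.
    by apply: hr; move: xx'; rewrite /ball/= => xx'; lra.
  have h2 : `|f x - f y| < e / 2.
    apply: hr; rewrite /ball/= (le_lt_trans (ler_distD x' _ _))//.
    by move: xx'; rewrite /ball/= => xx'; lra.
  apply: ltW; apply: (le_lt_trans (ler_distD (f x) _ _)).
  by rewrite distrC in h1; lra.
move=> near_d.
have [d [d0 [d1 hd]]] : exists d : R, 0 < d /\ d <= 1 /\ `[- K1, K1] `<=` Q d.
  near (0 : R)^'+ => d.
  exists d; split => //; split; last by near: d.
  by near: d; exact: nbhs_right_le.
exists d => // x y xy; case: (leP `|x| K1) => [xK|xK].
  by apply: hd => //=; rewrite in_itv/= -ler_norml.
have K1K : K <= K1 - 1 by rewrite /K1 addrK ler_norm.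
rewrite (fK x) ?(fK y) ?subrr ?normr0 ?(ltW e0)//; last lra.
have := ler_normB (x - y) (- y); rewrite opprK subrK normrN; lra.
Unshelve. all: by end_near.
Qed.

(** Three averagings: the second derivative of the third one is a second difference of the first
    one, which is differentiable with bounded derivative, so that this second derivative is
    Lipschitz. *)
Lemma compact_support_smoothing (f : R -> R) (B e : R) : compact_support f ->
  (forall x, `|f x| <= B) -> 0 < e ->
  exists C g0 g1 g2, [/\ 0 <= C, taylor2 C g0 g1 g2, forall x, `|g0 x| <= B &
    forall x, `|g0 x - f x| <= e].
Proof.
move=> sf fB e0; have [d d0 hd] := compact_support_unif_continuous sf e0.
have B0 : 0 <= B by exact: le_trans (fB 0).
(* Three averagings of width [h] displace the argument by at most [3 * h = d]. *)
pose h := d / 3; have h0 : 0 < h by rewrite divr_gt0.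
have [f1 [sf1 df1 f1E]] := moving_average sf h0.
have [f2 [sf2 df2 f2E]] := moving_average sf1 h0.
have [f3 [sf3 df3 f3E]] := moving_average sf2 h0.
have f1B x : `|f1 x| <= B by have [c [_ ->]] := f1E x.
have f2B x : `|f2 x| <= B by have [c [_ ->]] := f2E x.
have f3B x : `|f3 x| <= B by have [c [_ ->]] := f3E x.
pose g1 x := (f2 (x + h) - f2 x) / h.
pose g2 x := ((f1 (x + h + h) - f1 (x + h)) / h - (f1 (x + h) - f1 x) / h) / h.
have dg1 x : is_derive x (1 : R) g1 (g2 x).
  have dx : is_derive x (1 : R) (fun t => f2 (t + h)) ((f1 (x + h + h) - f1 (x + h)) / h).
    have := is_derive_shift h x df2; rewrite [h + x]addrC.
    by under eq_fun do rewrite addrC.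
  rewrite /g1; apply: is_derive_eq; rewrite /GRing.scale/= /g2; ring.
have lip1 x t : `|f1 (x + t) - f1 x| <= 2 * B / h * `|t|.
  have [c [_ ->]] := mean_value x t df1; rewrite !normrM normfV (gtr0_norm h0).
  rewrite ler_wpM2r// ler_pM2r ?invr_gt0// (le_trans (ler_normB _ _))//.
  by rewrite mulrDl mul1r lerD.
have cg2 : continuous g2.
  have c1 := is_derive_continuous df1.
  have cs (a : R) : continuous (fun x => f1 (x + a)).
    by move=> x; apply: continuous_comp; [apply: cvgD; [exact: cvg_id|exact: cvg_cst]|exact: c1].
  have cs2 (a b : R) : continuous (fun x => f1 (x + a + b)).
    move=> x; apply: (@continuous_comp _ _ _ (fun x => x + a) (fun x => f1 (x + b))); last exact: cs.
    by apply: cvgD; [exact: cvg_id|exact: cvg_cst].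
  move=> x; apply: cvgM; last exact: cvg_cst.
  apply: cvgB; (apply: cvgM; last exact: cvg_cst); apply: cvgB.
  - exact: cs2.
  - exact: cs.
  - exact: cs.
  - exact: c1.
(* One constant for two purposes: the first term is the Lipschitz constant of [g2] (four increments
   of [f1]), the second its bound (four values of [f1]). *)
pose L := 2 * B / h * 4 / h ^+ 2 + 4 * B / h ^+ 2.
have hi : 0 < h^-1 by rewrite invr_gt0.
have g2E x : g2 x = (f1 (x + h + h) - f1 (x + h) - (f1 (x + h) - f1 x)) * h^-1 ^+ 2.
  by rewrite /g2; ring.
have BBh : 0 <= 2 * B / h * 4 / h ^+ 2.
  by rewrite !mulr_ge0// ?invr_ge0 ?exprn_ge0 ?(ltW h0).
have BBh2 : 0 <= 4 * B / h ^+ 2.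
  by rewrite !mulr_ge0// ?invr_ge0 ?exprn_ge0 ?(ltW h0).
have [| | |C tC C0] := @taylor2_of_derivatives R f3 g1 g2 B (2 * B / h) L df3 dg1 cg2 f3B.
- move=> x; rewrite normrM normfV (gtr0_norm h0) ler_pM2r//.
  by rewrite (le_trans (ler_normB _ _))// mulrDl mul1r lerD.
- move=> x; rewrite g2E normrM [`|h^-1 ^+ 2|]ger0_norm ?sqr_ge0//.
  apply: (@le_trans _ _ (4 * B * h^-1 ^+ 2)); last by rewrite /L exprVn lerDr.
  rewrite ler_wpM2r ?sqr_ge0//.
  have := f1B (x + h + h); have := f1B (x + h); have := f1B x.
  by rewrite !ler_norml; lra.
- move=> x t; rewrite !g2E -mulrBl normrM [`|h^-1 ^+ 2|]ger0_norm ?sqr_ge0//.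
  apply: (@le_trans _ _ (4 * (2 * B / h * `|t|) * h^-1 ^+ 2)); last first.
    rewrite /L (@le_trans _ _ (2 * B / h * 4 / h ^+ 2 * `|t|))//.
      by rewrite exprVn le_eqVlt; apply/orP; left; apply/eqP; ring.
    by rewrite ler_wpM2r// lerDl.
  rewrite ler_wpM2r ?sqr_ge0//.
  have := lip1 (x + h + h) t; have := lip1 (x + h) t; have := lip1 x t.
  have -> : x + h + h + t = x + t + h + h by ring.
  have -> : x + h + t = x + t + h by ring.
  by set p := 2 * B / h * `|t|; rewrite !ler_norml; lra.
exists C, f3, g1, g2; split=> // x.
have [c3 [h3 e3]] := f3E x; have [c2 [h2 e2]] := f2E c3; have [c1 [h1 e1]] := f1E c2.
rewrite e3 e2 e1; apply: hd.
rewrite (le_trans (ler_distD c2 _ _))// (@le_trans _ _ (h + (h + h)))//.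
  rewrite lerD// (le_trans (ler_distD c3 _ _))// lerD//.
by rewrite /h; lra.
Qed.

End smoothing.

(** * Lindeberg central limit theorem *)

Lemma telescope_step (R : realDomainType) (x1 x2 x3 x4 x5 y1 y2 y3 : R) :
  `|x1 - x2 - x3| <= y1 -> `|x4 - x2 - x3| <= y2 -> `|x4 - x5| <= y3 ->
  `|x1 - x5| <= y1 + y2 + y3.
Proof. by rewrite !ler_norml; lra. Qed.

Section averaging.
Variable R : realType.
Implicit Types g : R -> R.

(** The heat semigroup: [g] convolved with the centred normal law of standard deviation [b]. It
    plays the part of an added independent Gaussian variable without enlarging [Omega]. *)
Definition gauss_avg (b : R) g (x : R) := \int[gauss (1 : R)]_z g (x + b * z).

Let mshift g (x b : R) : measurable_fun setT g -> measurable_fun setT (fun z : R => g (x + b * z)).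
Proof.
move=> mg; apply: (measurableT_comp mg).
by apply: measurable_funD => //; exact: measurable_funM.
Qed.

Lemma gauss_avg_integrable g (b B x : R) : measurable_fun setT g -> (forall x, `|g x| <= B) ->
  integrableR (gauss (1:R)) (fun z => g (x + b * z)).
Proof. by move=> mg gB; apply: (@integrableR_bounded _ _ _ _ _ B) => //; exact: mshift. Qed.

Lemma gauss_avg_measurable g (b B : R) : measurable_fun setT g -> (forall x, `|g x| <= B) ->
  measurable_fun setT (gauss_avg b g).
Proof.
move=> mg gB.
pose h (z : R * R) : \bar R := (g (z.1 + b * z.2) + B)%:E.
have mh : measurable_fun setT h.
  apply/measurable_EFinP; apply: measurable_funD => //; apply: (measurableT_comp mg).
  by apply: measurable_funD => //; exact: measurable_funM.
have h0 z : (0 <= h z)%E.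
  by rewrite lee_fin; have := gB (z.1 + b * z.2); rewrite ler_norml; lra.
have := @measurable_fun_fubini_tonelli_F _ _ R R R (gauss (1:R)) h mh h0.
have -> : fubini_F (gauss (1:R)) h = (fun x => (gauss_avg b g x + B)%:E).
  apply/funext => x; rewrite /fubini_F /h/=.
  rewrite RintegralE; last first.
    by apply: integrableRD; [exact: gauss_avg_integrable gB|exact: integrableR_cst].
  rewrite RintegralT_D ?RintegralT_cst//; first exact: gauss_avg_integrable gB.
  exact: integrableR_cst.
move=> /measurable_EFinP m.
have -> : gauss_avg b g = (fun x => (gauss_avg b g x + B) - B).
  by apply/funext => x; rewrite addrK.
exact: measurable_funB.
Qed.

Lemma gauss_avg_bound g (b B x : R) : measurable_fun setT g -> (forall x, `|g x| <= B) ->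
  `|gauss_avg b g x| <= B.
Proof.
move=> mg gB; rewrite -[leRHS](RintegralT_cst (gauss (1:R))).
apply: RintegralT_norm_bound => //; last exact: integrableR_cst.
exact: mshift.
Qed.

(** The remainder is linear in the three functions, so the remainder of the averages is the average
    of the remainders. The constant [C] does not change, which makes the errors of all replacements
    uniform. *)
Lemma taylor2_gauss_avg C g0 g1 g2 (b : R) : taylor2 C g0 g1 g2 ->
  taylor2 C (gauss_avg b g0) (gauss_avg b g1) (gauss_avg b g2).
Proof.
move=> [m0 m1 m2 b0 b1 b2 r2 r3].
have i0 x := @gauss_avg_integrable g0 b C x m0 b0.
have i1 x := @gauss_avg_integrable g1 b C x m1 b1.
have i2 x := @gauss_avg_integrable g2 b C x m2 b2.
pose r (x h z : R) := g0 (x + b * z + h) - g0 (x + b * z) - g1 (x + b * z) * h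
  - g2 (x + b * z) * h ^+ 2 / 2.
have mr (x h : R) : measurable_fun setT (r x h).
  have e : (fun z : R => g0 (x + b * z + h)) = (fun z : R => g0 ((x + h) + b * z)).
    by apply/funext => z; rewrite addrAC.
  apply: measurable_funB; first (apply: measurable_funB; first apply: measurable_funB).
  - by rewrite e; exact: mshift.
  - exact: mshift.
  - by apply: measurable_funM => //; exact: mshift.
  - by apply: measurable_funM => //; apply: measurable_funM => //; exact: mshift.
have rE x h : gauss_avg b g0 (x + h) - gauss_avg b g0 x - gauss_avg b g1 x * h -
    gauss_avg b g2 x * h ^+ 2 / 2 = \int[gauss (1 : R)]_z r x h z.
  transitivity (\int[gauss (1 : R)]_z (g0 (x + h + b * z) - g0 (x + b * z) - h * g1 (x + b * z)
     - (h ^+ 2 / 2) * g2 (x + b * z))); last first.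
    by apply: eq_Rintegral => z _; rewrite /r (addrAC x h); ring.
  rewrite RintegralT_B; last 2 first.
  - apply: integrableRB; first exact: integrableRB.
    exact: integrableRZ.
  - exact: integrableRZ.
  rewrite RintegralT_B; last 2 first.
  - exact: integrableRB.
  - exact: integrableRZ.
  by rewrite RintegralT_B// !RintegralT_Z// /gauss_avg; ring.
split.
- exact: gauss_avg_measurable b0.
- exact: gauss_avg_measurable b1.
- exact: gauss_avg_measurable b2.
- by move=> x; exact: gauss_avg_bound.
- by move=> x; exact: gauss_avg_bound.
- by move=> x; exact: gauss_avg_bound.
- move=> x h; rewrite rE -[leRHS](RintegralT_cst (gauss (1:R))).
  by apply: RintegralT_norm_bound => //; [move=> z; exact: r2|exact: integrableR_cst].
- move=> x h; rewrite rE -[leRHS](RintegralT_cst (gauss (1:R))).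
  by apply: RintegralT_norm_bound => //; [move=> z; exact: r3|exact: integrableR_cst].
Qed.

Lemma gauss_avg_semigroup g (B a b c x : R) : 0 <= a -> 0 <= b -> 0 <= c ->
  c ^+ 2 = a ^+ 2 + b ^+ 2 -> measurable_fun setT g -> (forall x, `|g x| <= B) ->
  gauss_avg a (gauss_avg b g) x = gauss_avg c g x.
Proof.
(* The convolution formula needs [0 < b]. If [b = 0] then [c = a] or [c = - a], and the latter
   forces both to be 0. *)
move=> a0; rewrite le_eqVlt => /predU1P[<-|b0].
  rewrite expr0n addr0 => c0 /eqP; rewrite eqf_sqr => /orP[/eqP ->|/eqP ca].
    move=> mg gB; apply: eq_Rintegral => z _; rewrite /gauss_avg.
    under eq_Rintegral do rewrite mul0r addr0.
    by rewrite RintegralT_cst.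
  have [-> ->] : a = 0 /\ c = 0 by split; lra.
  move=> mg gB; rewrite /gauss_avg; apply: eq_Rintegral => z _.
  have -> : (fun u : R => g (x + 0 * z + 0 * u)) = (fun=> g (x + 0 * z)).
    by apply/funext => u; rewrite [0 * u]mul0r addr0.
  by rewrite RintegralT_cst.
move=> c0 cab mg gB.
have c0' : 0 < c.
  by rewrite lt_neqAle c0 andbT; apply/eqP => c00; move: cab; rewrite -c00; nra.
have mgx : measurable_fun setT (fun u => g (x + u)).
  by apply: (measurableT_comp mg); exact: measurable_funD.
apply: (etrans _ (gauss_convolution b0 c0' cab mgx (fun y => gB (x + y)))).
apply: eq_Rintegral => z _; apply: eq_Rintegral => y _.
by rewrite addrA.
Qed.

End averaging.

Section onestep.
Context d (Omega : measurableType d) (R : realType) (P : probability Omega R).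

(** Independence kills the first-order term, as [xi] is centred, and factors the second-order one.
    The two remainder bounds together give [C * xi^2 * min 1 |xi|], the quantity of Lindeberg's
    condition. *)
Lemma taylor2_step C (g0 g1 g2 : R -> R) (W xi : Omega -> R) (v e : R) :
  taylor2 C g0 g1 g2 -> 0 <= C -> measurable_fun setT W -> sq_integrable P xi -> indep2 P W xi ->
  \int[P]_w xi w = 0 -> \int[P]_w (xi w ^+ 2) = v ->
  \int[P]_w (xi w ^+ 2 * Num.min 1 `|xi w|) <= e ->
  `|\int[P]_w g0 (W w + xi w) - \int[P]_w g0 (W w) - v / 2 * \int[P]_w g2 (W w)| <= C * e.
Proof.
move=> [m0 m1 m2 b0 b1 b2 r2 r3] C0 mW [mxi i2xi] Wxi xi0 xi2 xie.
have ixi : integrableR P xi by exact: sq_integrable_integrable.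
have ib (g : R -> R) (X : Omega -> R) : measurable_fun setT g -> measurable_fun setT X ->
    (forall x, `|g x| <= C) -> integrableR P (fun w => g (X w)).
  move=> mg mX gC; apply: (@integrableR_bounded _ _ _ _ _ C) => //.
  exact: measurableT_comp.
have mWxi : measurable_fun setT (fun w => W w + xi w) by exact: measurable_funD.
have [i1 e1] : integrableR P (fun w => g1 (W w) * xi w) /\
    \int[P]_w (g1 (W w) * xi w) = (\int[P]_w g1 (W w)) * (\int[P]_w xi w).
  apply: indep2_integralM => //; last exact: ib.
  by apply: (indep2_comp (v := id)) Wxi.
have [i2 e2] : integrableR P (fun w => g2 (W w) * xi w ^+ 2) /\
    \int[P]_w (g2 (W w) * xi w ^+ 2) = (\int[P]_w g2 (W w)) * (\int[P]_w (xi w ^+ 2)).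
  apply: indep2_integralM => //; last exact: ib.
  exact: (indep2_comp m2 (measurable_funX 2 (@measurable_id _ _ setT)) Wxi).
pose r w := g0 (W w + xi w) - g0 (W w) - g1 (W w) * xi w - g2 (W w) * xi w ^+ 2 / 2.
have i2' : integrableR P (fun w => g2 (W w) * xi w ^+ 2 / 2).
  have := integrableRZ (2^-1) i2; apply: eq_integrable => // w _ /=.
  by rewrite mulrC.
have ia : integrableR P (fun w => g0 (W w + xi w) - g0 (W w)).
  by apply: integrableRB; [exact: (ib g0)|exact: (ib g0)].
have ir : integrableR P r by apply: integrableRB => //; exact: integrableRB.
have -> : \int[P]_w g0 (W w + xi w) - \int[P]_w g0 (W w) - v / 2 * \int[P]_w g2 (W w) =
    \int[P]_w r w.
  rewrite RintegralT_B//; last exact: integrableRB.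
  rewrite RintegralT_B// RintegralT_B//; [|exact: (ib g0)|exact: (ib g0)].
  rewrite e1 xi0 mulr0 subr0; congr (_ - _).
  transitivity (2^-1 * \int[P]_w (g2 (W w) * xi w ^+ 2)); first by rewrite e2 xi2; ring.
  rewrite -RintegralT_Z//.
  by apply: eq_Rintegral => w _; rewrite mulrC.
have mmin : measurable_fun setT (fun w => Num.min 1 `|xi w|).
  by apply: measurable_minr => //; exact: measurableT_comp.
have imin : integrableR P (fun w => xi w ^+ 2 * Num.min 1 `|xi w|).
  apply: (integrableR_le (g := fun w => xi w ^+ 2)) => //.
    by apply: measurable_funM => //; exact: measurable_funX.
  move=> w; rewrite normrM ger0_norm ?sqr_ge0// ler_piMr ?sqr_ge0//.
  by rewrite ger0_norm ?ge_min ?lexx// le_min ler01 normr_ge0.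
apply: (@le_trans _ _ (C * \int[P]_w (xi w ^+ 2 * Num.min 1 `|xi w|))); last by rewrite ler_wpM2l.
rewrite -RintegralT_Z//; apply: RintegralT_norm_bound => //.
- by have /integrableR_measurable := ir.
- move=> w; rewrite /r; case: (leP 1 `|xi w|) => _.
    by rewrite mulr1; exact: r2.
  apply: le_trans (r3 _ _) _; rewrite le_eqVlt; apply/orP; left; apply/eqP.
  by rewrite -[xi w ^+ 2]real_normK ?num_real//; ring.
- exact: integrableRZ.
Qed.

End onestep.

Section lindeberg.
Context d (Omega : measurableType d) (R : realType) (P : probability Omega R).
Let m3 : R := \int[gauss (1:R)]_z (`|z| ^+ 3).

(** The Gaussian counterpart of [taylor2_step]: for equal variances the second-order terms are the
    same, so they cancel when the two are compared. *)
Lemma taylor2_gauss_step C (g0 g1 g2 : R -> R) (b x : R) : taylor2 C g0 g1 g2 ->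
  0 <= C -> 0 <= b ->
  `|gauss_avg b g0 x - g0 x - b ^+ 2 / 2 * g2 x| <= C * (b ^+ 3 * m3).
Proof.
move=> [mg0 mg1 mg2 b0 b1 b2 r2 r3] C0 b0'.
have i0 := @gauss_avg_integrable _ g0 b C x mg0 b0.
have i1 := integrableRZ (g1 x * b) (normal_integrable R).
have i2 := integrableRZ (g2 x * b ^+ 2 / 2) (normal_square_integrable R).
have i01 := integrableRB i0 (integrableR_cst (gauss (1:R)) (g0 x)).
have -> : gauss_avg b g0 x - g0 x - b ^+ 2 / 2 * g2 x = \int[gauss (1:R)]_z
   (g0 (x + b * z) - g0 x - g1 x * b * z - g2 x * b ^+ 2 / 2 * z ^+ 2).
  rewrite RintegralT_B//; last exact: integrableRB.
  rewrite RintegralT_B// RintegralT_B ?RintegralT_cst//; last exact: integrableR_cst.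
  rewrite (RintegralT_Z _ (normal_integrable R)) (RintegralT_Z _ (normal_square_integrable R)).
  by rewrite normal_mean0 normal_second_moment /gauss_avg; ring.
have i3 := integrableRZ (C * b ^+ 3) (normal_cube_integrable R).
rewrite mulrA -RintegralT_Z; last exact: normal_cube_integrable.
apply: RintegralT_norm_bound i3.
  by apply: (@integrableR_measurable _ _ _ (gauss (1:R))); apply: integrableRB => //; exact: integrableRB.
move=> z; have := r3 x (b * z); rewrite normrM (ger0_norm b0') exprMn exprMn.
by rewrite !mulrA; apply: le_trans; rewrite le_eqVlt; apply/orP; left; apply/eqP; congr (`|_|); ring.
Qed.

Variables (T : choiceType) (xi : T -> Omega -> R) (b e : R).
Hypotheses (b0 : 0 <= b) (ixi : mutually_independent P xi).
Hypothesis xi2 : forall t, sq_integrable P (xi t).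
Hypothesis xi_mean : forall t, \int[P]_w xi t w = 0.
Hypothesis xi_var : forall t, \int[P]_w (xi t w ^+ 2) = b ^+ 2.
Hypothesis xi_tail : forall t, \int[P]_w (xi t w ^+ 2 * Num.min 1 `|xi t w|) <= e.

Let mxi t : measurable_fun setT (xi t). Proof. by case: (xi2 t). Qed.

Lemma block_sum_measurable (J s : seq T) : {subset s <= J} ->
  measurable_fun (setT : set (g_sigma_algebraType (block xi J))) (fun w => \sum_(u <- s) xi u w).
Proof.
elim: s => [|u s ih] hs; first by under eq_fun do rewrite big_nil; exact: measurable_cst.
under eq_fun do rewrite big_cons.
apply: measurable_funD; first by apply: xi_block_measurable; apply: hs; rewrite mem_head.
by apply: ih => x xs; apply: hs; rewrite in_cons xs orbT.
Qed.

(* The [m] summands already replaced by Gaussian ones are carried by [gauss_avg]. *)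
Lemma lindeberg_swap C (g0 g1 g2 : R -> R) (s : seq T) (m : nat) :
  taylor2 C g0 g1 g2 -> 0 <= C -> uniq s ->
  `|\int[P]_w gauss_avg (Num.sqrt m%:R * b) g0 (\sum_(t <- s) xi t w) -
    gauss_avg (Num.sqrt (m + size s)%:R * b) g0 0| <=
  (size s)%:R * (C * (e + b ^+ 3 * m3)).
Proof.
move=> tg C0; elim: s m => [|t s ih] m us.
  under eq_Rintegral do rewrite big_nil.
  by rewrite RintegralT_cst addn0 subrr normr0 mul0r.
have /andP[ts us'] : (t \notin s) && uniq s by [].
pose W w := \sum_(u <- s) xi u w.
have mWb : measurable_fun (setT : set (g_sigma_algebraType (block xi s))) W.
  exact: block_sum_measurable.
have mW : measurable_fun setT W by exact: (block_measurable_fun mxi mWb).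
have Wt : indep2 P W (xi t).
  apply: (block_indep2 mxi ixi (J1 := s) (J2 := [:: t])) => //.
    by rewrite cat_uniq us'/= orbF ts.
  by apply: xi_block_measurable; rewrite inE.
pose a := Num.sqrt m%:R * b; pose a' := Num.sqrt m.+1%:R * b.
have ta := taylor2_gauss_avg a tg.
have step1 := taylor2_step ta C0 mW (xi2 t) Wt (xi_mean t) (xi_var t) (xi_tail t).
(* The Gaussian variable that replaces [xi t] merges with the [m] earlier ones into a single one of
   variance [m.+1 * b ^+ 2]. *)
have a'E x : gauss_avg b (gauss_avg a g0) x = gauss_avg a' g0 x.
  apply: (gauss_avg_semigroup (B := C)) => //.
  - by rewrite mulr_ge0 ?sqrtr_ge0.
  - by rewrite mulr_ge0 ?sqrtr_ge0.
  - by rewrite !exprMn !sqr_sqrtr// -natr1; ring.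
  - by case: tg.
  - by case: tg.
have ib (g : R -> R) : measurable_fun setT g -> (forall x, `|g x| <= C) ->
    integrableR P (fun w => g (W w)).
  move=> mg gC; apply: (@integrableR_bounded _ _ _ _ _ C) => //.
  exact: measurableT_comp.
have iA0 : integrableR P (fun w => gauss_avg a g0 (W w)) by case: ta => *; exact: ib.
have iA2 : integrableR P (fun w => gauss_avg a g2 (W w)) by case: ta => *; exact: ib.
have iA' : integrableR P (fun w => gauss_avg a' g0 (W w)).
  by case: (taylor2_gauss_avg a' tg) => *; exact: ib.
have step2 : `|\int[P]_w gauss_avg a' g0 (W w) - \int[P]_w gauss_avg a g0 (W w) -
    b ^+ 2 / 2 * \int[P]_w gauss_avg a g2 (W w)| <= C * (b ^+ 3 * m3).
  rewrite -RintegralT_B// -RintegralT_Z// -RintegralT_B//; last 2 first.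
  - exact: integrableRB.
  - exact: integrableRZ.
  rewrite -[leRHS](RintegralT_cst P).
  apply: RintegralT_norm_bound; last exact: integrableR_cst.
    apply: (@integrableR_measurable _ _ _ P).
    by apply: integrableRB; [exact: integrableRB|exact: integrableRZ].
  by move=> w; rewrite -a'E; exact: (taylor2_gauss_step (W w) ta C0 b0).
have := ih m.+1 us'; rewrite -/a' addSn -addnS => step3.
have -> : (size (t :: s))%:R * (C * (e + b ^+ 3 * m3)) =
  (C * e + C * (b ^+ 3 * m3)) + (size s)%:R * (C * (e + b ^+ 3 * m3)).
  by rewrite /= -natr1; ring.
have -> : (fun w => gauss_avg (Num.sqrt m%:R * b) g0 (\sum_(u <- t :: s) xi u w)) =
    (fun w => gauss_avg a g0 (W w + xi t w)).
  by apply/funext => w; rewrite big_cons addrC.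
exact: (telescope_step step1 step2 step3).
Qed.

End lindeberg.

Section clt.
Context d (Omega : measurableType d) (R : realType) (P : probability Omega R).
Variables (T : choiceType) (xi : T -> Omega -> R) (b : R).
Hypotheses (b0 : 0 <= b) (ixi : mutually_independent P xi).
Hypothesis xi2 : forall t, sq_integrable P (xi t).
Hypothesis xi_mean : forall t, \int[P]_w xi t w = 0.
Hypothesis xi_var : forall t, \int[P]_w (xi t w ^+ 2) = b ^+ 2.
Hypothesis xi_tail : forall e, 0 < e -> exists2 a0, 0 < a0 & forall a t, 0 < a -> a <= a0 ->
  \int[P]_w (xi t w ^+ 2 * Num.min 1 (a * `|xi t w|)) <= e.

(** Sums run over arbitrary lists of indices, not initial segments of a sequence, because the strata
    enter in proportions that vary with [k]. The tail hypothesis is uniform in the index. *)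
Theorem lindeberg_clt C (g0 g1 g2 : R -> R) (s : nat -> seq T) :
  taylor2 C g0 g1 g2 -> 0 <= C -> (forall k, uniq (s k)) ->
  (fun k => (size (s k))%:R^-1 : R) @ \oo --> (0 : R) ->
  (forall k, (0 < size (s k))%N) ->
  (fun k => \int[P]_w g0 ((Num.sqrt (size (s k))%:R)^-1 * \sum_(t <- s k) xi t w)) @ \oo -->
  \int[gauss (1:R)]_z g0 (b * z).
Proof.
move=> tg C0 us sz sz0.
set m3 := \int[gauss (1:R)]_z (`|z| ^+ 3).
have m30 : 0 <= m3 by apply: Rintegral_ge0 => z _; rewrite exprn_ge0.
apply/cvgrPdist_le => e e0.
(* After scaling by [c] with [c ^+ 2 = 1 / n], the [n] replacements cost
   [C * e1 + c * (C * b ^+ 3 * m3)]. This [e1] makes the first term at most [e / 2];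
   [c <= e / (2 * M)] does the same for the second. *)
pose e1 := e / (2 * (C + 1)); have e10 : 0 < e1 by rewrite divr_gt0// mulr_gt0//; lra.
have [a0 a00 ha0] := xi_tail e10.
pose M := C * b ^+ 3 * m3 + 1; have M0 : 0 < M.
  by rewrite ltr_wpDl// !mulr_ge0// exprn_ge0.
pose q := Num.min a0 (e / (2 * M)); have q0 : 0 < q.
  by rewrite lt_min a00 divr_gt0// mulr_gt0.
have /cvgrPdist_le /(_ (q ^+ 2)) := sz; rewrite exprn_gt0// => /(_ isT).
apply: filterS => k hk.
set n := size (s k) in hk *; set c := (Num.sqrt n%:R)^-1.
have n0 : (0 : R) < n%:R by rewrite ltr0n; exact: sz0.
have c0 : 0 < c by rewrite invr_gt0 sqrtr_gt0.
have c2 : c ^+ 2 = n%:R^-1 by rewrite exprVn sqr_sqrtr// ltW.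
have cq : c <= q.
  rewrite -(@ler_pXn2r _ 2)// ?nnegrE ?(ltW c0) ?(ltW q0)// c2.
  by move: hk; rewrite sub0r normrN ger0_norm// invr_ge0 ltW.
have ca0 : c <= a0 by apply: le_trans cq _; rewrite ge_min lexx.
have ce : c <= e / (2 * M) by apply: le_trans cq _; rewrite ge_min lexx orbT.
pose eta t w := c * xi t w.
have ieta : mutually_independent P eta.
  by apply: (mutually_independent_comp (h := fun _ x => c * x) _ ixi) => t; exact: measurable_funM.
have eta2 t : sq_integrable P (eta t) by exact: sq_integrableZ.
have eta_mean t : \int[P]_w eta t w = 0.
  by rewrite RintegralT_Z ?xi_mean ?mulr0//; exact: sq_integrable_integrable.
have eta_var t : \int[P]_w (eta t w ^+ 2) = (c * b) ^+ 2.
  rewrite exprMn -(xi_var t) -RintegralT_Z; last by case: (xi2 t).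
  by apply: eq_Rintegral => w _; rewrite /eta exprMn.
have eta_tail t : \int[P]_w (eta t w ^+ 2 * Num.min 1 `|eta t w|) <= c ^+ 2 * e1.
  have -> : \int[P]_w (eta t w ^+ 2 * Num.min 1 `|eta t w|) =
      c ^+ 2 * \int[P]_w (xi t w ^+ 2 * Num.min 1 (c * `|xi t w|)).
    rewrite -RintegralT_Z; last first.
      have [mx ix] := xi2 t; apply: (integrableR_le (g := fun w => xi t w ^+ 2)) => //.
        apply: measurable_funM; first exact: measurable_funX.
        apply: measurable_minr => //; apply: measurable_funM => //.
        exact: measurableT_comp.
      move=> w; rewrite normrM ger0_norm ?sqr_ge0// ler_piMr ?sqr_ge0//.
      by rewrite ger0_norm ?ge_min ?lexx// le_min ler01 mulr_ge0// ltW.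
    by apply: eq_Rintegral => w _; rewrite /eta exprMn normrM (gtr0_norm c0) mulrA.
  by rewrite ler_pM2l ?exprn_gt0//; exact: ha0.
have := lindeberg_swap (mulr_ge0 (ltW c0) b0) ieta eta2 eta_mean eta_var eta_tail 0 tg C0 (us k).
rewrite add0n -/n -/m3.
have -> : (fun w => gauss_avg (Num.sqrt 0%:R * (c * b)) g0 (\sum_(t <- s k) eta t w)) =
  (fun w => g0 (c * \sum_(t <- s k) xi t w)).
  apply/funext => w; rewrite /gauss_avg sqrtr0 mul0r -mulr_sumr.
  under eq_Rintegral do rewrite mul0r addr0.
  by rewrite RintegralT_cst.
have -> : gauss_avg (Num.sqrt n%:R * (c * b)) g0 0 = \int[gauss (1:R)]_z g0 (b * z).
  apply: eq_Rintegral => z _; rewrite add0r mulrA divff ?mul1r//.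
  by rewrite gt_eqF// sqrtr_gt0.
rewrite distrC => /le_trans; apply.
have -> : n%:R * (C * (c ^+ 2 * e1 + (c * b) ^+ 3 * m3)) = C * e1 + c * (C * b ^+ 3 * m3).
  have -> : n%:R = (c ^+ 2)^-1 by rewrite c2 invrK.
  by field; rewrite gt_eqF.
have h1 : C * e1 <= e / 2.
  have -> : e / 2 = (C + 1) * e1 by rewrite /e1; field; rewrite gt_eqF//; lra.
  by rewrite ler_pM2r//; lra.
have h2 : c * (C * b ^+ 3 * m3) <= e / 2.
  apply: (@le_trans _ _ (e / (2 * M) * M)).
    apply: ler_pM => //; first exact: ltW.
      by rewrite !mulr_ge0// exprn_ge0.
    by rewrite /M; lra.
  by rewrite le_eqVlt; apply/orP; left; apply/eqP; field; rewrite gt_eqF.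
lra.
Qed.

End clt.

(** * Convergence in law *)

Lemma three_term_bound (R : realFieldType) (e x1 x2 x3 x4 y1 y2 y3 : R) : 0 < e ->
  `|x1 - x2| <= 2 * (e / 16) + (y1 + y2) -> `|x3 - x4| <= 2 * (e / 16) + y3 ->
  `|x4 - x2| <= e / 16 -> y2 <= e / 8 -> y1 + y3 <= e / 8 -> `|x3 - x1| <= e.
Proof. by rewrite !ler_norml; lra. Qed.

Section law_convergence.
Variable R : realType.

Lemma cutoff_exists (g : R -> R) (B M : R) : 0 <= M -> continuous g -> (forall x, `|g x| <= B) ->
  exists f : R -> R, [/\ compact_support f, forall x, `|f x| <= B &
    forall x, `|x| <= M + 1 -> f x = g x].
Proof.
move=> M0 cg gB.
pose chi (x : R) := Num.max 0 (Num.min 1 (M + 2 - `|x|)).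
have chi01 x : 0 <= chi x <= 1.
  by rewrite /chi le_max lexx/= ge_max ler01 ge_min lexx.
exists (fun x => g x * chi x); split.
- split.
    move=> x; apply: cvgM; first exact: cg.
    apply: (@continuous_max _ _ (cst 0) (fun x => Num.min 1 (M + 2 - `|x|))); first exact: cvg_cst.
    apply: (@continuous_min _ _ (cst 1) (fun x => M + 2 - `|x|)); first exact: cvg_cst.
    apply: cvgB; first exact: cvg_cst.
    exact: norm_continuous.
  exists (M + 2) => x hx; rewrite /chi max_l ?mulr0// ge_min; apply/orP; right; lra.
- move=> x; rewrite normrM -[leRHS]mulr1; apply: ler_pM => //.
  by have /andP[h0 h1] := chi01 x; rewrite ger0_norm.
- move=> x hx; rewrite /chi max_r; last by rewrite le_min ler01/=; lra.
  by rewrite min_l ?mulr1//; lra.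
Qed.

Context d (Omega : measurableType d) (P : probability Omega R).

(** If [|y| <= M] and [|x - y| <= del <= 1] then [|x| <= M + 1], where the cutoff [f] equals [g];
    passing from [f x] to [f y] and on to [g0 y] costs [e] each time. Otherwise the trivial bound
    [2 * B] is used. *)
Lemma norm_sub_le_indic (f g g0 : R -> R) (B M del e x y : R) :
  (forall x, `|g x| <= B) -> (forall x, `|g0 x| <= B) ->
  (forall x, `|x| <= M + 1 -> f x = g x) -> del <= 1 -> 0 <= e ->
  (forall x y, `|x - y| <= del -> `|f x - f y| <= e) ->
  (forall x, `|g0 x - f x| <= e) ->
  `|g x - g0 y| <= 2 * e + 2 * B * ((M < `|y|)%R%:R + (del < `|x - y|)%R%:R).
Proof.
move=> gB g0B fg del1 e0 fu g0f.
have B0 : 0 <= B by exact: le_trans (gB 0).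
have h2B : `|g x - g0 y| <= 2 * B.
  by rewrite (le_trans (ler_normB _ _))// mulrDl mul1r lerD.
case: ltP => [_|yM] /=.
  apply: (le_trans h2B); case: ltP => _ /=; rewrite ?addr0 ?mulr1; lra.
case: ltP => [_|xy] /=; first by apply: (le_trans h2B); rewrite add0r mulr1; lra.
rewrite addr0 mulr0 addr0.
have xM : `|x| <= M + 1.
  have := ler_normD (x - y) y; rewrite subrK; lra.
rewrite -fg//; have := fu x y xy; have := g0f y.
by rewrite !ler_norml; lra.
Qed.

Lemma indic_norm_gt_le (X : Omega -> R) (M : R) : 0 < M -> sq_integrable P X ->
  integrableR P (fun w => (M < `|X w|)%R%:R) /\
  \int[P]_w (M < `|X w|)%R%:R <= (\int[P]_w (X w ^+ 2)) / M ^+ 2.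
Proof.
move=> M0 [mX iX].
have mS : measurable [set w | M < `|X w|].
  by apply: measurable_set_lt => //; exact: measurableT_comp.
have e : (fun w => (M < `|X w|)%R%:R : R) = \1_[set w | M < `|X w|].
  by apply/funext => w; rewrite indicE mem_setE.
rewrite e; split; first exact: integrableR_indic.
rewrite RintegralT_indic//; apply: markovR => //; first by rewrite exprn_gt0.
  by move=> w; exact: sqr_ge0.
move=> w /= h; rewrite -[leRHS]real_normK ?num_real// ler_sqr ?nnegrE ?(ltW h)//; exact: ltW.
Qed.

End law_convergence.

Section slutsky.
Context d (Omega : measurableType d) (R : realType) (P : probability Omega R).
Variables (W Z : nat -> Omega -> R) (s V : R).
Hypothesis s0 : 0 < s.
Hypothesis mZ : forall k, measurable_fun setT (Z k).
Hypothesis W2 : forall k, sq_integrable P (W k).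
Hypothesis WV : forall k, \int[P]_w (W k w ^+ 2) <= V.
Hypothesis W_test : forall C (g0 g1 g2 : R -> R), taylor2 C g0 g1 g2 -> 0 <= C ->
  (fun k => \int[P]_w g0 (W k w)) @ \oo --> \int[gauss (1:R)]_z g0 (s * z).
Hypothesis ZW : forall del, 0 < del ->
  (fun k => fine (P [set w | del < `|Z k w - W k w|])) @ \oo --> (0 : R).

(** A Slutsky argument: bounded second moments make [W] tight, so a bounded continuous test function
    may be cut off and smoothed at a small cost, for [W] and for the Gaussian limit alike. *)
Theorem cvg_in_law_normal : cvg_in_law P Z (normal_prob 0 s).
Proof.
move=> g cg [B gB].
have B0 : 0 <= B by exact: le_trans (gB 0).
have V0 : 0 <= V.
  apply: le_trans (WV 0); apply: Rintegral_ge0 => w _; exact: sqr_ge0.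
have mg : measurable_fun setT g by exact: continuous_measurable_fun.
have mW k : measurable_fun setT (W k) by case: (W2 k).
have ib (h : R -> R) (D : R) (X : Omega -> R) : measurable_fun setT h -> measurable_fun setT X ->
    (forall x, `|h x| <= D) -> integrableR P (fun w => h (X w)).
  move=> mh mX hD; apply: (@integrableR_bounded _ _ _ _ _ D) => //.
  exact: measurableT_comp.
have mZs : measurable_fun setT (fun z : R => s * z) by exact: measurable_funM.
have igG (h : R -> R) (D : R) : measurable_fun setT h ->
    (forall x, `|h x| <= D) -> integrableR (gauss (1:R)) (fun z => h (s * z)).
  move=> mh hD; apply: (@integrableR_bounded _ _ _ _ _ D) => //.
  exact: (measurableT_comp mh mZs).
have lim : (fun k => \int[P]_w g (Z k w)) @ \oo --> \int[gauss (1:R)]_z g (s * z).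
  apply/cvgrPdist_le => e e0.
  (* By Chebyshev the masses beyond [M] of [W k] and of the limit cost together
     [2 * B * (V + s ^+ 2) / M ^+ 2], which is at most [e / 8] once [M ^+ 2 >= Q]. *)
  pose Q := 16 * B * (V + s ^+ 2) / e.
  have Q0 : 0 <= Q by rewrite /Q divr_ge0 ?(ltW e0)// !mulr_ge0// addr_ge0// sqr_ge0.
  pose M := 1 + Q.
  have M1 : 1 <= M by rewrite lerDl.
  have M0 : 0 < M by lra.
  have MQ : Q <= M ^+ 2 by rewrite /M; nra.
  have [f [sf fB fg]] := cutoff_exists (ltW M0) cg gB.
  pose e1 := e / 16; have e10 : 0 < e1 by rewrite divr_gt0.
  have [d1 d10 fu1] := compact_support_unif_continuous sf e10.
  pose del := Num.min d1 1; have del0 : 0 < del by rewrite lt_min d10 ltr01.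
  have fu x y : `|x - y| <= del -> `|f x - f y| <= e1.
    by move=> h; apply: fu1; apply: le_trans h _; rewrite ge_min lexx.
  have del1 : del <= 1 by rewrite ge_min lexx orbT.
  have [C [g0 [g1 [g2 [C0 tg g0B g0f]]]]] := compact_support_smoothing sf fB e10.
  have mg0 := taylor2_meas0 tg.
  have key x y := @norm_sub_le_indic R f g g0 B M del e1 x y gB g0B fg del1 (ltW e10) fu g0f.
  have /cvgrPdist_le /(_ e1 e10) h1 := W_test tg C0.
  have /cvgrPdist_le /(_ (e / (16 * (B + 1)))) := ZW del0.
  have eB0 : 0 < e / (16 * (B + 1)) by rewrite divr_gt0// mulr_gt0//; lra.
  move=> /(_ eB0) h2.
  apply: filterS2 h1 h2 => k h1 h2.
  have [iM PM] := indic_norm_gt_le M0 (W2 k).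
  have mS : measurable [set w | del < `|Z k w - W k w|].
    by apply: measurable_set_lt => //; apply: measurableT_comp => //; exact: measurable_funB.
  have eS : (fun w => (del < `|Z k w - W k w|)%R%:R : R) = \1_[set w | del < `|Z k w - W k w|].
    by apply/funext => w; rewrite indicE mem_setE.
  have iS : integrableR P (fun w => (del < `|Z k w - W k w|)%R%:R).
    by rewrite eS; exact: integrableR_indic.
  have b1 : `|\int[P]_w g (Z k w) - \int[P]_w g0 (W k w)| <=
      2 * e1 + 2 * B * (V / M ^+ 2 + fine (P [set w | del < `|Z k w - W k w|])).
    rewrite -RintegralT_B; [|exact: (ib g B)|exact: (ib g0 B)].
    apply: le_trans.
      apply: (RintegralT_norm_bound (g := fun w => 2 * e1 + 2 * B * ((M < `|W k w|)%R%:R +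
        (del < `|Z k w - W k w|)%R%:R))).
      - by apply: measurable_funB; exact: measurableT_comp.
      - by move=> w; exact: key.
      - by apply: integrableRD; [exact: integrableR_cst|exact/integrableRZ/integrableRD].
    rewrite RintegralT_D ?RintegralT_cst; [|exact: integrableR_cst|exact/integrableRZ/integrableRD].
    rewrite RintegralT_Z; last exact: integrableRD.
    rewrite RintegralT_D// lerD2l ler_wpM2l ?mulr_ge0//.
    apply: lerD; last by rewrite eS RintegralT_indic.
    by apply: le_trans PM _; rewrite ler_pM2r// invr_gt0 exprn_gt0.
  have sz2 : sq_integrable (gauss (1:R)) (fun z => s * z).
    by apply: sq_integrableZ; split => //; exact: normal_square_integrable.
  have [iG PG] := indic_norm_gt_le M0 sz2.
  have b2 : `|\int[gauss (1:R)]_z g (s * z) - \int[gauss (1:R)]_z g0 (s * z)| <=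
      2 * e1 + 2 * B * (s ^+ 2 / M ^+ 2).
    rewrite -RintegralT_B; [|exact: (igG g B)|exact: (igG g0 B)].
    apply: le_trans.
      apply: (RintegralT_norm_bound (g := fun z => 2 * e1 + 2 * B * (M < `|s * z|)%R%:R)).
      - by apply: measurable_funB; [exact: (measurableT_comp mg)|exact: (measurableT_comp mg0)].
      - move=> z; have := key (s * z) (s * z); have dz : (del < 0) = false by rewrite ltNge ltW.
        rewrite subrr normr0 dz addr0.
        exact.
      - by apply: integrableRD; [exact: integrableR_cst|exact: integrableRZ].
    rewrite RintegralT_D ?RintegralT_cst; [|exact: integrableR_cst|exact: integrableRZ].
    rewrite RintegralT_Z// lerD2l ler_wpM2l ?mulr_ge0//.
    apply: le_trans PG _.
    rewrite ler_pM2r ?invr_gt0 ?exprn_gt0//.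
    have -> : \int[gauss (1:R)]_w ((s * w) ^+ 2) = \int[gauss (1:R)]_w (s ^+ 2 * w ^+ 2).
      by apply: eq_Rintegral => z _; rewrite exprMn.
    by rewrite (RintegralT_Z _ (normal_square_integrable R)) normal_second_moment mulr1.
  set pd := fine _ in h2 b1.
  have pd_le : 2 * B * pd <= e / 8.
    have h3 : pd <= e / (16 * (B + 1)).
      by move: h2; rewrite sub0r normrN; apply: le_trans; exact: ler_norm.
    apply: (@le_trans _ _ (2 * (B + 1) * (e / (16 * (B + 1))))); last first.
      rewrite le_eqVlt; apply/orP; left; apply/eqP; field; rewrite gt_eqF//; lra.
    apply: (@le_trans _ _ (2 * B * (e / (16 * (B + 1))))).
      by rewrite ler_wpM2l// mulr_ge0.
    by rewrite ler_pM2r//; lra.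
  have VM : 2 * B * (V / M ^+ 2) + 2 * B * (s ^+ 2 / M ^+ 2) <= e / 8.
    have -> : 2 * B * (V / M ^+ 2) + 2 * B * (s ^+ 2 / M ^+ 2) = (Q * (e / 8)) / M ^+ 2.
      by rewrite /Q; field; rewrite !gt_eqF.
    by rewrite ler_pdivrMr ?exprn_gt0// mulrC ler_pM2l// divr_gt0.
  move: b1 b2 h1 pd_le VM; rewrite /e1.
  move: (\int[P]_w g (Z k w)) (\int[P]_w g0 (W k w)) (\int[gauss (1:R)]_z g (s * z))
    (\int[gauss (1:R)]_z g0 (s * z)) => x1 x2 x3 x4.
  rewrite [2 * B * (V / M ^+ 2 + pd)]mulrDr.
  exact: three_term_bound.
have -> : (\int[normal_prob 0 s]_x (g x)%:E)%E = (\int[gauss (1:R)]_z g (s * z))%:E.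
  have e := @Rintegral_gauss_scaling R s g s0 mg (igG _ B mg gB).
  rewrite -e -RintegralE; last exact: (@integrableR_bounded _ _ _ _ _ B).
  by apply: integral_gauss; exact/measurable_EFinP.
have -> : (fun k => \int[P]_w (g (Z k w))%:E)%E = (fun k => (\int[P]_w g (Z k w))%:E).
  by apply/funext => k; rewrite RintegralE//; exact: (ib g B).
by apply: cvg_EFin; [exact: nearW|exact: lim].
Qed.

End slutsky.

(** * Deterministic analysis of the allocation *)

Lemma cvg_sumr (R : realType) (J : finType) (f : J -> nat -> R) (l : J -> R) :
  (forall j, f j @ \oo --> l j) -> (fun k => \sum_j f j k) @ \oo --> \sum_j l j.
Proof.
move=> fl; elim: (index_enum J) => [|j s IH].
  by under eq_fun do rewrite big_nil; rewrite big_nil; exact: cvg_cst.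
by under eq_fun do rewrite big_cons; rewrite big_cons; exact: cvgD.
Qed.

Section ruleB.
Variables (R : realType) (I : nat) (p : 'I_I -> R) (n0 : 'I_I -> nat) (sh : 'I_I -> R) (L : R).
Hypotheses (p0 : forall i, 0 < p i) (sh0 : forall i, 0 <= sh i) (L0 : 0 <= L).
Hypothesis sh_nz : exists i, sh i != 0.

Let nn j : R := (n0 j).+1%:R.
Let al j := p j * sh j.

(* Rule (b) is a water-filling: [lam] is the common ratio of the strata that receive
   draws, the others being already above the level [al i * lam]. *)
Lemma ruleB_waterfilling : exists lam,
  (forall i, ruleB p n0 sh L i = Num.max (nn i) (al i * lam) - nn i) /\
  \sum_i Num.max (nn i) (al i * lam) = L + \sum_i nn i.
Proof.
pose J := [seq j <- enum 'I_I | sh j != 0].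
pose leT (x y : 'I_I) := nn y / al y <= nn x / al x.
pose s := sort leT J.
have leT_total : total leT by move=> x y; exact: le_total.
have leT_trans : transitive leT by move=> x y z h1 h2; exact: le_trans h2 h1.
have s_sorted : sorted leT s by exact: sort_sorted.
have s_uniq : uniq s by rewrite sort_uniq filter_uniq// enum_uniq.
have s_mem i : (i \in s) = (sh i != 0) by rewrite mem_sort mem_filter mem_enum andbT.
have nn0 i : 0 < nn i by rewrite ltr0n.
have al0 i : i \in s -> 0 < al i.
  by rewrite s_mem => h; rewrite mulr_gt0// lt_neqAle eq_sym h sh0.
have [i0 i0s] : exists i, i \in s by case: sh_nz => i hi; exists i; rewrite s_mem.
have n_gt0 : (0 < size s)%N by case: (s) i0s.
pose ns := map nn s; pose als := map al s.
pose lam t := (L + \sum_(x <- drop t ns) x) / (\sum_(x <- drop t als) x).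
pose cond t := lam t <= ns`_(t.-1) / als`_(t.-1).
pose istar := (\max_(t < size s | (0 < (t : nat))%N && cond (t : nat)) (t : nat))%N.
have istar_lt : (istar < size s)%N.
  by rewrite -(prednK n_gt0) ltnS; apply/bigmax_leqP => t _; rewrite -ltnS prednK.
have rho t : (t < size s)%N -> ns`_t / als`_t = nn (nth i0 s t) / al (nth i0 s t).
  by move=> ts; rewrite !(nth_map i0).
have rho_mono t u : (t <= u)%N -> (u < size s)%N -> ns`_u / als`_u <= ns`_t / als`_t.
  move=> tu us; rewrite !rho ?(leq_ltn_trans tu)//.
  have leT_refl : reflexive leT by move=> x; exact: lexx.
  exact: (sorted_leq_nth leT_trans leT_refl i0 s_sorted t u (leq_ltn_trans tu us) us tu).
have dropE (F : 'I_I -> R) t : \sum_(x <- drop t (map F s)) x = \sum_(i <- drop t s) F i.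
  by rewrite -map_drop big_map.
have al_drop t : (t < size s)%N -> 0 < \sum_(i <- drop t s) al i.
  move=> ts; rewrite (drop_nth i0)// big_cons ltr_pwDl ?al0 ?mem_nth//.
  rewrite big_seq; apply: sumr_ge0 => i id; apply/ltW/al0.
  exact: mem_drop id.
have lamE t : (t < size s)%N -> lam t * \sum_(i <- drop t s) al i = L + \sum_(i <- drop t s) nn i.
  by move=> ts; rewrite /lam !dropE divfK// gt_eqF// al_drop.
(* An empty maximum is 0, so a positive [istar] is attained by an index satisfying [cond]. This
   places the discarded strata above the water level. *)
have star_pos : (0 < istar)%N -> cond istar.
  move=> ipos; have [t /andP[_ ht] ->] : {t : 'I_(size s) | (0 < (t : nat))%N && cond t & istar = t}.
    apply: eq_bigmax_cond; rewrite lt0n; apply: contraTneq ipos => h.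
    rewrite -leqNgt leqn0; apply/eqP; rewrite /istar big_pred0// => t.
    by have /card0_eq/(_ t) := h; rewrite inE.
  exact: ht.
(* [cond] counts from 1, so position [istar] of the list is the first kept stratum. By maximality
   [istar.+1] fails [cond], or the list ends there and [0 <= L] suffices; clearing denominators puts
   this stratum below the level [lam istar]. *)
have star_le : ns`_istar / als`_istar <= lam istar.
  rewrite rho// ler_pdivrMr ?al0 ?mem_nth//.
  have := lamE istar istar_lt; rewrite (drop_nth i0 istar_lt) !big_cons.
  set x := nth i0 s istar; have xs : x \in s by exact: mem_nth.
  have [last|notlast] := leqP (size s) istar.+1.
    by rewrite drop_oversize// !big_nil !addr0 => ->; rewrite lerDr.
  have Ncond : ~~ cond istar.+1.
    apply/negP => hc; have := @leq_bigmax_cond _ (fun t : 'I_(size s) => (0 < (t : nat))%N && cond t)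
      (fun t => t : nat) (Ordinal notlast) hc.
    by rewrite -/istar ltnn.
  have lamS := lamE istar.+1 notlast.
  move: Ncond; rewrite /cond -ltNge/= rho// -/x => lt1 lamI.
  have A0 := al_drop _ notlast; have ax := al0 _ xs.
  move: lamS lamI A0; set A := \sum_(i <- drop istar.+1 s) al i.
  set B := \sum_(i <- drop istar.+1 s) nn i => lamS lamI A0.
  have h1 : nn x / al x * A <= L + B by rewrite -lamS ler_pM2r// ltW.
  have h2 : nn x + nn x / al x * A <= lam istar * (al x + A) by rewrite lamI; lra.
  have h3 : nn x + nn x / al x * A = nn x / al x * (al x + A) by field; rewrite gt_eqF.
  move: h2; rewrite h3 ler_pM2r ?addr_gt0// ler_pdivrMr//.
pose D := drop istar s.
have D_uniq : uniq D by exact: drop_uniq.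
have ruleE i : ruleB p n0 sh L i = if i \in D then al i * lam istar - nn i else 0.
  rewrite /ruleB -/nn -/al -/J -/leT -/s -/ns -/als.
  have -> : (sh i == 0) || (i \in take istar s) = (i \notin D).
    have : (i \in s) = (i \in take istar s) || (i \in D) by rewrite -mem_cat cat_take_drop.
    have : ~~ ((i \in take istar s) && (i \in D)).
      move: s_uniq; rewrite -{1}(cat_take_drop istar s) cat_uniq => /and3P[_ /hasPn h _].
      by apply/negP => /andP[h1 /h]; rewrite /= h1.
    rewrite s_mem; case: (sh i == 0); case: (i \in take istar s); case: (i \in D) => //.
  by case: (i \in D) => //=; rewrite /lam mulrA.
have geD i : i \in D -> nn i <= al i * lam istar.
  move=> /(nthP i0)[t]; rewrite size_drop => ht <-; rewrite nth_drop.
  have ts : (istar + t < size s)%N by rewrite -ltn_subRL.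
  have := rho_mono _ _ (leq_addr t istar) ts; rewrite (rho _ ts) => h.
  have := le_trans h star_le; rewrite ler_pdivrMr ?al0 ?mem_nth//.
  by rewrite mulrC.
have leD i : i \notin D -> al i * lam istar <= nn i.
  move=> iD; case: (eqVneq (sh i) 0) => [si|si].
    by rewrite /al si mulr0 mul0r ltW.
  have /(nthP i0)[t] : i \in take istar s.
    have : i \in s by rewrite s_mem.
    by rewrite -{1}(cat_take_drop istar s) mem_cat (negPf iD) orbF.
  rewrite size_take istar_lt => ht <-; rewrite nth_take//.
  have is0 : (0 < istar)%N by apply: leq_ltn_trans ht.
  have ts := ltn_trans ht istar_lt.
  have ht' : (t <= istar.-1)%N by rewrite -ltnS prednK.
  have := le_trans (star_pos is0) (rho_mono _ _ ht' _).
  move=> /(_ (leq_ltn_trans (leq_pred _) istar_lt)).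
  by rewrite rho// ler_pdivlMr ?al0 ?mem_nth// mulrC.
have maxE i : Num.max (nn i) (al i * lam istar) - nn i = if i \in D then al i * lam istar - nn i else 0.
  case: ifPn => [/geD h|/leD h]; first by rewrite (max_idPr h).
  by rewrite (max_idPl h) subrr.
exists (lam istar); split=> [i|]; first by rewrite ruleE maxE.
apply/eqP; rewrite -subr_eq -sumrB; apply/eqP.
under eq_bigr do rewrite maxE.
rewrite -big_mkcond/= -big_uniq//= sumrB -mulr_suml [X in X - _]mulrC lamE//.
by rewrite addrK.
Qed.

Lemma ruleB_ge0 i : 0 <= ruleB p n0 sh L i.
Proof. by have [lam [-> _]] := ruleB_waterfilling; rewrite subr_ge0 le_max lexx. Qed.

Lemma sum_ruleB : \sum_i ruleB p n0 sh L i = L.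
Proof.
have [lam [E S]] := ruleB_waterfilling; under eq_bigr do rewrite E.
by rewrite sumrB S addrK.
Qed.

(** Each maximum is at least [al j * lam], so the water level is at most the total size divided by
    the sum of the [al j]: a stratum that receives draws is raised at most to its proportional share
    of the total. *)
Lemma ruleB_le i :
  ruleB p n0 sh L i <= Num.max 0 (al i / (\sum_j al j) * (L + \sum_j nn j) - nn i).
Proof.
have [lam [-> S]] := ruleB_waterfilling.
have al_ge0 j : 0 <= al j by rewrite mulr_ge0// ltW.
have al_gt0 : 0 < \sum_j al j.
  case: sh_nz => j hj; rewrite (bigD1 j)//= ltr_pwDl ?sumr_ge0//.
  by rewrite mulr_gt0// lt_neqAle eq_sym hj sh0.
have h : lam <= (L + \sum_j nn j) / \sum_j al j.
  rewrite ler_pdivlMr// -S mulr_sumr; apply: ler_sum => j _.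
  by rewrite le_max [al j * lam]mulrC lexx orbT.
rewrite le_max lerBlDr ge_max; case: (leP (al i * lam) (nn i)) => h2.
  by rewrite add0r h2 lexx.
apply/orP; right; rewrite lerB//.
by rewrite [leRHS]mulrAC -[leRHS]mulrA ler_wpM2l// mulrC.
Qed.

(* A description of rule (b) without sorting, from which its measurability in the
   sampled values can be read off. *)
Lemma le_ruleB i (y : R) : 0 < y ->
  (y <= ruleB p n0 sh L i) = (sh i != 0) &&
  (\sum_j Num.max (nn j) (al j * ((nn i + y) / al i)) <= L + \sum_j nn j).
Proof.
move=> y0; have [lam [-> S]] := ruleB_waterfilling; rewrite -S.
have nn0 j : 0 < nn j by rewrite ltr0n.
have al_ge0 j : 0 <= al j by rewrite mulr_ge0// ltW.
case: (eqVneq (sh i) 0) => [si|si] /=.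
  by rewrite /al si mulr0 mul0r (max_idPl (ltW (nn0 i))) subrr leNgt y0.
have ai : 0 < al i by rewrite mulr_gt0// lt_neqAle eq_sym si sh0.
have -> : (y <= Num.max (nn i) (al i * lam) - nn i) = (nn i + y <= al i * lam).
  by rewrite lerBrDl le_max; have -> : (nn i + y <= nn i) = false by rewrite gerDl leNgt y0.
set x := _ / al i; have -> : nn i + y = al i * x by rewrite mulrC divfK// gt_eqF.
(* The total at level [x] is nondecreasing in [x], and strictly so above the level at which stratum
   [i] starts to fill, which [0 < y] guarantees. Hence comparing totals amounts to comparing
   levels. *)
rewrite ler_pM2l//; apply/idP/idP => [xl|].
  apply: ler_sum => j _; rewrite ge_max !le_max lexx/=; apply/orP; right.
  exact: ler_wpM2l.
apply: contraTT; rewrite -!ltNge => lx.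
have ix : al i * x = nn i + y by rewrite mulrC divfK// gt_eqF.
rewrite (bigD1 i)//= [X in _ < X](bigD1 i)//=; apply: ltr_leD.
  by rewrite lt_max [in X in _ || X]gt_max ix ltrDl y0 -ix ltr_pM2l// lx !orbT.
apply: ler_sum => j _; rewrite ge_max !le_max lexx/=; apply/orP; right.
by apply: ler_wpM2l => //; exact: ltW.
Qed.

End ruleB.

(** * Growth of the sample sizes *)

Section allocation.
Variables (R : realType) (I : nat) (p : 'I_I -> R) (N : nat -> nat) (Y : 'I_I -> nat -> R).
Variable r : alloc_rule.
Hypotheses (p0 : forall i, 0 < p i) (p1 : \sum_i p i = 1).
Hypotheses (N0 : N 0%N = 0%N) (NS : forall k, (N k + I <= N k.+1)%N).
Implicit Types (k : nat) (i : 'I_I).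

Definition step_sd k i := if k == 0%N then 1 else emp_sd Y (alloc p N Y r k i) i.
Definition step_draws k : R := (N k.+1 - N k - I)%N%:R.
Definition step_alloc k i := if [forall j, step_sd k j == 0] then p i * step_draws k
  else match r with
       | RuleA => ruleA p (step_sd k) (step_draws k) i
       | RuleB => ruleB p (alloc p N Y r k) (step_sd k) (step_draws k) i
       end.
Definition step_share k i := p i * step_sd k i / \sum_j p j * step_sd k j.

Lemma step_sd_ge0 k i : 0 <= step_sd k i.
Proof. by rewrite /step_sd; case: ifP => // _; exact: sqrtr_ge0. Qed.

Lemma step_drawsE k : step_draws k = (N k.+1)%:R - (N k)%:R - I%:R.
Proof.
rewrite /step_draws !natrB//; last by rewrite leq_subRL// (leq_trans _ (NS k))// leq_addr.
by rewrite (leq_trans _ (NS k))// leq_addr.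
Qed.

Lemma step_sd_nz k : ~~ [forall j, step_sd k j == 0] -> exists i, step_sd k i != 0.
Proof. by rewrite negb_forall => /existsP. Qed.

Lemma step_sd_sum_gt0 k : (exists i, step_sd k i != 0) -> 0 < \sum_j p j * step_sd k j.
Proof.
move=> [j hj]; rewrite (bigD1 j)//= ltr_pwDl ?sumr_ge0//.
  by rewrite mulr_gt0// lt_neqAle eq_sym hj step_sd_ge0.
by move=> i _; rewrite mulr_ge0 ?step_sd_ge0// ltW.
Qed.

Lemma step_share_ge0 k i : 0 <= step_share k i.
Proof.
rewrite /step_share divr_ge0 ?mulr_ge0 ?step_sd_ge0 ?(ltW (p0 _))//.
by apply: sumr_ge0 => j _; rewrite mulr_ge0 ?step_sd_ge0// ltW.
Qed.

Lemma step_alloc_ge0 k i : 0 <= step_alloc k i.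
Proof.
rewrite /step_alloc; case: ifPn => [_|/step_sd_nz nz]; first by rewrite mulr_ge0// ltW.
case: r; last by apply: ruleB_ge0 => // j; exact: step_sd_ge0.
by rewrite /ruleA mulr_ge0//; exact: step_share_ge0.
Qed.

Lemma step_alloc_sum k : \sum_i step_alloc k i = step_draws k.
Proof.
rewrite /step_alloc; case: (boolP [forall j, step_sd k j == 0]) => [_|/step_sd_nz nz].
  by rewrite -mulr_suml p1 mul1r.
case: r; last by apply: sum_ruleB => // j; exact: step_sd_ge0.
rewrite -mulr_suml -mulr_suml divff ?mul1r//.
by rewrite gt_eqF// step_sd_sum_gt0.
Qed.

Let cum k (t : nat) : R := \sum_(j < I | (j < t)%N) step_alloc k j.

(** The definitions above mirror the local bindings of [alloc], and [j < i.+1] computes to [j <= i],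
    so the recursion holds by conversion. *)
Lemma allocS k i : alloc p N Y r k.+1 i =
  (alloc p N Y r k i + 1 + `|Num.floor (cum k i.+1) - Num.floor (cum k i)|)%N.
Proof. by []. Qed.

Let cumS k i : cum k i.+1 = cum k i + step_alloc k i.
Proof.
rewrite /cum (bigD1 i)//= addrC; congr (_ + _).
by apply: eq_bigl => j; rewrite ltnS ltn_neqAle andbC.
Qed.

Let floor_cum k i : Num.floor (cum k i) <= Num.floor (cum k i.+1).
Proof. by apply: le_floor; rewrite cumS lerDl step_alloc_ge0. Qed.

(** The differences of floors telescope to the floor of the total allocation. That total is an
    integer, so the rounding loses nothing overall. *)
Lemma alloc_sum k : (\sum_i alloc p N Y r k i = N k)%N.
Proof.
elim: k => [|k IH]; first by rewrite N0 big1.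
under eq_bigr do rewrite allocS -addnA.
rewrite big_split/= IH big_split/= sum1_card card_ord.
suff E : (\sum_(i < I) `|Num.floor (cum k i.+1) - Num.floor (cum k i)|)%N = (N k.+1 - N k - I)%N.
  by have := NS k; rewrite E; clear; lia.
apply/eqP; rewrite -(eqr_nat int) natr_sum.
under eq_bigr => i _ do rewrite natz gez0_abs ?subr_ge0 ?floor_cum//.
rewrite -(big_mkord xpredT (fun t => Num.floor (cum k t.+1) - Num.floor (cum k t)))/=.
rewrite telescope_sumr//.
have -> : cum k I = step_draws k.
  by rewrite -step_alloc_sum /cum; apply: eq_bigl => j; rewrite ltn_ord.
rewrite /cum big_pred0; last by move=> j; rewrite ltn0.
by rewrite floor0 subr0 /step_draws natz -[_%:R]/((_%:Z)%:~R) intrKfloor.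
Qed.

Lemma alloc_ge k i : (k <= alloc p N Y r k i)%N.
Proof. by elim: k => // k IH; rewrite allocS addn1 addSn ltnS (leq_trans IH)// leq_addr. Qed.

(* The second argument of [max] is the case of rule (b) where the stratum is raised to
   the water level [step_share k i * N k.+1]. *)
Lemma alloc_step k i : (exists j, step_sd k j != 0) ->
  (alloc p N Y r k.+1 i)%:R <= Num.max
    ((alloc p N Y r k i)%:R + 2 + step_share k i * ((N k.+1)%:R - (N k)%:R))
    (step_share k i * (N k.+1)%:R + 2).
Proof.
move=> nz; set n := (alloc p N Y r k i)%:R.
(* The 2 is the forced draw plus a rounding error below 1. *)
have h : (alloc p N Y r k.+1 i)%:R <= n + 2 + step_alloc k i.
  rewrite allocS !natrD -/n.
  rewrite -[X in _ + X <= _]/(((`|_|%N)%:Z)%:~R) gez0_abs ?subr_ge0 ?floor_cum// intrB.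
  have := floor_le (cum k i.+1); have := floorD1_gt (cum k i); rewrite cumS intrD; lra.
apply: (le_trans h); rewrite /step_alloc.
case: ifPn => [/forallP h'|_]; first by case: nz => j; rewrite h'.
have hB := @ruleB_le R I p (alloc p N Y r k) (step_sd k) (step_draws k) p0 (step_sd_ge0 k) (ler0n _ _) nz i.
move: hB; set pr := alloc p N Y r k => hB; rewrite le_max; case: r.
  apply/orP; left; rewrite lerD2l /ruleA ler_wpM2l ?step_share_ge0// step_drawsE.
  by rewrite gerBl.
move: hB; have -> : step_draws k + \sum_j (pr j).+1%:R = (N k.+1)%:R.
  under eq_bigr do rewrite -natr1.
  by rewrite big_split/= -natr_sum alloc_sum sumr_const card_ord step_drawsE; ring.
rewrite -/(step_share k i) le_max; set m := ruleB _ _ _ _ _ => /orP[|] hb.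
  apply/orP; left; have := step_share_ge0 k i.
  have : 0 <= (N k.+1)%:R - (N k)%:R :> R by rewrite subr_ge0 ler_nat (leq_trans _ (NS k))// leq_addr.
  by move=> h1 h2; have := mulr_ge0 h2 h1; lra.
by apply/orP; right; move: hb; rewrite -natr1 -/n; lra.
Qed.

Hypothesis kN : (fun k => k%:R / (N k)%:R : R) @ \oo --> (0 : R).
Variable s : 'I_I -> R.
Hypotheses (s0 : forall i, 0 <= s i) (s_pos : exists i, 0 < s i).
Hypothesis sd_cvg : forall i, (fun n => emp_sd Y n i) @ \oo --> s i.

Lemma step_sd_cvg i : (fun k => step_sd k i) @ \oo --> s i.
Proof.
have al : (fun k => alloc p N Y r k i) @ \oo --> \oo.
  move=> B [m _ mB]; exists m => // k /= mk; apply: mB => /=.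
  exact: leq_trans (alloc_ge k i).
have := cvg_comp _ _ al (@sd_cvg i); apply: cvg_trans; apply: near_eq_cvg.
by exists 1%N => // k /=; rewrite /step_sd; case: k.
Qed.

Lemma s_sum_gt0 : 0 < \sum_j p j * s j.
Proof.
case: s_pos => j hj; rewrite (bigD1 j)//= ltr_pwDl ?sumr_ge0 ?mulr_gt0//.
by move=> i _; rewrite mulr_ge0// ltW.
Qed.

Let q i := p i * s i / \sum_j p j * s j.

Lemma step_share_cvg i : (fun k => step_share k i) @ \oo --> q i.
Proof.
apply: cvgM; first by apply: cvgM; [exact: cvg_cst|exact: step_sd_cvg].
apply: cvgV; first by rewrite gt_eqF// s_sum_gt0.
by apply: cvg_sumr => j; apply: cvgM; [exact: cvg_cst|exact: step_sd_cvg].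
Qed.

Lemma step_sd_eventually_nz : \forall k \near \oo, exists i, step_sd k i != 0.
Proof.
case: s_pos => i hi; have := step_sd_cvg (i := i) => /cvgrPdist_lt/(_ _ hi).
apply: filterS => k h; exists i; apply: contraTneq h => ->.
by rewrite subr0 ger0_norm ?ltxx// ltW.
Qed.

Lemma N_gt0 k : (0 < I)%N -> (0 < k)%N -> (0 < N k)%N.
Proof. by case: k => // k I0 _; rewrite (leq_trans _ (NS k))// addn_gt0 I0 orbT. Qed.

Lemma alloc_ratio_le i e : 0 < e ->
  \forall k \near \oo, (alloc p N Y r k i)%:R / (N k)%:R <= q i + e.
Proof.
move=> e0; have I0 : (0 < I)%N by apply: leq_ltn_trans (ltn_ord i).
have e2 : 0 < e / 2 by rewrite divr_gt0.
have q0 : 0 <= q i by rewrite divr_ge0 ?mulr_ge0// ltW ?s_sum_gt0.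
have : \forall k \near \oo, (exists j, step_sd k j != 0) /\ step_share k i <= q i + e / 2.
  have := @step_share_cvg i => /cvgrPdist_le/(_ _ e2); apply: filterS2 step_sd_eventually_nz.
  by move=> k nz; rewrite distrC ler_distl => /andP[_ h].
move=> [k0 _ hk0]; pose K : R := (alloc p N Y r k0 i)%:R.
(* An invariant preserved by both arguments of the maximum in [alloc_step]: the first adds at most 2
   and [q i + e / 2] times the increment of [N]; the second is a bound of the same form that forgets
   the past. *)
have inv k : (k0 <= k)%N ->
    (alloc p N Y r k i)%:R <= K + 2 * k%:R + (q i + e / 2) * (N k)%:R.
  elim: k => [|k IH]; first by rewrite leqn0 => /eqP E; rewrite /K E; rewrite !mulr0 N0 mulr0 !addr0.
  rewrite leq_eqVlt => /orP[/eqP <-|]; first by rewrite -/K -addrA lerDl addr_ge0// mulr_ge0// addr_ge0// ltW.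
  rewrite ltnS => kk; have [nz sh] := hk0 k kk.
  apply: le_trans (alloc_step i nz) _; have {IH} := IH kk.
  have dN : 0 <= (N k.+1)%:R - (N k)%:R :> R by rewrite subr_ge0 ler_nat (leq_trans _ (NS k))// leq_addr.
  have := ler_wpM2r dN sh; have := ler_wpM2r (ler0n R (N k.+1)) sh.
  have : 0 <= K by []. have : 0 <= k%:R :> R by [].
  rewrite -natr1 ge_max => h1 h2 h3 h4 h5; apply/andP; split; lra.
(* For [1 <= k] one has [K + 2 * k <= (K + 2) * k], which is at most [e / 2 * N k] for large [k].
   This is where [k / N k --> 0] is used. *)
have K2 : 0 < e / 2 / (K + 2) by rewrite divr_gt0// ltr_wpDl.
have := kN => /cvgrPdist_le/(_ _ K2) [k1 _ hk1].
exists (maxn 1 (maxn k0 k1)) => // k /=; rewrite !geq_max => /and3P[k_1 k_0 kk1].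
have Nk : 0 < (N k)%:R :> R by rewrite ltr0n N_gt0.
have := hk1 k kk1; rewrite /= sub0r normrN ger0_norm ?divr_ge0//.
rewrite ler_pdivrMr// => h1; have K0 : 0 < K + 2 by rewrite ltr_wpDl.
have h2 : (K + 2) * k%:R <= e / 2 * (N k)%:R.
  apply: le_trans (ler_wpM2l (ltW K0) h1) _.
  by rewrite mulrA [X in X * _]mulrC divfK// gt_eqF.
rewrite ler_pdivrMr//; have := inv k k_0.
have : 1 <= k%:R :> R by rewrite ler1n.
have K'0 : 0 <= K by []; move=> /(ler_wpM2l K'0); lra.
Qed.

Lemma alloc_ratio_cvg i :
  (fun k => (alloc p N Y r k i)%:R / (N k)%:R : R) @ \oo --> q i.
Proof.
have I0 : (0 < I)%N by apply: leq_ltn_trans (ltn_ord i).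
apply/cvgrPdist_le => e e0.
(* Ratios and limits both sum to 1, so the deficit of one stratum is at most the excess of the
   others, fewer than [I] times [e']. *)
pose e' := e / (1 + I%:R); have I1 : 0 < 1 + I%:R :> R by rewrite ltr_wpDr.
have e'0 : 0 < e' by rewrite divr_gt0.
have all_le : \forall k \near \oo, forall j, (alloc p N Y r k j)%:R / (N k)%:R <= q j + e'.
  by apply: filter_forall => j; exact: alloc_ratio_le.
have pos : \forall k \near \oo, (0 < N k)%N by exists 1%N => // k /=; exact: N_gt0.
apply: filterS2 pos all_le => k Nk le_k.
have Nk' : 0 < (N k)%:R :> R by rewrite ltr0n.
have sum1 : \sum_j (alloc p N Y r k j)%:R / (N k)%:R = 1 :> R.
  by rewrite -mulr_suml -natr_sum alloc_sum divff// gt_eqF.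
have q1 : \sum_j q j = 1 by rewrite -mulr_suml divff// gt_eqF// s_sum_gt0.
have ee : e' * (1 + I%:R) = e by rewrite divfK// gt_eqF.
have lower : q i - (alloc p N Y r k i)%:R / (N k)%:R <= I%:R * e'.
  have : \sum_(j | j != i) (alloc p N Y r k j)%:R / (N k)%:R <= \sum_(j | j != i) q j + I%:R * e'.
    apply: le_trans (ler_sum _ (fun j _ => le_k j)) _.
    rewrite big_split/= lerD2l.
    have -> : I%:R * e' = \sum_(j < I) e' by rewrite sumr_const card_ord mulr_natl.
    by rewrite [leRHS](bigD1 i)//= lerDr ltW.
  by move: sum1 q1; rewrite (bigD1 i)//= => sum1; rewrite (bigD1 i)//=; lra.
have := le_k i; rewrite ler_distl => up.
have : 0 <= I%:R * e' by rewrite mulr_ge0// ltW.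
move: ee lower up; rewrite mulrDr mulr1 [e' * _]mulrC => ee lower up h.
by apply/andP; split; lra.
Qed.

End allocation.

(** * Measurability of the algorithm *)

Section measurability.
Context d (T : measurableType d) (R : realType).

Lemma measurable_fun_ge (f : T -> R) :
  (forall y, measurable [set w | y <= f w]) -> measurable_fun setT f.
Proof.
move=> h; apply: (measurability (@RGenCInfty.G R)); first exact: RGenCInfty.measurableE.
move=> _ [_ [r ->] <-]; rewrite setTI.
rewrite (_ : _ @^-1` _ = [set w | r <= f w]); first exact: h.
by apply/seteqP; split=> w /=; rewrite in_itv/= andbT.
Qed.

Lemma measurable_natr_fiber (h : T -> nat) (n : nat) :
  measurable_fun setT (fun w => (h w)%:R : R) -> measurable [set w | h w = n].
Proof.
move=> mh; rewrite (_ : [set w | _] = [set w | (h w)%:R == n%:R :> R]).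
  by apply: measurable_set_bool; apply: measurable_fun_eqr.
by apply/seteqP; split=> w /=; rewrite eqr_nat => /eqP.
Qed.

(** Split according to the countably many values of [h]; how [h] depends on the [F n] is
    irrelevant. *)
Lemma measurable_fun_random_index (h : T -> nat) (F : nat -> T -> R) :
  measurable_fun setT (fun w => (h w)%:R : R) ->
  (forall n, measurable_fun setT (F n)) -> measurable_fun setT (fun w => F (h w) w).
Proof.
move=> mh mF _ B mB; rewrite setTI.
rewrite (_ : _ @^-1` _ = \bigcup_n ([set w | h w = n] `&` F n @^-1` B)).
  apply: bigcup_measurable => n _; apply: measurableI; first exact: measurable_natr_fiber.
  by rewrite -[X in measurable X]setTI; exact: mF.
by apply/seteqP; split=> [w Bw|w [n _ [<-]]//]; exists (h w).
Qed.

(** Via [1 / x = x * (x^2)^-1], where the inverse of a nonnegative number is a power. At 0 both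
    sides are 0 by the convention on inverses. *)
Lemma measurable_funV (f : T -> R) :
  measurable_fun setT f -> measurable_fun setT (fun w => (f w)^-1).
Proof.
move=> mf; rewrite (_ : (fun w => _) = (fun w => f w * ((f w ^+ 2) `^ (- 1)))).
  apply: measurable_funM => //.
  by apply: (measurableT_comp (@measurable_powR R (- 1))); exact: measurable_funX.
apply/funext => w; rewrite powR_inv1 ?sqr_ge0//.
have [->|h] := eqVneq (f w) 0; first by rewrite invr0 mul0r.
by rewrite expr2 invfM mulrA divff// mul1r.
Qed.

Lemma measurable_sum_cond n (P : pred 'I_n) (h : 'I_n -> T -> R) :
  (forall i, measurable_fun setT (h i)) ->
  measurable_fun setT (fun w => \sum_(i | P i) h i w).
Proof.
move=> mh; under eq_fun do rewrite big_mkcond.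
by apply: measurable_sum => i; case: (P i).
Qed.

Variables (I : nat) (p : 'I_I -> R) (N : nat -> nat) (Y : 'I_I -> nat -> T -> R) (r : alloc_rule).
Hypotheses (p0 : forall i, 0 < p i) (mY : forall i j, measurable_fun setT (Y i j)).

Let Yw w i j := Y i j w.
Let al k w := alloc p N (Yw w) r k.

Lemma measurable_emp_sd n i : measurable_fun setT (fun w => emp_sd (Yw w) n i).
Proof.
apply: (measurableT_comp (continuous_measurable_fun (@sqrt_continuous R))).
apply: measurable_funB; first apply: measurable_funM => //.
  by apply: measurable_sum => j; apply: measurable_funX; exact: mY.
apply: measurable_funX; apply: measurable_funM => //.
by apply: measurable_sum => j; exact: mY.
Qed.

Lemma measurable_alloc k i : measurable_fun setT (fun w => (al k w i)%:R : R).
Proof.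
elim: k i => [|k IH] i; first exact: measurable_cst.
pose sd w := step_sd p N (Yw w) r k.
have msd j : measurable_fun setT (fun w => sd w j).
  rewrite /sd /step_sd; case: (k == 0%N) => //.
  apply: (measurable_fun_random_index (F := fun n w => emp_sd (Yw w) n j)).
    exact: IH.
  by move=> n; exact: measurable_emp_sd.
have mz j : measurable [set w | sd w j == 0].
  by apply: measurable_set_bool; exact: measurable_fun_eqr.
have m0 : measurable [set w | [forall j, sd w j == 0]].
  rewrite (_ : [set w | _] = \bigcap_(j in [set` predT]) [set w | sd w j == 0]).
    by apply: fin_bigcap_measurable.
  by apply/seteqP; split=> w /=; [move=> /forallP h j _; exact: h|move=> h; apply/forallP => j; exact: h].
have mal j : measurable_fun setT (fun w => p j * sd w j) by apply: measurable_funM.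
have mstep j : measurable_fun setT (fun w => step_alloc p N (Yw w) r k j).
  have sd0 w i' : 0 <= sd w i' by exact: step_sd_ge0.
  rewrite /step_alloc; have pL : measurable_fun setT (fun _ : T => p j * step_draws R I N k) by [].
  move: IH sd0 msd mz m0 mal; rewrite /sd /al; clear sd; case: r => IH sd0 msd mz m0 mal.
    apply: measurable_fun_ifT => //=.
      by apply: (measurable_fun_bool true); rewrite setTI; exact: m0.
    apply: measurable_funM => //; apply: measurable_funM => //.
    by apply: measurable_funV; exact: measurable_sum.
  pose sd w := step_sd p N (Yw w) RuleB k.
  (* It suffices to treat the events [y <= m]. Unless all deviations vanish, such an event is
     certain for [y <= 0], as rule (b) is nonnegative, and for [0 < y] it is described by
     [le_ruleB]. *)
  apply: measurable_fun_ge => y.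
  rewrite (_ : [set w | _] = ([set w | [forall j, sd w j == 0]] `&`
      [set w | y <= p j * step_draws R I N k]) `|` (~` [set w | [forall j, sd w j == 0]] `&`
      [set w | y <= 0 \/ ((sd w j != 0) && (\sum_i Num.max ((alloc p N (Yw w) RuleB k i).+1%:R)
        (p i * sd w i * (((alloc p N (Yw w) RuleB k j).+1%:R + y) / (p j * sd w j)))
        <= step_draws R I N k + \sum_i (alloc p N (Yw w) RuleB k i).+1%:R))])); last first.
    apply/seteqP; split=> w /=; rewrite -/(sd w).
      case: ifPn => h; first by left.
      move=> hy; right; split; first exact/negP.
      have [y0|y0] := leP y 0; [by left|right].
      have nz := step_sd_nz h; rewrite -le_ruleB//; exact: sd0.
    case=> -[]; first by move=> ->.
    move=> /negP hZ; have nz := step_sd_nz hZ; rewrite (negPf hZ) => -[y0|].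
      by apply: le_trans y0 _; apply: ruleB_ge0 => //; exact: sd0.
    have [y0 _|y0] := leP y 0; last by rewrite -le_ruleB//; exact: sd0.
    by apply: le_trans y0 _; apply: ruleB_ge0 => //; exact: sd0.
  have mn j' : measurable_fun setT (fun w => (alloc p N (Yw w) RuleB k j').+1%:R : R).
    by under eq_fun do rewrite -natr1; exact: measurable_funD.
  have [y0|y0] := leP y 0.
    apply: measurableU; apply: measurableI => //; first by apply: measurable_set_le.
      exact: measurableC.
    rewrite (_ : [set w | _] = setT); first exact: measurableT.
    by apply/seteqP; split=> // w _; left.
  apply: measurableU; apply: measurableI => //; first by apply: measurable_set_le.
    exact: measurableC.
  rewrite (_ : [set w | _] = ~` [set w | sd w j == 0] `&`
      [set w | \sum_i Num.max ((alloc p N (Yw w) RuleB k i).+1%:R)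
        (p i * sd w i * (((alloc p N (Yw w) RuleB k j).+1%:R + y) / (p j * sd w j)))
        <= step_draws R I N k + \sum_i (alloc p N (Yw w) RuleB k i).+1%:R]); last first.
    apply/seteqP; split=> w /=; first by move=> [//|/andP[/negP]].
    by move=> [/negP h1 h2]; right; rewrite h1 h2.
  apply: measurableI; first exact: measurableC (mz j).
  apply: measurable_set_le.
    apply: measurable_sum => i'; apply: measurable_maxr => //.
    apply: measurable_funM => //; apply: measurable_funM; first exact: measurable_funD.
    exact: measurable_funV.
  apply: measurable_funD => //; exact: measurable_sum.
have mfloor (g : T -> R) : measurable_fun setT g ->
    measurable_fun setT (fun w => (Num.floor (g w))%:~R : R).
  move=> mg; apply: (measurableT_comp (f := fun x : R => (Num.floor x)%:~R : R)) => //.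
  by apply: nondecreasing_measurable => // x y xy; rewrite ler_int le_floor.
rewrite (_ : (fun w => _) = (fun w => (al k w i)%:R + 1 +
   `|(Num.floor (\sum_(j < I | (j <= i)%N) step_alloc p N (Yw w) r k j))%:~R -
   (Num.floor (\sum_(j < I | (j < i)%N) step_alloc p N (Yw w) r k j))%:~R|)).
  apply: measurable_funD; first exact: measurable_funD.
  apply: measurableT_comp => //.
  by apply: measurable_funB; apply: mfloor; exact: measurable_sum_cond.
apply/funext => w; rewrite -intrB -intr_norm -natr_absz.
by rewrite [al k.+1 w i]allocS natrD [in RHS]natr1 addn1.
Qed.

Lemma measurable_estimator k :
  measurable_fun setT (fun w => estimator p N (Yw w) r k).
Proof.
apply: measurable_sum => i; apply: measurable_funM.
  by apply: measurable_funM => //; apply: measurable_funV; exact: measurable_alloc.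
apply: (measurable_fun_random_index (F := fun n w => \sum_(j < n) Y i j w)).
  exact: measurable_alloc.
by move=> n; apply: measurable_sum.
Qed.

End measurability.

(** * Random sample sizes *)

Section in_probability.
Context d (Omega : measurableType d) (R : realType) (P : probability Omega R).

Lemma prob_le (A B : set Omega) : measurable A -> measurable B -> A `<=` B ->
  fine (P A) <= fine (P B).
Proof.
move=> mA mB AB; apply: fine_le; rewrite ?fin_num_measure//.
by apply: le_measure; rewrite ?inE.
Qed.

Lemma prob_le_sum (J : finType) (A : set Omega) (B : J -> set Omega) :
  measurable A -> (forall j, measurable (B j)) ->
  (forall w, A w -> exists j, B j w) -> fine (P A) <= \sum_j fine (P (B j)).
Proof.
move=> mA mB AB; rewrite -RintegralT_indic//.
under eq_bigr do rewrite -RintegralT_indic//.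
rewrite -RintegralT_sum; last by move=> j; exact: integrableR_indic.
apply: RintegralT_le; [exact: integrableR_indic| |move=> w].
  by apply: integrableR_sum => j; exact: integrableR_indic.
have s0 : 0 <= \sum_j (\1_(B j) w : R) by apply: sumr_ge0 => j _; rewrite indicE.
rewrite indicE; case: (boolP (w \in A)) => //= wA.
have [j Bj] := AB w (set_mem wA).
by rewrite (bigD1 j)//= indicE mem_set// lerDl sumr_ge0.
Qed.

Lemma measurable_prob_gt (V : Omega -> R) (del : R) :
  measurable_fun setT V -> measurable [set w | del < `|V w|].
Proof. by move=> mV; apply: measurable_set_lt => //; exact: measurableT_comp. Qed.

Lemma cvg_prob0_sum (J : finType) (V : J -> nat -> Omega -> R) :
  (forall j k, measurable_fun setT (V j k)) ->
  (forall j (del : R), 0 < del -> (fun k => fine (P [set w | del < `|V j k w|])) @ \oo --> (0 : R)) ->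
  forall del : R, 0 < del ->
  (fun k => fine (P [set w | del < `|\sum_j V j k w|])) @ \oo --> (0 : R).
Proof.
(* The successor avoids a division by 0 when [J] is empty. *)
move=> mV V0 del del0; pose e := del / #|J|.+1%:R.
have e0 : 0 < e by rewrite divr_gt0.
have h : (fun k => \sum_j fine (P [set w | e < `|V j k w|])) @ \oo --> (0 : R).
  by have := cvg_sumr (fun j => V0 j e e0); rewrite big1.
apply: (@squeeze_cvgr _ _ _ _ (cst 0) _ _ _ 0) h; last exact: cvg_cst.
apply: nearW => k; rewrite fine_ge0//=; apply: prob_le_sum.
- by apply: measurable_prob_gt; exact: measurable_sum.
- by move=> j; exact: measurable_prob_gt.
move=> w /= hw; apply: contrapT => Nw; move: hw; apply/negP; rewrite -leNgt.
have le_e j : `|V j k w| <= e.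
  by rewrite leNgt; apply/negP => h1; apply: Nw; exists j.
apply: le_trans (ler_norm_sum _ _ _) _; apply: le_trans (ler_sum _ (fun j _ => le_e j)) _.
rewrite sumr_const -mulr_natr /e mulrAC ler_pdivrMr// ler_wpM2l ?(ltW del0)//.
by rewrite ler_nat.
Qed.

Lemma ae_cvg_in_prob (V : nat -> Omega -> R) (l : R) :
  (forall k, measurable_fun setT (V k)) ->
  {ae P, forall w, V ^~ w @ \oo --> l} ->
  forall del : R, 0 < del -> (fun k => fine (P [set w | del < `|V k w - l|])) @ \oo --> (0 : R).
Proof.
move=> mV [Z [mZ Z0 hZ]] del del0.
(* Off the null set [Z] the indicators tend to 0 at every point, so dominated convergence applies
   without exception sets. *)
pose B k := [set w | del < `|V k w - l|] `\` Z.
have mB0 k : measurable [set w | del < `|V k w - l|].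
  by apply: measurable_prob_gt; exact: measurable_funB.
have mB k : measurable (B k) by exact: measurableD.
have E k : fine (P [set w | del < `|V k w - l|]) = \int[P]_w (\1_(B k) w : R).
  rewrite RintegralT_indic// /B; congr fine.
  apply: le_anti; apply/andP; split; last first.
    by apply: le_measure; rewrite ?inE//; exact: mB.
  rewrite -[leRHS]adde0 -Z0; apply: le_trans (measureU2 _ (mB k) mZ).
  apply: le_measure; rewrite ?inE//; first exact: measurableU.
  by move=> w hw; have [wZ|wZ] := pselect (Z w); [right|left].
under eq_fun do rewrite E.
have [] := @Rintegral_dominated_cvg _ _ _ P (fun k => \1_(B k)) (fun=> 0) (fun=> 1).
- by move=> k; exact: measurable_indic.
- move=> w; have hw : \forall k \near \oo, 0 = \1_(B k) w :> R.
    have [wZ|wZ] := pselect (Z w).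
      by apply: nearW => k; rewrite indicE memNset// => -[].
    have /cvgrPdist_le/(_ _ del0) : V ^~ w @ \oo --> l by apply: contrapT => h; apply/wZ/hZ.
    by apply: filterS => k h; rewrite indicE memNset// => -[]; rewrite /= distrC ltNge h.
  by apply/cvgrPdist_le => e e0; apply: filterS hw => k <-; rewrite subrr normr0 ltW.
- exact: integrableR_cst.
- by move=> k w; rewrite indicE ger0_norm// lern1 leq_b1.
by move=> _; rewrite RintegralT_cst.
Qed.

End in_probability.

(** * Replacing random sample sizes by deterministic ones *)

Section anscombe.
Context d (Omega : measurableType d) (R : realType) (P : probability Omega R).
Variables (xi : nat -> Omega -> R) (v : R).
Hypothesis xi2 : forall j, sq_integrable P (xi j).
Hypothesis xi_mean : forall j, \int[P]_w xi j w = 0.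
Hypothesis xi_var : forall j, \int[P]_w (xi j w ^+ 2) = v.
Hypothesis ixi : mutually_independent P xi.

Let S (n : nat) w := \sum_(j < n) xi j w.

Let mS n : measurable_fun setT (S n).
Proof. by apply: measurable_sum => j; have [] := xi2 j. Qed.

Lemma kolmogorov_window (l len : nat) (a : R) (A : set Omega) : measurable A -> 0 < a ->
  (forall w, A w -> exists m, [/\ (l <= m)%N, (m <= l + len)%N & a <= `|S m w - S l w|]) ->
  fine (P A) <= len%:R * v / a ^+ 2.
Proof.
move=> mA a0 hA; pose zeta j := xi (l + j).
have izeta : mutually_independent P zeta.
  by apply: (mutually_independent_reindex (phi := fun j => (l + j)%N)) => // x y /addnI.
have z2 j : sq_integrable P (zeta j) by exact: xi2.
have z0 j : \int[P]_w zeta j w = 0 by exact: xi_mean.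
have := kolmogorov_inequality a0 z2 z0 izeta (n := len) mA.
under eq_bigr do rewrite xi_var.
rewrite sumr_const card_ord mulr_natl; apply => w /hA[m [lm mlen h]].
exists (m - l)%N; first by rewrite leq_subLR.
have E t : S (l + t) w = S l w + \sum_(j < t) zeta j w by rewrite /S big_split_ord.
by move: h; rewrite -{1}(subnKC lm) E [_ + _ - _]addrC addKr.
Qed.

(** To be read with [x = n / N], [s = sqrt N], [b = 1 / sqrt M], and with [tn], [t0], [tl] the
    partial sums at the random size, at the deterministic size and at the left end of the window.
    The difference splits into [q / (s x) * (tn - t0)], small by the oscillation in the window, and
    [(q / (s x) - b) * t0], small because the coefficient is. *)
Lemma window_split (q eta del s x tn t0 tl b : R) :
  0 < q -> 0 < eta -> eta <= q / 2 -> 0 < del -> 0 < s ->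
  `|x - q| <= eta -> `|1 - s * b| <= eta ->
  `|tn - tl| < del * s / 8 -> `|t0 - tl| < del * s / 8 ->
  `|t0| < del * s / (2 * ((2 / q + 1) * eta)) ->
  `|q / (s * x) * tn - b * t0| <= del.
Proof.
move=> q0 eta0 etaq del0 s0 xq sb tn_tl t0_tl t0_lt.
have x0 : q / 2 <= x by move: xq; rewrite ler_distl => /andP[]; lra.
have x_gt0 : 0 < x by rewrite (lt_le_trans _ x0)// divr_gt0.
have kappa0 : 0 < (2 / q + 1) * eta by rewrite mulr_gt0// addr_gt0// divr_gt0.
have -> : q / (s * x) * tn - b * t0 = q / (s * x) * (tn - t0) + (q / (s * x) - b) * t0 by ring.
have h1 : `|q / (s * x)| <= 2 / s.
  rewrite gtr0_norm ?divr_gt0 ?mulr_gt0// invfM mulrCA mulrC.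
  by rewrite ler_pM2r ?invr_gt0// ler_pdivrMr//; lra.
have h2 : `|tn - t0| <= del * s / 4.
  have -> : tn - t0 = (tn - tl) - (t0 - tl) by ring.
  by apply: le_trans (ler_normB _ _) _; lra.
have h3 : `|q / (s * x) - b| <= (2 / q + 1) * eta / s.
  have -> : q / (s * x) - b = ((q - x) / x + (1 - s * b)) / s.
    by field; rewrite !gt_eqF.
  rewrite normrM [`|s^-1|]ger0_norm ?invr_ge0 ?(ltW s0)// ler_pM2r ?invr_gt0//.
  apply: le_trans (ler_normD _ _) _.
  rewrite [leRHS]mulrDl [1 * eta]mul1r; apply: lerD => //; rewrite normrM distrC.
  rewrite normfV [`|x|]gtr0_norm// ler_pdivrMr// (le_trans xq)//.
  have h : 1 <= x / (q / 2) by rewrite ler_pdivlMr ?divr_gt0// mul1r.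
  have -> : 2 / q * eta * x = eta * (x / (q / 2)) by field; rewrite gt_eqF.
  by rewrite ler_peMr// ltW.
have h4 : `|q / (s * x) * (tn - t0)| <= del / 2.
  rewrite normrM; apply: (@le_trans _ _ (2 / s * (del * s / 4))); first exact: ler_pM.
  by rewrite [leLHS](_ : _ = del / 2)//; field; rewrite gt_eqF.
have h5 : `|(q / (s * x) - b) * t0| <= del / 2.
  rewrite normrM; apply: (@le_trans _ _ ((2 / q + 1) * eta / s *
    (del * s / (2 * ((2 / q + 1) * eta))))); first by apply: ler_pM => //; exact: ltW.
  move: kappa0; set K := (2 / q + 1) * eta => K0.
  by rewrite [leLHS](_ : _ = del / 2)//; field; rewrite !gt_eqF.
by apply: le_trans (ler_normD _ _) _; lra.
Qed.

Variables (n : nat -> Omega -> nat) (N M n0 : nat -> nat) (q : R).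
Hypothesis q0 : 0 < q.
Hypothesis mn : forall k, measurable_fun setT (fun w => (n k w)%:R : R).
Hypothesis N_gt0 : \forall k \near \oo, (0 < N k)%N.
Hypothesis N_oo : (fun k => (N k)%:R^-1 : R) @ \oo --> (0 : R).
Hypothesis nN : forall eta : R, 0 < eta ->
  (fun k => fine (P [set w | eta < `|(n k w)%:R / (N k)%:R - q|])) @ \oo --> (0 : R).
Hypothesis n0N : (fun k => (n0 k)%:R / (N k)%:R : R) @ \oo --> q.
Hypothesis NM : (fun k => Num.sqrt (N k)%:R * (Num.sqrt (M k)%:R)^-1 : R) @ \oo --> (1 : R).

Let V k w := q * Num.sqrt (N k)%:R / (n k w)%:R * S (n k w) w - (Num.sqrt (M k)%:R)^-1 * S (n0 k) w.

Lemma measurable_random_sum k : measurable_fun setT (fun w => S (n k w) w).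
Proof. by apply: (measurable_fun_random_index (F := S)). Qed.

Lemma measurable_anscombe k : measurable_fun setT (V k).
Proof.
apply: measurable_funB; last by apply: measurable_funM.
apply: measurable_funM; last exact: measurable_random_sum.
by apply: measurable_funM => //; exact: measurable_funV.
Qed.

(** Three exceptional events: the random size leaves the window, the partial sums oscillate too much
    inside it, or the deterministic sum is too large. The maximal inequality bounds the last two
    whatever the dependence between size and samples, by a constant times [eta]. *)
Lemma anscombe del : 0 < del -> (fun k => fine (P [set w | del < `|V k w|])) @ \oo --> (0 : R).
Proof.
move=> del0.
have v0 : 0 <= v by rewrite -(xi_var 0); apply: Rintegral_ge0 => w _; exact: sqr_ge0.
pose kappa := 2 / q + 1.
have kappa0 : 0 < kappa by rewrite addr_gt0// divr_gt0.
(* 192 is 3 * 64, from a window of length at most [3 * eta * N] and the threshold [del * s / 8]. The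
   8 is 2 * 4, from [n0 <= 2 * q * N] and the threshold [u]; this gives [eta ^+ 2], bounded by
   [eta]. *)
pose C := 192 * v / del ^+ 2 + 8 * q * v * kappa ^+ 2 / del ^+ 2 + 1.
apply/cvgrPdist_le => e e0.
pose eta := Num.min (Num.min 1 (q / 2)) (e / 2 / C).
have C0 : 0 < C.
  have d2 : 0 <= (del ^+ 2)^-1 by rewrite invr_ge0 sqr_ge0.
  have h1 : 0 <= 192 * v by exact: mulr_ge0.
  have h2 : 0 <= 8 * q * v by apply: mulr_ge0 => //; apply: mulr_ge0 => //; exact: ltW.
  have h3 : 0 <= 8 * q * v * kappa ^+ 2 by apply: mulr_ge0 => //; exact: sqr_ge0.
  by apply: ltr_wpDl => //; apply: addr_ge0; apply: mulr_ge0.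
have eta0 : 0 < eta by rewrite !lt_min ltr01 !divr_gt0.
have eta1 : eta <= 1 by rewrite !ge_min lexx.
have etaq : eta <= q / 2 by rewrite !ge_min lexx orbT.
have etaC : eta * C <= e / 2 by rewrite -ler_pdivlMr// !ge_min lexx !orbT.
have e2 : 0 < e / 2 by rewrite divr_gt0.
have H1 := nN eta0; move/cvgrPdist_le : H1 => /(_ _ e2) H1.
have H2 := n0N; move/cvgrPdist_le : H2 => /(_ _ eta0) H2.
have H3 := NM; move/cvgrPdist_le : H3 => /(_ _ eta0) H3.
have H4 := N_oo; move/cvgrPdist_le : H4 => /(_ _ eta0) H4.
have H5 := N_gt0.
near=> k.
have K1 : `|0 - fine (P [set w | eta < `|(n k w)%:R / (N k)%:R - q|])| <= e / 2 by near: k.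
have K2 : `|q - (n0 k)%:R / (N k)%:R| <= eta by near: k.
have K3 : `|1 - Num.sqrt (N k)%:R * (Num.sqrt (M k)%:R)^-1| <= eta by near: k.
have K4 : `|0 - (N k)%:R^-1| <= eta by near: k.
have K5 : (0 < N k)%N by near: k.
have Nr0 : 0 < (N k)%:R :> R by rewrite ltr0n K5.
pose s : R := Num.sqrt (N k)%:R; have s0 : 0 < s by rewrite sqrtr_gt0.
have s2 : s ^+ 2 = (N k)%:R by rewrite sqr_sqrtr// ltW.
rewrite sub0r normrN ger0_norm ?fine_ge0//.
(* The window contains every integer within [eta * N] of [q * N], hence both sizes. For large [k]
   one has [1 <= eta * N], which absorbs the rounding into [len <= 3 * eta * N]. *)
pose l := Num.truncn ((q - eta) * (N k)%:R).
pose len := (Num.truncn (2 * eta * (N k)%:R)).+1.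
pose a := del * s / 8; have a0 : 0 < a by rewrite divr_gt0// mulr_gt0.
pose Kset := \bigcup_(m in [set m | (l <= m)%N /\ (m <= l + len)%N]) [set w | a <= `|S m w - S l w|].
pose u := del * s / (2 * (kappa * eta)).
have u0 : 0 < u by rewrite divr_gt0 ?mulr_gt0.
pose Uset := [set w | u <= `|S (n0 k) w|].
have mK : measurable Kset.
  apply: bigcup_measurable => m _; apply: measurable_set_le => //.
  by apply: measurableT_comp => //; exact: measurable_funB.
have mU : measurable Uset by apply: measurable_set_le => //; exact: measurableT_comp.
have mG : measurable [set w | eta < `|(n k w)%:R / (N k)%:R - q|].
  by apply: measurable_prob_gt; apply: measurable_funB => //; exact: measurable_funM.
have qe : 0 <= (q - eta) * (N k)%:R by rewrite mulr_ge0// ?subr_ge0 ?(ltW Nr0)//; lra.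
have lP := truncn_itv qe; rewrite -/l in lP.
have l2P : 2 * eta * (N k)%:R < len%:R by exact: truncnS_gt.
have len_le : len%:R <= 3 * eta * (N k)%:R.
  rewrite /len -natr1; have := truncn_le (2 * eta * (N k)%:R).
  have -> : 0 <= 2 * eta * (N k)%:R by apply: mulr_ge0; [exact: mulr_ge0 (ltW eta0)|exact: ltW].
  move=> h.
  move: K4; rewrite sub0r normrN ger0_norm ?invr_ge0 ?(ltW Nr0)// => {}K4.
  have : 1 <= eta * (N k)%:R by rewrite -ler_pdivrMr// mul1r.
  by lra.
have inwin m : `|m%:R / (N k)%:R - q| <= eta -> (l <= m)%N /\ (m <= l + len)%N.
  rewrite ler_distl => /andP[]; rewrite ler_pdivlMr// ler_pdivrMr// => h1 h2.
  case/andP: lP => l1 l2; split.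
    by rewrite -(ler_nat R) (le_trans l1).
  rewrite -ltnS -(ltr_nat R) -natr1 natrD.
  move: l2; rewrite -natr1; lra.
have K_le : fine (P Kset) <= len%:R * v / a ^+ 2.
  by apply: (kolmogorov_window (l := l)) => // w [m [h1 h2] h3]; exists m.
have U_le : fine (P Uset) <= (n0 k)%:R * v / u ^+ 2.
  apply: (kolmogorov_window (l := 0)) => // w hw; exists (n0 k); split=> //.
  by rewrite /S big_ord0 subr0.
have sub : [set w | del < `|V k w|] `<=` [set w | eta < `|(n k w)%:R / (N k)%:R - q|] `|` (Kset `|` Uset).
  move=> w /= Vw; apply: contrapT => /not_orP[/negP]; rewrite -leNgt => Gw /not_orP[NK NU].
  move: Vw; apply/negP; rewrite -leNgt.
  have notK m : (l <= m)%N /\ (m <= l + len)%N -> `|S m w - S l w| < a.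
    by move=> hm; rewrite ltNge; apply/negP => h; apply: NK; exists m.
  rewrite /V; have -> : q * Num.sqrt (N k)%:R / (n k w)%:R = q / (s * ((n k w)%:R / (N k)%:R)).
    rewrite -/s !invfM invrK -s2 expr2; set y := (n k w)%:R^-1.
    by field; rewrite gt_eqF.
  apply: (@window_split q eta del s _ _ _ (S l w)) => //.
  - exact/notK/inwin.
  - by apply/notK/inwin; rewrite distrC.
  - by rewrite ltNge; apply/negP.
have mKU : measurable (Kset `|` Uset) by exact: measurableU.
apply: le_trans (prob_le P _ _ sub) _; first by apply: measurable_prob_gt; exact: measurable_anscombe.
  exact: measurableU.
apply: le_trans (probU_le _ mG mKU) _.
have := probU_le P mK mU.
move: K1; rewrite sub0r normrN ger0_norm ?fine_ge0// => {}K1 H6.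
have K_le' : fine (P Kset) <= 192 * v / del ^+ 2 * eta.
  apply: le_trans K_le _; rewrite ler_pdivrMr ?exprn_gt0//.
  have -> : 192 * v / del ^+ 2 * eta * a ^+ 2 = 3 * eta * (N k)%:R * v.
    by rewrite /a !exprMn s2; field; rewrite gt_eqF.
  by rewrite ler_wpM2r.
have U_le' : fine (P Uset) <= 8 * q * v * kappa ^+ 2 / del ^+ 2 * eta.
  apply: le_trans U_le _; rewrite ler_pdivrMr ?exprn_gt0//.
  have n0_le : (n0 k)%:R <= 2 * q * (N k)%:R.
    by rewrite -ler_pdivrMr//; move: K2; rewrite distrC ler_distl => /andP[_]; lra.
  have -> : 8 * q * v * kappa ^+ 2 / del ^+ 2 * eta * u ^+ 2 = 2 * q * (N k)%:R * v / eta.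
    by rewrite /u exprMn exprMn s2 exprVn; field; rewrite !gt_eqF.
  apply: (@le_trans _ _ (2 * q * (N k)%:R * v)); first by rewrite ler_wpM2r.
  rewrite ler_peMr ?invf_ge1//.
  by rewrite !mulr_ge0// ltW.
move: etaC; rewrite /C; lra.
Unshelve. all: by end_near.
Qed.

End anscombe.

(** * Central limit theorem for the adaptive estimator *)

Section moments.
Context d (Omega : measurableType d) (R : realType) (P : probability Omega R).

Lemma second_moment_sum (T : choiceType) (xi : T -> Omega -> R) (s : seq T) :
  (forall t, sq_integrable P (xi t)) -> (forall t, \int[P]_w xi t w = 0) ->
  mutually_independent P xi -> uniq s ->
  \int[P]_w ((\sum_(t <- s) xi t w) ^+ 2) = \sum_(t <- s) \int[P]_w (xi t w ^+ 2).
Proof.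
move=> xi2 xi0 ixi; elim: s => [_|t s IH /= /andP[ts us]].
  rewrite big_nil -[RHS](RintegralT_cst P); apply: eq_Rintegral => w _.
  by rewrite big_nil expr0n.
have mxi u : measurable_fun setT (xi u) by case: (xi2 u).
have S2 : sq_integrable P (fun w => \sum_(u <- s) xi u w) by exact: sq_integrable_sum.
have ind : indep2 P (xi t) (fun w => \sum_(u <- s) xi u w).
  apply: (block_indep2 mxi ixi (J1 := [:: t]) (J2 := s)).
  - by rewrite /= ts.
  - by apply: xi_block_measurable; rewrite mem_head.
  - exact: block_sum_measurable.
have [iTS ITS] := indep2_integralM ind (sq_integrable_integrable (xi2 t)) (sq_integrable_integrable S2).
rewrite big_cons -(IH us).
under eq_Rintegral do rewrite big_cons sqrrD -mulr_natl.
rewrite RintegralT_D; [|apply: integrableRD|by case: S2]; last 2 first.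
- by case: (xi2 t).
- exact: integrableRZ.
rewrite RintegralT_D; [|by case: (xi2 t)|exact: integrableRZ].
by rewrite RintegralT_Z// ITS xi0 mul0r mulr0 addr0.
Qed.

(** Lindeberg's condition for a single variable: dominated convergence along [a = 1 / (m + 1)], then
    monotonicity in [a]. *)
Lemma truncated_moment_small (X : Omega -> R) (e : R) : sq_integrable P X -> 0 < e ->
  exists2 a0, 0 < a0 & forall a, 0 < a -> a <= a0 ->
    \int[P]_w (X w ^+ 2 * Num.min 1 (a * `|X w|)) <= e.
Proof.
move=> [mX iX2] e0.
pose F (a : R) w := X w ^+ 2 * Num.min 1 (a * `|X w|).
have mF a : measurable_fun setT (F a).
  apply: measurable_funM; first exact: measurable_funX.
  apply: measurable_minr => //; apply: measurable_funM => //.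
  exact: measurableT_comp.
have min_ge0 (a : R) w : 0 < a -> 0 <= Num.min 1 (a * `|X w|) by move=> a0; rewrite le_min ler01 mulr_ge0// ltW.
have F_le (a : R) w : 0 < a -> `|F a w| <= X w ^+ 2.
  move=> a0; rewrite ger0_norm ?(mulr_ge0 (sqr_ge0 _) (min_ge0 _ _ a0))//.
  by rewrite ler_piMr ?sqr_ge0// ge_min lexx.
have iF (a : R) : 0 < a -> integrableR P (F a).
  by move=> a0; apply: integrableR_le iX2 => // w; exact: F_le.
have [] := @Rintegral_dominated_cvg _ _ _ P (fun n => F n.+1%:R^-1) (fun=> 0) (fun w => X w ^+ 2).
- by [].
- move=> w; rewrite -(mulr0 (X w ^+ 2)); apply: cvgM; first exact: cvg_cst.
  have h0 : (fun n : nat => n.+1%:R^-1 * `|X w|) @ \oo --> (0 : R).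
    by rewrite -(mul0r `|X w|); apply: cvgM; [exact: cvg_harmonic|exact: cvg_cst].
  apply: (@squeeze_cvgr _ _ _ _ (cst 0) _ _ _ 0) h0; last exact: cvg_cst.
  by apply: nearW => n; rewrite min_ge0// ge_min lexx orbT.
- exact: iX2.
- by move=> n w; exact: F_le.
move=> _; rewrite RintegralT_cst => /cvgrPdist_le/(_ _ e0) [m _ hm].
exists m.+1%:R^-1; first by [].
move=> a a0 am; have := hm m (leqnn m); rewrite /= sub0r normrN => /(le_trans (ler_norm _)).
apply: le_trans; apply: RintegralT_le; [exact: iF|exact: iF|move=> w].
rewrite ler_wpM2l ?sqr_ge0// le_min !ge_min lexx/=; apply/orP; right.
by rewrite ler_wpM2r.
Qed.

(** The strong law for the variables and for their squares, combined by continuity of the square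
    root; the limit is the variance in its expanded form. *)
Lemma emp_sd_cvg (I : nat) (Y : 'I_I -> nat -> Omega -> R) (i : 'I_I) :
  (forall j, sq_integrable P (Y i j)) ->
  (forall j B, measurable B -> P (Y i j @^-1` B) = P (Y i 0%N @^-1` B)) ->
  mutually_independent P (Y i) ->
  {ae P, forall w, (fun n => emp_sd (fun i j => Y i j w) n i) @ \oo -->
    Num.sqrt (\int[P]_w ((Y i 0%N w - \int[P]_w Y i 0%N w) ^+ 2))}.
Proof.
move=> Y2 lY iY; have mY j : measurable_fun setT (Y i j) by case: (Y2 j).
set mu := \int[P]_w Y i 0%N w.
have iY1 : integrableR P (Y i 0%N) by exact: sq_integrable_integrable.
have h1 := strong_law_of_large_numbers mY iY lY iY1.
have msq : measurable_fun setT (fun x : R => x ^+ 2) by exact: exprn_measurable.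
have mY2 j : measurable_fun setT (fun w => Y i j w ^+ 2) by exact: measurable_funX.
have iYsq : mutually_independent P (fun j w => Y i j w ^+ 2).
  by have := mutually_independent_comp (fun _ : nat => msq) iY.
have lYsq j B : measurable B ->
    P ((fun w => Y i j w ^+ 2) @^-1` B) = P ((fun w => Y i 0%N w ^+ 2) @^-1` B).
  move=> mB; apply: (lY j ((fun x => x ^+ 2) @^-1` B)).
  by rewrite -[X in measurable X]setTI; exact: msq.
have iY2 : integrableR P (fun w => Y i 0%N w ^+ 2) by case: (Y2 0%N).
have h2 := strong_law_of_large_numbers mY2 iYsq lYsq iY2.
have -> : \int[P]_w ((Y i 0%N w - mu) ^+ 2) = \int[P]_w (Y i 0%N w ^+ 2) - mu ^+ 2.
  have i1 := integrableRZ (2 * mu) iY1.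
  rewrite (@eq_Rintegral _ _ _ _ _ (fun w => Y i 0%N w ^+ 2 - 2 * mu * Y i 0%N w + mu ^+ 2)); last first.
    by move=> w _; ring.
  rewrite RintegralT_D; [|exact: integrableRB|exact: integrableR_cst].
  rewrite RintegralT_B// RintegralT_Z// RintegralT_cst -/mu; ring.
apply: filterS2 h1 h2 => w h1 h2.
apply: cvg_comp; last exact: sqrt_continuous.
apply: cvgB; first exact: h2.
by rewrite /GRing.exp/=; apply: cvgM; exact: h1.
Qed.

End moments.

Section core.
Context d (Omega : measurableType d) (R : realType) (P : probability Omega R).
Variables (I : nat) (p : 'I_I -> R) (N : nat -> nat) (Y : 'I_I -> nat -> Omega -> R) (r : alloc_rule).
Hypotheses (p0 : forall i, 0 < p i) (p1 : \sum_i p i = 1).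
Hypotheses (N0 : N 0%N = 0%N) (NS : forall k, (N k + I <= N k.+1)%N).
Hypothesis kN : (fun k => k%:R / (N k)%:R : R) @ \oo --> (0 : R).
Hypothesis Y2 : forall i j, sq_integrable P (Y i j).
Hypothesis lY : forall i j B, measurable B -> P (Y i j @^-1` B) = P (Y i 0%N @^-1` B).
Hypothesis iY : mutually_independent P (fun t : 'I_I * nat => Y t.1 t.2).

Let mu i := \int[P]_w Y i 0%N w.
Let sig i := Num.sqrt (\int[P]_w ((Y i 0%N w - mu i) ^+ 2)).
Hypothesis sig_pos : exists i, 0 < sig i.

Let sigma := \sum_i p i * sig i.
Let q i := p i * sig i / sigma.
Let n k i w := alloc p N (fun i j => Y i j w) r k i.
Let D i j w := Y i j w - mu i.

Let mY i j : measurable_fun setT (Y i j). Proof. by case: (Y2 i j). Qed.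

Let sig0 i : 0 <= sig i. Proof. exact: sqrtr_ge0. Qed.

Let sigma0 : 0 < sigma.
Proof. exact: s_sum_gt0. Qed.

Let I0 : (0 < I)%N.
Proof. by case: sig_pos => i _; apply: leq_ltn_trans (ltn_ord i). Qed.

Let N_gt0' k : (0 < k)%N -> (0 < N k)%N.
Proof. by move=> k0; exact: (N_gt0 NS). Qed.

Let iYi i : mutually_independent P (Y i).
Proof.
by apply: (@mutually_independent_reindex _ _ _ _ _ _ _ _ _ (fun j : nat => (i, j)) _ iY) => j j' [].
Qed.

Let msub i : measurable_fun setT (fun x : R => x - mu i).
Proof. exact: measurable_funB. Qed.

Let iD i : mutually_independent P (D i).
Proof. by have := mutually_independent_comp (fun _ : nat => msub i) (@iYi i). Qed.

Let D2 i j : sq_integrable P (D i j).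
Proof.
have := sq_integrableD (Y2 i j) (sq_integrable_cst P (- mu i)).
by [].
Qed.

Let D_law i (h : R -> R) j : measurable_fun setT h -> integrableR P (fun w => h (D i 0%N w)) ->
  \int[P]_w h (D i j w) = \int[P]_w h (D i 0%N w).
Proof.
move=> mh ih; have mh' : measurable_fun setT (fun x : R => h (x - mu i)) by exact: measurableT_comp.
have [] // := same_law_integral (mY i 0%N) (mY i j) _ mh' ih.
by move=> B mB; exact/esym/lY.
Qed.

Let D_mean i j : \int[P]_w D i j w = 0.
Proof.
rewrite (@D_law i id) //; last exact: sq_integrable_integrable (D2 i 0).
rewrite RintegralT_B; [|exact: sq_integrable_integrable|exact: integrableR_cst].
by rewrite RintegralT_cst subrr.
Qed.

Let D_var i j : \int[P]_w (D i j w ^+ 2) = sig i ^+ 2.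
Proof.
have msq : measurable_fun setT (fun x : R => x ^+ 2) by exact: exprn_measurable.
rewrite (D_law j msq); last by case: (D2 i 0).
by rewrite /sig sqr_sqrtr//; apply: Rintegral_ge0 => w _; exact: sqr_ge0.
Qed.

Lemma alloc_ratio_cvg_ae :
  {ae P, forall w, forall i, (fun k => (n k i w)%:R / (N k)%:R : R) @ \oo --> q i}.
Proof.
have : {ae P, forall w, forall i, (fun n => emp_sd (fun i j => Y i j w) n i) @ \oo --> sig i}.
  apply: filter_forall => i; exact: (emp_sd_cvg (Y2 i) (lY i) (@iYi i)).
apply: filterS => w hw i.
exact: (alloc_ratio_cvg r p0 p1 N0 NS kN sig0 sig_pos hw).
Qed.


Let n_measurable k i : measurable_fun setT (fun w => (n k i w)%:R : R).
Proof. exact: measurable_alloc. Qed.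

Lemma alloc_ratio_in_prob i (eta : R) : 0 < eta ->
  (fun k => fine (P [set w | eta < `|(n k i w)%:R / (N k)%:R - q i|])) @ \oo --> (0 : R).
Proof.
apply: ae_cvg_in_prob; first by move=> k; exact: measurable_funM.
by apply: filterS alloc_ratio_cvg_ae => w h; exact: h.
Qed.

(* [W k] is a sum over deterministic sample sizes close to [q i * N k], in which the
   strata of positive standard deviation are rescaled to the common variance
   [sigma ^+ 2]. *)
Let J := {i : 'I_I | sig i != 0}.
Let T : choiceType := (J * nat)%type.
Let xi (t : T) w := sigma / sig (val t.1) * D (val t.1) t.2 w.
(** The successor keeps the total size [M k] positive for every [k], and is negligible against
    [N k]. *)
Let n0 i k := (Num.truncn (q i * (N k)%:R)).+1.
Let s k : seq T := [seq (i, j) | i <- enum {: J}, j <- iota 0 (n0 (val i) k)].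
Let M k := size (s k).
Let W k w := (Num.sqrt (M k)%:R)^-1 * \sum_(t <- s k) xi t w.

Let J_inh : exists i : J, true.
Proof. case: sig_pos => i hi; have h : sig i != 0 by rewrite gt_eqF.
by exists (Sub i h). Qed.

Let sum_J (F : 'I_I -> R) : (forall i, sig i = 0 -> F i = 0) ->
  \sum_(i : J) F (val i) = \sum_i F i.
Proof.
move=> F0; rewrite [RHS](bigID (fun i => sig i != 0))/= [X in _ + X]big1 ?addr0; last first.
  by move=> i /negPn /eqP; exact: F0.
by symmetry; exact: (@big_sub R 0 _ _ [pred i | sig i != 0] F).
Qed.

Let q_sum : \sum_(i : J) q (val i) = 1.
Proof.
rewrite sum_J; last by move=> i h; rewrite /q h mulr0 mul0r.
by rewrite -mulr_suml divff// gt_eqF.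
Qed.

Let q0 (i : J) : 0 < q (val i).
Proof.
case: i => i h; have s0 : 0 < sig i by rewrite lt_neqAle eq_sym h sig0.
exact: divr_gt0 (mulr_gt0 (p0 i) s0) sigma0.
Qed.

Let M_sum k : M k = (\sum_(i : J) n0 (val i) k)%N.
Proof.
rewrite /M size_allpairs_dep sumnE big_map big_enum/=.
by apply: eq_bigr => i _; rewrite size_iota.
Qed.

Let s_uniq k : uniq (s k).
Proof.
apply: allpairs_uniq_dep; [exact: enum_uniq|by move=> i _; exact: iota_uniq|].
by move=> [i j] [i' j'] _ _ /= [-> ->].
Qed.

Let M_gt0 k : (0 < M k)%N.
Proof. by case: J_inh => i _; rewrite M_sum (bigD1 i)//= addSn. Qed.

Let W_sum k w : W k w = \sum_(i : J) sigma / sig (val i) *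
  ((Num.sqrt (M k)%:R)^-1 * \sum_(j < n0 (val i) k) D (val i) j w).
Proof.
rewrite /W big_allpairs_dep/= big_enum/= mulr_sumr; apply: eq_bigr => i _.
rewrite /xi/= -mulr_sumr mulrCA; congr (_ * (_ * _)).
by rewrite -(big_mkord xpredT (fun j => D (val i) j w)) /index_iota subn0.
Qed.

Let N_oo : (fun k => (N k)%:R^-1 : R) @ \oo --> (0 : R).
Proof.
apply: (@squeeze_cvgr _ _ _ _ (cst 0) _ _ _ 0 _ kN); last exact: cvg_cst.
exists 1%N => // k /= k1; rewrite invr_ge0 ler0n/= ler_peMl ?invr_ge0//.
by rewrite ler1n.
Qed.

Let N_near : \forall k \near \oo, (0 < N k)%N.
Proof. by exists 1%N => // k /=; exact: N_gt0'. Qed.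

Let n0_cvg (i : J) : (fun k => (n0 (val i) k)%:R / (N k)%:R : R) @ \oo --> q (val i).
Proof.
have h : (fun k => q (val i) + (N k)%:R^-1) @ \oo --> q (val i).
  by rewrite -[X in _ --> X]addr0; apply: cvgD => //; exact: cvg_cst.
apply: (@squeeze_cvgr _ _ _ _ (cst (q (val i))) _ _ _ (q (val i)) _ h); last exact: cvg_cst.
apply: filterS N_near => k Nk; have Nr : 0 < (N k)%:R :> R by rewrite ltr0n.
have qN : 0 <= q (val i) * (N k)%:R by apply: mulr_ge0 => //; exact: ltW (q0 i).
have /andP[h1 h2] := truncn_itv qN.
rewrite /= ler_pdivlMr// (ltW h2)/= ler_pdivrMr// mulrDl mulVf ?gt_eqF//.
by rewrite -natr1 lerD2r.
Qed.

Let M_cvg : (fun k => (M k)%:R / (N k)%:R : R) @ \oo --> (1 : R).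
Proof.
have := cvg_sumr n0_cvg; rewrite q_sum; apply: cvg_trans.
by apply: near_eq_cvg; apply: nearW => k; rewrite M_sum natr_sum mulr_suml.
Qed.

Let NM_cvg : (fun k => Num.sqrt (N k)%:R * (Num.sqrt (M k)%:R)^-1 : R) @ \oo --> (1 : R).
Proof.
have h : (fun k => (Num.sqrt ((M k)%:R / (N k)%:R))^-1 : R) @ \oo --> (1 : R).
  rewrite -[X in _ --> X]invr1; apply: cvgV; first by rewrite oner_eq0.
  rewrite -[X in _ --> X]sqrtr1; apply: cvg_comp M_cvg _; exact: sqrt_continuous.
apply: cvg_trans h; apply: near_eq_cvg; apply: nearW => k.
by rewrite sqrtrM// sqrtrV// invfM invrK mulrC.
Qed.

Let M_oo : (fun k => (M k)%:R^-1 : R) @ \oo --> (0 : R).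
Proof.
have h : (fun k => (N k)%:R^-1 * ((M k)%:R / (N k)%:R)^-1 : R) @ \oo --> (0 : R).
  rewrite -(mul0r (1^-1 : R)); apply: cvgM => //; apply: cvgV => //; exact: oner_neq0.
apply: cvg_trans h; apply: near_eq_cvg; apply: filterS N_near => k Nk.
by rewrite invfM invrK mulrCA mulVf ?mulr1// pnatr_eq0 -lt0n.
Qed.


Let xi2 t : sq_integrable P (xi t).
Proof. exact: sq_integrableZ. Qed.

Let xi_mean t : \int[P]_w xi t w = 0.
Proof. by rewrite RintegralT_Z ?D_mean ?mulr0//; exact: sq_integrable_integrable. Qed.

Let xi_var t : \int[P]_w (xi t w ^+ 2) = sigma ^+ 2.
Proof.
under eq_Rintegral do rewrite exprMn.
rewrite RintegralT_Z; last by case: (D2 (val t.1) t.2).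
rewrite D_var -exprMn divfK//; exact: (valP t.1).
Qed.

Let ixi : mutually_independent P xi.
Proof.
pose phi (t : T) : 'I_I * nat := (val t.1, t.2).
have phi_inj : injective phi by move=> [i j] [i' j'] [/val_inj -> ->].
have mh (t : T) : measurable_fun setT (fun x : R => sigma / sig (val t.1) * (x - mu (val t.1))).
  by apply: measurable_funM => //; exact: msub.
exact: (mutually_independent_comp mh (mutually_independent_reindex phi_inj iY)).
Qed.

(** Uniformity in the index comes from two facts: inside a stratum all variables have the same law,
    and there are finitely many strata. *)
Let xi_tail e : 0 < e -> exists2 a0, 0 < a0 & forall a t, 0 < a -> a <= a0 ->
  \int[P]_w (xi t w ^+ 2 * Num.min 1 (a * `|xi t w|)) <= e.
Proof.
move=> e0.
have [m _ hm] : \forall m \near \oo, forall i : J, forall a, 0 < a -> a <= m.+1%:R^-1 ->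
    \int[P]_w (xi (i, 0%N) w ^+ 2 * Num.min 1 (a * `|xi (i, 0%N) w|)) <= e.
  apply: filter_forall => i.
  have [a0 a00 ha0] := truncated_moment_small (xi2 (i, 0%N)) e0.
  have /cvgrPdist_le/(_ _ a00) := @cvg_harmonic R; apply: filterS => m.
  rewrite /harmonic sub0r normrN ger0_norm ?invr_ge0// => h a ap am; apply: ha0 => //.
  exact: le_trans am h.
exists m.+1%:R^-1; first by [].
move=> a [i j] a0 am; have := hm m (leqnn m) i a a0 am; apply: le_trans.
rewrite le_eqVlt; apply/orP; left; apply/eqP.
pose h (x : R) := (sigma / sig (val i) * x) ^+ 2 * Num.min 1 (a * `|sigma / sig (val i) * x|).
have mh : measurable_fun setT h.
  have mz : measurable_fun setT (fun x : R => sigma / sig (val i) * x) by exact: measurable_funM.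
  apply: measurable_funM; first exact: measurable_funX.
  apply: measurable_minr => //; apply: measurable_funM => //.
  exact: measurableT_comp.
apply: (@D_law (val i) h j mh).
have [_ iX2] := xi2 (i, 0%N); apply: integrableR_le iX2.
  by apply: measurableT_comp => //; case: (D2 (val i) 0).
move=> w; rewrite /h -/(xi (i, 0%N) w).
have m0 : 0 <= Num.min 1 (a * `|xi (i, 0%N) w|) by rewrite le_min ler01 mulr_ge0// ltW.
rewrite ger0_norm ?(mulr_ge0 (sqr_ge0 _) m0)//.
by rewrite ler_piMr ?sqr_ge0// ge_min lexx.
Qed.

Let W2 k : sq_integrable P (W k).
Proof. by apply: sq_integrableZ; exact: sq_integrable_sum. Qed.

Let WV k : \int[P]_w (W k w ^+ 2) <= sigma ^+ 2.
Proof.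
under eq_Rintegral do rewrite exprMn.
rewrite RintegralT_Z; last by case: (sq_integrable_sum (s k) xi2).
rewrite second_moment_sum//.
under eq_bigr do rewrite xi_var.
have -> : \sum_(t <- s k) sigma ^+ 2 = (M k)%:R * sigma ^+ 2.
  by rewrite big_const_seq count_predT iter_addr_0 mulr_natl.
rewrite mulrA exprVn sqr_sqrtr// mulVf ?mul1r//.
by rewrite pnatr_eq0 -lt0n.
Qed.

(** The contribution of stratum [i] to [Z k - W k]. Since [sigma / sig i * q i = p i], the first
    case is a multiple of the difference treated in [anscombe]; in the second, [W k] has no term for
    the stratum. *)
Let B i k w := if sig i != 0 then sigma / sig i *
    (q i * Num.sqrt (N k)%:R / (n k i w)%:R * (\sum_(j < n k i w) D i j w) -
     (Num.sqrt (M k)%:R)^-1 * \sum_(j < n0 i k) D i j w)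
  else Num.sqrt (N k)%:R * (p i / (n k i w)%:R * \sum_(j < n k i w) D i j w).

Let mDsum i m : measurable_fun setT (fun w => \sum_(j < m) D i j w).
Proof. by apply: measurable_sum => j; case: (D2 i j). Qed.

Let mrandom i k : measurable_fun setT (fun w => \sum_(j < n k i w) D i j w).
Proof. by apply: (measurable_fun_random_index (F := fun m w => \sum_(j < m) D i j w)). Qed.

Let mB i k : measurable_fun setT (B i k).
Proof.
rewrite /B; case: (sig i != 0); apply: measurable_funM => //.
  apply: measurable_funB; last exact: measurable_funM.
  by apply: measurable_funM => //; apply: measurable_funM => //; exact: measurable_funV.
by apply: measurable_funM => //; apply: measurable_funM => //; exact: measurable_funV.
Qed.

Let Z k w := Num.sqrt (N k)%:R *
  (estimator p N (fun i j => Y i j w) r k - \sum_i p i * mu i).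

Let n_gt0 k i w : (0 < k)%N -> 0 < (n k i w)%:R :> R.
Proof. by move=> k0; rewrite ltr0n (leq_trans k0)// alloc_ge. Qed.

(** At [k = 0] the sizes are 0 and the empty averages cannot absorb the centring by [mu i], hence
    the condition on [k]. *)
Let ZW_B k w : (0 < k)%N -> Z k w - W k w = \sum_i B i k w.
Proof.
move=> k0; rewrite W_sum.
rewrite (sum_J (F := fun i => sigma / sig i *
  ((Num.sqrt (M k)%:R)^-1 * \sum_(j < n0 i k) D i j w))); last first.
  by move=> i ->; rewrite invr0 mulr0 mul0r.
rewrite /Z /estimator -sumrB mulr_sumr -sumrB; apply: eq_bigr => i _.
have nk := n_gt0 i w k0.
have -> : p i / (n k i w)%:R * \sum_(j < n k i w) Y i j w - p i * mu i =
    p i / (n k i w)%:R * \sum_(j < n k i w) D i j w.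
  rewrite /D sumrB sumr_const card_ord -[mu i *+ _]mulr_natl mulrBr; congr (_ - _).
  by rewrite mulrA divfK// gt_eqF.
rewrite /B; case: eqP => [->|/eqP si] /=; first by rewrite invr0 mulr0 mul0r subr0.
rewrite mulrBr; congr (_ - _); rewrite mulrA [RHS]mulrA; congr (_ * _).
by rewrite /q; field; rewrite si !gt_eqF.
Qed.

Let B0 i (del : R) : 0 < del -> (fun k => fine (P [set w | del < `|B i k w|])) @ \oo --> (0 : R).
Proof.
move=> del0; rewrite /B; have [si|si] := eqVneq (sig i) 0; last first.
  have c0 : 0 < sigma / sig i by rewrite divr_gt0// lt_neqAle eq_sym si sig0.
  have qi : 0 < q i by exact: (q0 (Sub i si)).
  have := @anscombe _ _ _ P (D i) (sig i ^+ 2) (D2 i) (@D_mean i) (@D_var i) (@iD i)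
    (fun k => n k i) N M (n0 i) (q i) qi (fun k => n_measurable k i) N_near N_oo
    (@alloc_ratio_in_prob i) (@n0_cvg (Sub i si)) NM_cvg (del / (sigma / sig i)) (divr_gt0 del0 c0).
  apply: cvg_trans; apply: near_eq_cvg; apply: nearW => k; congr (fine (P _)).
  by apply/seteqP; split=> w /=; rewrite normrM (gtr0_norm c0) ltr_pdivrMr// [_ * (sigma / _)]mulrC.
(* Strata of zero standard deviation: Kolmogorov's inequality with variance 0. *)
have vi j : \int[P]_w (D i j w ^+ 2) = 0 by rewrite D_var si expr0n.
apply/cvgrPdist_le => e e0; exists 1%N => // k /= k0.
rewrite (_ : fine _ = 0) ?subrr ?normr0 ?(ltW e0)//.
have Nk : 0 < (N k)%:R :> R by rewrite ltr0n N_gt0'.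
have pN : 0 < Num.sqrt (N k)%:R * p i by rewrite mulr_gt0// sqrtr_gt0.
apply/eqP; rewrite eq_le fine_ge0//= andbT.
have := @kolmogorov_window _ _ _ P (D i) 0 (D2 i) (@D_mean i) vi (@iD i) 0 (N k)
  (del / (Num.sqrt (N k)%:R * p i)) [set w | del < `|Num.sqrt (N k)%:R *
  (p i / (n k i w)%:R * \sum_(j < n k i w) D i j w)|] _ (divr_gt0 del0 pN).
rewrite mulr0 mul0r; apply.
  have := mB i k; rewrite /B si eqxx/= => m; exact: measurable_prob_gt.
(* The sizes sum to [N k], so the random size lies in the window [0, N k]; with variance 0 the
   length of the window costs nothing. *)
move=> w /= hw; exists (n k i w); split=> //.
  by rewrite add0n -(alloc_sum (fun i j => Y i j w) r p0 p1 N0 NS k)/= (bigD1 i)//= leq_addr.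
rewrite big_ord0 subr0 ler_pdivrMr// mulrC ltW// (lt_le_trans hw)//.
set S := \sum_(j < _) _.
have -> : Num.sqrt (N k)%:R * (p i / (n k i w)%:R * S) =
  (Num.sqrt (N k)%:R * p i) * ((n k i w)%:R^-1 * S) by ring.
rewrite normrM (gtr0_norm pN) ler_pM2l// normrM ger0_norm ?invr_ge0// ler_piMl//.
by rewrite invf_le1 ?n_gt0// ler1n -(ltr0n R) n_gt0.
Qed.

Theorem stratified_clt : cvg_in_law P Z (normal_prob 0 sigma).
Proof.
have mZ k : measurable_fun setT (Z k).
  apply: measurable_funM => //; apply: measurable_funB => //.
  exact: measurable_estimator.
apply: (cvg_in_law_normal sigma0 mZ W2 WV).
  move=> C g0 g1 g2 tg C0; apply: (lindeberg_clt (ltW sigma0) ixi xi2 xi_mean xi_var xi_tail tg) => //.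
move=> del del0; apply: cvg_trans (cvg_prob0_sum mB B0 del0).
apply: near_eq_cvg; exists 1%N => // k /= k0; congr (fine (P _)).
by apply/seteqP; split=> w /=; rewrite ZW_B.
Qed.

End core.

(** * Conditional laws *)

Section conditional_law.
Context d d' (Omega : measurableType d) (E : measurableType d') (R : realType)
  (P : probability Omega R) (X Y : Omega -> E) (A : set E).
Hypotheses (mX : measurable_fun setT X) (mY : measurable_fun setT Y).
Hypotheses (mA : measurable A) (pA : (0 < P (X @^-1` A))%E).
Hypothesis YX : has_cond_law P X A Y.

Let p := fine (P (X @^-1` A)).

Let mXA : measurable (X @^-1` A).
Proof. by rewrite -[X in measurable X]setTI; exact: mX. Qed.

Lemma cond_law_prob_gt0 : 0 < p.
Proof. by rewrite -lte_fin /p fineK// fin_num_measure. Qed.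

Lemma cond_law_off (B : set E) : measurable B -> B `&` A = set0 -> P (Y @^-1` B) = 0%E.
Proof. by move=> mB BA; rewrite YX// BA preimage_set0 measure0 mul0r. Qed.

(** On subsets of [A] the law of [X] is [p] times the law of [Y], and [Y] gives no mass to the
    complement of [A]. *)
Lemma ge0_integral_cond_law (h : E -> R) : measurable_fun setT h -> (forall x, 0 <= h x) ->
  (\int[P]_(w in X @^-1` A) (h (X w))%:E = p%:E * \int[P]_w (h (Y w))%:E)%E.
Proof.
move=> mh h0; have p0 := cond_law_prob_gt0.
have mEh : measurable_fun setT (EFin \o h) by exact/measurable_EFinP.
have mEhA : measurable_fun A (EFin \o h) by exact: measurable_funTS.
have -> : (\int[P]_(w in X @^-1` A) (h (X w))%:E = \int[law P mX]_(x in A) (h x)%:E)%E.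
  by rewrite ge0_integral_pushforward// => x _; rewrite lee_fin.
have -> : (\int[P]_w (h (Y w))%:E = \int[law P mY]_x (h x)%:E)%E.
  by rewrite ge0_integral_law// => x; rewrite lee_fin.
pose pn : {nonneg R} := NngNum (ltW p0).
have -> : (\int[law P mY]_x (h x)%:E = \int[law P mY]_(x in A) (h x)%:E)%E.
  rewrite -(setUv A) ge0_integral_setU//; [|exact: measurableC|by rewrite setUv|by move=> x _; rewrite lee_fin|].
    rewrite [X in (_ + X)%E](_ : _ = 0%E) ?adde0//.
    apply: null_set_integral => //; first exact: measurableC.
      exact: measurable_funTS.
    exact: (cond_law_off (measurableC mA) (setICl A)).
  by apply/disj_setPCl.
rewrite -(@ge0_integral_mscale _ _ _ (law P mY) A mA pn (EFin \o h) mEhA)//.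
apply: eq_measure_integral => B mB BA.
transitivity (p%:E * P (Y @^-1` B))%E; last by [].
rewrite YX// (setIidl BA) -EFinM mulrC divfK ?gt_eqF// fineK ?fin_num_measure//.
  by rewrite -[X in measurable X]setTI; exact: mX.
by move=> x _; rewrite lee_fin.
Qed.

Lemma integrable_cond_law (h : E -> R) : measurable_fun setT h ->
  integrableR P (fun w => h (X w)) -> integrableR P (fun w => h (Y w)).
Proof.
move=> mh ih; have p0 := cond_law_prob_gt0.
apply/integrableP; split; first by apply/measurable_EFinP; exact: measurableT_comp.
have mah : measurable_fun setT (fun x => `|h x|) by exact: measurableT_comp.
have /= E1 := ge0_integral_cond_law mah (fun=> normr_ge0 _).
have : (\int[P]_(w in X @^-1` A) `|h (X w)|%:E < +oo)%E.
  have /integrableP[_] := integrableS measurableT mXA (@subsetT _ _) ih.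
  by [].
rewrite E1; have : (0 <= \int[P]_w `|h (Y w)|%:E)%E by apply: integral_ge0 => w _; rewrite lee_fin.
rewrite /=; case: (\int[P]_w _)%E => [x _ _||]//; first exact: ltry.
by rewrite gt0_muley ?lte_fin.
Qed.

Lemma cond_expect_law (h : E -> R) : measurable_fun setT h ->
  integrableR P (fun w => h (X w)) -> cond_expect P X A h = \int[P]_w h (Y w).
Proof.
move=> mh ih; have p0 := cond_law_prob_gt0; have ihY := integrable_cond_law mh ih.
have ge0 (g : E -> R) : measurable_fun setT g -> (forall x, 0 <= g x) ->
    integrableR P (fun w => g (X w)) ->
    \int[P]_(w in X @^-1` A) g (X w) = p * \int[P]_w g (Y w).
  move=> mg g0 ig; rewrite /Rintegral ge0_integral_cond_law// fineM//.
  by apply: integrable_fin_num => //; exact: integrable_cond_law.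
have mah : measurable_fun setT (fun x => `|h x|) by exact: measurableT_comp.
have iah : integrableR P (fun w => `|h (X w)|) by exact: integrableR_abs.
have m2 : measurable_fun setT (fun x => h x + `|h x|) by exact: measurable_funD.
have i2 : integrableR P (fun w => h (X w) + `|h (X w)|) by exact: integrableRD.
have h2 x : 0 <= h x + `|h x| by rewrite -lerBlDl sub0r ler_normr lexx orbT.
have onD (g : Omega -> R) : integrableR P g -> P.-integrable (X @^-1` A) (EFin \o g).
  by move=> ig; exact: integrableS ig.
rewrite /cond_expect -/p.
(* Writing [h] as [(h + |h|) - |h|] reduces the claim to nonnegative integrable functions. *)
have -> : fine (\int[P]_(w in X @^-1` A) (h (X w))%:E) =
    \int[P]_(w in X @^-1` A) (h (X w) + `|h (X w)| - `|h (X w)|).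
  by apply: eq_Rintegral => w _; rewrite addrK.
rewrite RintegralB//; [|exact: onD|exact: onD].
rewrite (ge0 _ m2 h2 i2) (ge0 _ mah (fun=> normr_ge0 _) iah) -mulrBr mulrC mulKf ?gt_eqF//.
rewrite -(RintegralT_B (integrable_cond_law m2 i2) (integrable_cond_law mah iah)).
by apply: eq_Rintegral => w _; rewrite addrK.
Qed.

End conditional_law.

(** The state space is an arbitrary measurable space, R^d being an instance. The proof passes to the
    real variables [f (Xs i j)], whose law depends on [i] only, and rewrites the conditional moments
    of [f (X)] as their moments. *)
Theorem theorem2p1 (R : realType) (d : measure_display) (Omega : measurableType d)
  (P : probability Omega R) (d' : measure_display) (E : measurableType d')
  (X : Omega -> E) (f : E -> R) (I : nat) (A : 'I_I -> set E)
  (Xs : 'I_I -> nat -> Omega -> E) (N : nat -> nat) (r : alloc_rule) :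
  measurable_fun setT X ->
  measurable_fun setT f ->
  (forall i, measurable (A i)) ->
  (forall i j, i != j -> A i `&` A j = set0) ->
  (forall x, exists i, A i x) ->
  (forall i, (0 < P (X @^-1` A i))%E) ->
  (forall i j, measurable_fun setT (Xs i j)) ->
  (forall i j, has_cond_law P X (A i) (Xs i j)) ->
  mutually_independent P (fun t : 'I_I * nat => Xs t.1 t.2) ->
  P.-integrable setT (fun w => ((f (X w)) ^+ 2)%:E) ->
  (* hypothesis (H) *)
  (exists i, 0 < Num.sqrt (cond_var P X (A i) f)) ->
  N 0%N = 0%N ->
  (forall k, (N k + I <= N k.+1)%N) ->
  (fun k => k%:R / (N k)%:R : R) @ \oo --> (0 : R) ->
  let p i := fine (P (X @^-1` A i)) in
  let c := fine (\int[P]_w (f (X w))%:E) in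
  let sigma_star := \sum_(i < I) p i * Num.sqrt (cond_var P X (A i) f) in
  cvg_in_law P
    (fun k w => Num.sqrt (N k)%:R *
        (estimator p N (fun i j => f (Xs i j w)) r k - c))
    (normal_prob 0 sigma_star).
Proof.
move=> mX mf mA A_disj A_cover pA mXs lXs iXs f2 H N0 NS kN p c sigma_star.
have p0 i : 0 < p i by exact: cond_law_prob_gt0.
have fX2 : sq_integrable P (f \o X) by split=> //; exact: measurableT_comp.
have ifX : integrableR P (f \o X) by exact: sq_integrable_integrable.
have mXA i : measurable (X @^-1` A i) by rewrite -[X in measurable X]setTI; exact: mX.
(* Exactly one stratum contains [X w]. Integrating this identity gives both the total mass of the
   [p i] and the decomposition of the mean [c]. *)
have partition w (g : 'I_I -> R) i : A i (X w) ->
    \sum_j (if w \in X @^-1` A j then g j else 0) = g i.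
  move=> Ai; rewrite (bigD1 i)//= mem_set// big1 ?addr0// => j ji.
  rewrite memNset// => Aj; have : (A j `&` A i) (X w) by split.
  by rewrite A_disj.
have p1 : \sum_i p i = 1.
  rewrite /p; under eq_bigr => i _ do rewrite -(RintegralT_indic P (mXA i)).
  rewrite -RintegralT_sum => [|i]; last exact: integrableR_indic.
  rewrite -[RHS](RintegralT_cst P); apply: eq_Rintegral => w _.
  have [i Ai] := A_cover (X w); rewrite -[RHS](partition w (fun=> 1) i Ai).
  by apply: eq_bigr => j _; rewrite indicE; case: (w \in _).
pose Y i j w := f (Xs i j w).
have Y2 i j : sq_integrable P (Y i j).
  split; first exact: measurableT_comp.
  have mf2 : measurable_fun setT (fun x => f x ^+ 2) by exact: measurable_funX.
  exact: (integrable_cond_law mX (mXs i j) (mA i) (pA i) (lXs i j) mf2 f2).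
have lY i j B : measurable B -> P (Y i j @^-1` B) = P (Y i 0%N @^-1` B).
  move=> mB; have mfB : measurable (f @^-1` B) by rewrite -[X in measurable X]setTI; exact: mf.
  exact: etrans (lXs i j _ mfB) (esym (lXs i 0%N _ mfB)).
have iY : mutually_independent P (fun t : 'I_I * nat => Y t.1 t.2).
  by have := mutually_independent_comp (fun _ : 'I_I * nat => mf) iXs.
have muE i : cond_expect P X (A i) f = \int[P]_w Y i 0%N w.
  exact: (cond_expect_law mX (mXs i 0%N) (mA i) (pA i) (lXs i 0%N) mf ifX).
have sigE i : cond_var P X (A i) f = \int[P]_w ((Y i 0%N w - \int[P]_w Y i 0%N w) ^+ 2).
  rewrite /cond_var muE; set m := \int[P]_w _.
  have mg : measurable_fun setT (fun x => (f x - m) ^+ 2).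
    by apply: measurable_funX; exact: measurable_funB.
  apply: (cond_expect_law mX (mXs i 0%N) (mA i) (pA i) (lXs i 0%N) mg).
  have [] // := sq_integrableD fX2 (sq_integrable_cst P (- m)).
have cE : c = \sum_i p i * \int[P]_w Y i 0%N w.
  transitivity (\sum_i \int[P]_(w in X @^-1` A i) f (X w)); last first.
    apply: eq_bigr => i _; rewrite -muE /cond_expect mulrCA divff ?mulr1//.
    by rewrite gt_eqF// p0.
  under eq_bigr do rewrite Rintegral_mkcond.
  rewrite -RintegralT_sum => [|i].
    apply: eq_Rintegral => w _; have [i Ai] := A_cover (X w).
    rewrite -[LHS](partition w (fun=> f (X w)) i Ai).
    by apply: eq_bigr => j _; rewrite /patch.
  have := integrableS measurableT (mXA i) (@subsetT _ _) ifX.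
  by rewrite integrable_mkcond// restrict_EFin.
have sE : sigma_star =
    \sum_i p i * Num.sqrt (\int[P]_w ((Y i 0%N w - \int[P]_w Y i 0%N w) ^+ 2)).
  by apply: eq_bigr => i _; rewrite sigE.
rewrite sE cE.
apply: (stratified_clt (Y := Y)) => //.
by have [i hi] := H; exists i; rewrite -sigE.
Qed.
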